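(* Let $V$ be a non-zero finite dimensional $\mathbb{F}_q$-vector space. The singular locus of $Q_V$ is the union of all strata $\Omega_{V'}$ of codimension $\ge2$, that is, of the strata $\Omega_{V'}$ for all non-zero subspaces $V'\subset V$ with $\dim(V/V')\ge2$.
   Context: $\mathbb{F}_q$ is a finite field with $q$ elements. For a non-zero finite dimensional $\mathbb{F}_q$-vector space $V$, let $S_V$ be the symmetric algebra of $V$, $K_V$ its field of quotients, $R_V\subset K_V$ the $\mathbb{F}_q$-subalgebra generated by $\frac1v$ for all $v\in V\setminus\{0\}$, and $RS_V\subset K_V$ the subalgebra generated by $R_V$ and $S_V$, graded with each $v\in V\setminus\{0\}$ in degree $1$ and $\frac1v$ in degree $-1$. Set $Q_V:=\operatorname{Proj}R_V$ (formed after inverting the sign of the grading) and $\Omega_V:=\operatorname{Spec}RS_{V,0}$, where $RS_{V,0}$ is the degree $0$ part; since $RS_V$ is the localization of $R_V$ obtained by inverting all $\frac1v$, $\Omega_V$ is an open dense subscheme of $Q_V$. For a non-zero subspace $V'\subset V$ there is a closed embedding $i_*\colon Q_{V'}\hookrightarrow Q_V$ corresponding to the graded surjection $R_V\to R_{V'}$ with $\frac1v\mapsto\frac1v$ if $v\in V'$ and $\frac1v\mapsto0$ otherwise. The stratum $\Omega_{V'}\subset Q_V$ is the image of $\Omega_{V'}\hookrightarrow Q_{V'}\xrightarrow{i_*}Q_V$. The singular locus is the set of points whose local ring is not regular. *)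

(* Defs.v *)
From HB Require Import structures.
From mathcomp Require Import all_boot all_order all_algebra.
From mathcomp Require Import boolp classical_sets.
From mathcomp Require Import mpoly.

Import Order.TTheory GRing.Theory.
Local Open Scope classical_set_scope.
Local Open Scope ring_scope.

(** All the rings below are domains with a given embedding into a field [K], so
    a ring is a subset [A : set K]; ideals of [A] are subsets of [K] as well. *)
Section Subrings.
Context {K : fieldType}.
Implicit Types (A I m G : set K).

Definition ideal_of A I : Prop :=
  [/\ I `<=` A, I 0, forall x y, I x -> I y -> I (x + y)
    & forall a x, A a -> I x -> I (a * x)].

Definition prime_of A (P : set K) : Prop :=
  [/\ ideal_of A P, ~ P 1
    & forall a b, A a -> A b -> P (a * b) -> P a \/ P b].

Definition maximal_of A m : Prop :=
  [/\ ideal_of A m, ~ m 1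
    & forall I, ideal_of A I -> m `<=` I -> ~ I 1 -> I = m].

Definition ideal_gen A G : set K := smallest (ideal_of A) G.

Definition noetherian A : Prop :=
  forall I, ideal_of A I -> exists s : seq K, I = ideal_gen A [set` s].

Definition prime_chain A (n : nat) (P : nat -> set K) : Prop :=
  (forall i, (i <= n)%N -> prime_of A (P i)) /\
  (forall i, (i < n)%N -> P i `<` P i.+1).

Definition krull_dim A (d : nat) : Prop :=
  (exists P, prime_chain A d P) /\
  (forall n P, prime_chain A n P -> (n <= d)%N).

(** A Noetherian local ring whose maximal ideal is generated by as many
    elements as the Krull dimension of the ring. *)
Definition regular_local A : Prop :=
  noetherian A /\
  exists m, [/\ maximal_of A m, forall m', maximal_of A m' -> m' = m
    & exists d, krull_dim A d /\
      exists s : d.-tuple K, m = ideal_gen A [set` s]].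

End Subrings.

Section DrinfeldCompactification.
Context {F : finFieldType}.

(** The symmetric algebra [S_V] is the polynomial ring in the coordinates of
    the chosen basis [vbasis {:V}], and [K_V] is its field of fractions. *)
Definition symalg (V : vectType F) := {mpoly F[\dim {:V}]}.

Definition KV (V : vectType F) : fieldType := {fraction symalg V}.

Definition scal {V : vectType F} (c : F) : KV V :=
  tofrac (c%:MP : symalg V).

Definition elt {V : vectType F} (v : V) : KV V :=
  tofrac (\sum_(i < \dim {:V}) coord (vbasis {:V}) i v *: 'X_i : symalg V).

Definition subalgebra {V : vectType F} (A : set (KV V)) : Prop :=
  [/\ forall c : F, A (scal c), forall x y, A x -> A y -> A (x + y)
    & forall x y, A x -> A y -> A (x * y)].

Definition Vlin (V : vectType F) : set (KV V) :=
  [set elt v | v in [set v : V | v != 0]].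

Definition Vinv (V : vectType F) : set (KV V) :=
  [set (elt v)^-1 | v in [set v : V | v != 0]].

Definition RV (V : vectType F) : set (KV V) := smallest subalgebra (Vinv V).

Definition RSV (V : vectType F) : set (KV V) :=
  smallest subalgebra (Vinv V `|` Vlin V).

(** [graded_part G d] is the degree [d] part of the subalgebra generated by
    the sets [G e], where the elements of [G e] are put in degree [e]. *)
Inductive graded_part {V : vectType F} (G : int -> set (KV V)) :
  int -> set (KV V) :=
| graded_scal c : graded_part G 0 (scal c)
| graded_gen d x : G d x -> graded_part G d x
| graded_zero d : graded_part G d 0
| graded_add d x y :
    graded_part G d x -> graded_part G d y -> graded_part G d (x + y)
| graded_mul d e x y :
    graded_part G d x -> graded_part G e y -> graded_part G (d + e) (x * y).

Definition RV_gens (V : vectType F) (d : int) : set (KV V) :=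
  [set x | d = -1 /\ Vinv V x].

Definition RSV_gens (V : vectType F) (d : int) : set (KV V) :=
  [set x | (d = -1 /\ Vinv V x) \/ (d = 1 /\ Vlin V x)].

(** The sign of the grading is inverted here: [RVdeg V n] is the part of [R_V]
    spanned by the products of [n] reciprocals of non-zero vectors. *)
Definition RVdeg (V : vectType F) (n : nat) : set (KV V) :=
  graded_part (RV_gens V) (- n%:Z).

Definition RSV0 (V : vectType F) : set (KV V) := graded_part (RSV_gens V) 0.

Definition homogeneous {V : vectType F} (I : set (KV V)) : Prop :=
  forall x, I x -> exists (n : nat) (f : nat -> KV V),
    (forall i, RVdeg V i (f i) /\ I (f i)) /\ x = \sum_(i < n) f i.

(** The points of [Proj R_V]. *)
Definition QV (V : vectType F) : set (set (KV V)) :=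
  [set p | [/\ prime_of (RV V) p, homogeneous p
    & exists n x, [/\ (0 < n)%N, RVdeg V n x & ~ p x]]].

(** The homogeneous localization of [R_V] at [p], as a subring of [K_V]. *)
Definition stalk {V : vectType F} (p : set (KV V)) : set (KV V) :=
  [set x | exists n a b,
    [/\ RVdeg V n a, RVdeg V n b, ~ p b & x = a / b]].

Definition singular_locus (V : vectType F) : set (set (KV V)) :=
  [set p | QV V p /\ ~ regular_local (stalk p)].

(** The image of [Spec RS_{V,0}] in [Proj R_V].  The ring [RS_V] is
    the localization of [R_V] at all the [1/v], and it has units in degree 1;
    the open immersion thus sends [P] to the contraction of [P RS_V] to
    [R_V]. *)
Definition OmegaV (V : vectType F) : set (set (KV V)) :=
  [set p | exists2 P, prime_of (RSV0 V) P
    & p = RV V `&` ideal_gen (RSV V) P].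

(** [phi] restricts to the algebra homomorphism [R_V -> R_V'] with [1/v |-> 1/v]
    if [v \in V'] and [1/v |-> 0] otherwise; its values outside [R_V] are
    irrelevant.  The subspace [V'] as a vector space is [subvs_of V']. *)
Definition is_restriction {V : vectType F} (V' : {vspace V})
    (phi : KV V -> KV (subvs_of V')) : Prop :=
  [/\ forall c : F, phi (scal c) = scal c,
      forall x y, RV V x -> RV V y -> phi (x + y) = phi x + phi y,
      forall x y, RV V x -> RV V y -> phi (x * y) = phi x * phi y,
      forall u : subvs_of V', u != 0 -> phi ((elt (vsval u))^-1) = (elt u)^-1
    & forall v : V, v \notin V' -> phi ((elt v)^-1) = 0].

(** The image of [Omega_V'] under the closed embedding of [Q_V'] in [Q_V], which
    sends [q] to its preimage in [R_V]. *)
Definition stratum {V : vectType F} (V' : {vspace V}) : set (set (KV V)) :=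
  [set p | exists2 phi, is_restriction V' phi
    & exists2 q, OmegaV (subvs_of V') q & p = RV V `&` phi @^-1` q].

End DrinfeldCompactification.

(* Main.v *)
Require Import Defs.
From mathcomp Require Import all_boot all_order all_algebra.
From mathcomp Require Import boolp classical_sets.
From mathcomp Require Import mpoly.
From mathcomp Require Import ring zify.
Import GRing.Theory.
Local Open Scope classical_set_scope.
Local Open Scope ring_scope.

(** Let [p] be a point of [Q_V].  The relation
    [1/u * 1/v = 1/(u + v) * (1/u + 1/v)] and primality show that the vectors
    [v] with [1/v] not in [p], together with [0], form a subspace [V'], nonzero
    since [p] does not contain all the elements of positive degree ([support]).
    The point [p] contains the other reciprocals, which generate the kernel of
    the restriction [R_V -> R_V'] ([restriction_kernel]), so that it comes from a
    point of the open stratum of [Q_V'].  Hence [p] lies in the stratum of [V']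
    and in no other one ([stratum_properties], [mem_stratum]), and it is to be
    shown that its local ring is regular if and only if [V'] has codimension at
    most one.

    Choose [v1] in [V'] nonzero.  In codimension at most one, the local ring is
    the localization at a prime of the subring generated by the ratios [u / v1]
    for [u] in [V'] and, if [V'] is a hyperplane, by [s = v1 / vr] for some [vr]
    outside [V']: indeed, [v1 / (u + c vr) = s / (s u / v1 + c)], and [s] vanishes
    at [p] ([regular_stalk]).  This subring is a polynomial ring, built by
    adjoining transcendental elements one by one.  All local rings of a
    polynomial ring are regular because regularity passes from [A] to [A[x]]: a
    prime of [A[x]] over [P] is either [P[x]] or is generated, locally, by [P] and
    one more polynomial, and the chains of primes grow by as many terms as the
    lists of generators ([adj_regular]).  Krull's height theorem
    ([krull_height]) shows that no chain is longer.

    In codimension at least two, take [v] and [w] independent modulo [V'].  Then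
    [x = v1 / v], [y = v1 / w] and [z = v1 / (v + w)] belong to the maximal ideal
    [m] and satisfy [x y = (x + y) z].  They are independent modulo [m ^ 2]: each
    of the three directions outside [V'] defines a derivation of [R_V] over the
    restriction to [V'], the second term of an expansion at infinity, which kills
    the other two ([restriction_derivation], [square_coefficient]).  In a regular
    local ring such a relation is impossible: extend [x], [x - y], [z] to a minimal
    list of generators of [m]; the ideal generated by all of them but [x] contains
    [x ^ 2], so that Krull's height theorem bounds the dimension by one less than
    the number of generators ([quadratic_not_regular]).

    Transcendence statements are all proved in the same way, with a ring morphism
    from the symmetric algebra to polynomials over it: a translation or a
    homothety with indeterminate parameter fixes the smaller ring and moves the
    element ([fixed_transcendental]).  The restriction maps exist because they are
    limits: a morphism that sends the vectors of [V'] to constants and the other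
    vectors to polynomials of positive degree induces them by evaluation at
    infinity ([degeneration]). *)

Set Implicit Arguments.
Unset Strict Implicit.
Unset Printing Implicit Defensive.

(** * Noetherian subrings of a field *)
Section Ideals.
Context {K : fieldType}.
Implicit Types A I J L P G : set K.

Definition subring A :=
  [/\ A 1, forall x y, A x -> A y -> A (x - y)
    & forall x y, A x -> A y -> A (x * y)].

(** The ideal generated by a list, in a form suited to induction on the list. *)
Fixpoint span A (s : seq K) : set K :=
  if s is y :: s' then [set x | exists2 a, A a & span A s' (x - a * y)]
  else [set 0].

Lemma span_mono A B (s : seq K) : A `<=` B -> span A s `<=` span B s.
Proof.
move=> AB; elim: s => //= y s IH x [a Aa H].
by exists a; [exact: AB|exact: IH].
Qed.

Section Closure.
Variable A : set K.
Hypothesis rA : subring A.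

Lemma subring1 : A 1. Proof. by case: rA. Qed.
Lemma subringB x y : A x -> A y -> A (x - y).
Proof. by case: rA => _ h _; apply: h. Qed.
Lemma subringM x y : A x -> A y -> A (x * y).
Proof. by case: rA => _ _; apply. Qed.
Lemma subring0 : A 0.
Proof. by rewrite -(subrr 1); apply: subringB subring1 subring1. Qed.
Lemma subringN x : A x -> A (- x).
Proof. by rewrite -sub0r; apply: subringB subring0. Qed.
Lemma subringD x y : A x -> A y -> A (x + y).
Proof. by move=> Ax Ay; rewrite -[y]opprK; apply/subringB/subringN. Qed.
Lemma subringX x n : A x -> A (x ^+ n).
Proof.
move=> Ax; elim: n => [|n IH]; first exact: subring1.
by rewrite exprS; apply: subringM.
Qed.
Lemma subring_sum n (f : nat -> K) :
  (forall i, A (f i)) -> A (\sum_(i < n) f i).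
Proof. by move=> Af; elim/big_ind: _; [exact: subring0|exact: subringD|]. Qed.

Section OneIdeal.
Variable I : set K.
Hypothesis iI : ideal_of A I.

Lemma idealS : I `<=` A. Proof. by case: iI. Qed.
Lemma ideal0 : I 0. Proof. by case: iI. Qed.
Lemma idealD x y : I x -> I y -> I (x + y).
Proof. by case: iI => _ _ h _; apply: h. Qed.
Lemma idealMl a x : A a -> I x -> I (a * x).
Proof. by case: iI => _ _ _; apply. Qed.
Lemma idealMr a x : A a -> I x -> I (x * a).
Proof. by rewrite mulrC; apply: idealMl. Qed.
Lemma idealN x : I x -> I (- x).
Proof. by rewrite -mulN1r; apply: idealMl; apply/subringN/subring1. Qed.
Lemma idealB x y : I x -> I y -> I (x - y).
Proof. by move=> Ix Iy; apply/idealD/idealN. Qed.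
Lemma ideal_sum n (f : nat -> K) :
  (forall i, I (f i)) -> I (\sum_(i < n) f i).
Proof. by move=> If; elim/big_ind: _; [exact: ideal0|exact: idealD|]. Qed.
Lemma ideal_full : I 1 -> forall a, A a -> I a.
Proof. by move=> I1 a Aa; rewrite -[a]mulr1; apply: idealMl. Qed.

End OneIdeal.

Lemma ideal_self : ideal_of A A.
Proof. by split=> //; [exact: subring0|exact: subringD|exact: subringM]. Qed.

Lemma ideal_null : ideal_of A [set 0].
Proof.
split=> [x ->|//|x y -> ->|a x _ ->] /=; rewrite ?addr0 ?mulr0 //.
exact: subring0.
Qed.

Lemma prime_ideal P : prime_of A P -> ideal_of A P. Proof. by case. Qed.
Lemma primeN1 P : prime_of A P -> ~ P 1. Proof. by case. Qed.
Lemma primeM P a b : prime_of A P -> A a -> A b -> P (a * b) -> P a \/ P b.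
Proof. by case=> _ _; apply. Qed.
Lemma primeNM P a b :
  prime_of A P -> A a -> A b -> ~ P a -> ~ P b -> ~ P (a * b).
Proof. by move=> pP Aa Ab nPa nPb /(primeM pP Aa Ab)[]. Qed.
Lemma primeX P a n : prime_of A P -> A a -> P (a ^+ n) -> P a.
Proof.
move=> pP Aa; elim: n => [|n IH]; first by move/(primeN1 pP).
by rewrite exprS => /(primeM pP Aa (subringX n Aa))[|/IH].
Qed.

Lemma span_ideal (s : seq K) : all (fun y => `[< A y >]) s -> ideal_of A (span A s).
Proof.
elim: s => [_|y s IH /= /andP[/asboolP Ay As]]; first exact: ideal_null.
have iS := IH As; split.
- move=> x [a Aa /(idealS iS) H]; rewrite -(subrK (a * y) x).
  exact/subringD/subringM.
- by exists 0; [exact: subring0|rewrite mul0r subr0; exact: ideal0 iS].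
- move=> x z [a Aa Hx] [b Ab Hz]; exists (a + b); first exact: subringD.
  by rewrite mulrDl opprD addrACA; apply: idealD iS _ _ Hx Hz.
- move=> c x Ac [a Aa Hx]; exists (c * a); first exact: subringM.
  by rewrite -mulrA -mulrBr; apply: idealMl iS _ _ Ac Hx.
Qed.

Lemma mem_span (s : seq K) y : y \in s -> span A s y.
Proof.
elim: s => // z s IH; rewrite inE => /orP[/eqP ->|ys] /=.
  exists 1; first exact: subring1.
  rewrite mul1r subrr {IH}; elim: s => //= w s IH.
  by exists 0; [exact: subring0|rewrite mul0r subr0].
by exists 0; [exact: subring0|rewrite mul0r subr0; apply: IH].
Qed.

Lemma span_min (s : seq K) I : ideal_of A I -> {in s, forall y, I y} -> span A s `<=` I.
Proof.
move=> iI; elim: s => [_ x ->|y s IH Is x [a Aa H]]; first exact: ideal0 iI.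
rewrite -(subrK (a * y) x); apply: (idealD iI).
  by apply: IH H => z zs; apply: Is; rewrite inE zs orbT.
by apply: idealMl => //; apply: Is; rewrite inE eqxx.
Qed.

Lemma all_subset (s : seq K) : {in s, forall y, A y} -> all (fun y => `[< A y >]) s.
Proof. by move=> h; apply/allP => y /h /asboolP. Qed.

Lemma ideal_gen_ideal G : G `<=` A -> ideal_of A (ideal_gen A G).
Proof.
move=> GA; split.
- by apply: smallest_sub => //; exact: ideal_self.
- by move=> I [iI _]; apply: ideal0 iI.
- by move=> x y Gx Gy I h; apply: idealD (h.1) _ _ (Gx I h) (Gy I h).
- by move=> a x Aa Gx I h; apply: idealMl (h.1) _ _ Aa (Gx I h).
Qed.

Lemma ideal_gen_span (s : seq K) :
  {in s, forall y, A y} -> ideal_gen A [set` s] = span A s.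
Proof.
move=> sA; apply/seteqP; split.
  apply: smallest_sub => [|y /= ys]; first exact/span_ideal/all_subset.
  exact: mem_span.
by apply: span_min => [|y ys]; [exact: ideal_gen_ideal|exact: sub_gen_smallest].
Qed.

End Closure.

Lemma noetherian_span A I : subring A -> noetherian A -> ideal_of A I ->
  exists2 s, {in s, forall y, I y} & I = span A s.
Proof.
move=> rA nA iI; have [s Is] := nA _ iI; have sI : {in s, forall y, I y}.
  by move=> y ys; rewrite Is; apply: sub_gen_smallest.
by exists s; rewrite // Is ideal_gen_span // => y /sI /(idealS iI).
Qed.

(** The ascending chain condition, as a maximum principle for a family of
    ideals indexed by any type: otherwise some sequence of the family increases
    strictly, and its union has no finite list of generators. *)
Lemma noetherian_max A (T : Type) (D : T -> Prop) (f : T -> set K) t0 :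
  subring A -> noetherian A -> (forall t, D t -> ideal_of A (f t)) -> D t0 ->
  exists2 t, D t & forall t', D t' -> f t `<=` f t' -> f t' `<=` f t.
Proof.
move=> rA nA iD D0; apply: contrapT => noMax.
have next t : {t' | D t -> [/\ D t', f t `<=` f t' & ~ f t' `<=` f t]}.
  apply: cid; have [Dt|nDt] := pselect (D t); last by exists t.
  apply: contrapT => nt; apply: noMax; exists t => // t' Dt' le.
  by apply: contrapT => nle; apply: nt; exists t'.
pose u n := iter n (fun t => sval (next t)) t0.
have Du n : D (u n) by elim: n => // n IH; case: (svalP (next (u n)) IH).
have le_u m n : (m <= n)%N -> f (u m) `<=` f (u n).
  elim: n => [|n IH]; first by rewrite leqn0 => /eqP ->.
  rewrite leq_eqVlt => /orP[/eqP -> //|/IH le].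
  by apply: subset_trans le _; case: (svalP (next (u n)) (Du n)).
pose U := \bigcup_n f (u n).
have iU : ideal_of A U.
  split.
  - by move=> x [n _ ux]; apply: idealS (iD _ (Du n)) _ ux.
  - by exists 0%N => //; apply: ideal0 (iD _ _).
  - move=> x y [m _ ux] [n _ uy]; exists (maxn m n) => //.
    apply: (idealD (iD _ (Du _))).
      by apply: le_u ux; rewrite leq_maxl.
    by apply: le_u uy; rewrite leq_maxr.
  - by move=> a x Aa [n _ ux]; exists n => //; apply: (idealMl (iD _ (Du _))).
have [s sU Us] := noetherian_span rA nA iU.
have [k sk] : exists k, {in s, forall y, f (u k) y}.
  elim: s sU {Us} => [_|y s IH sU]; first by exists 0%N.
  have [n _ uy] : U y by apply: sU; rewrite inE eqxx.
  have [|k sk] := IH; first by move=> z zs; apply: sU; rewrite inE zs orbT.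
  exists (maxn n k) => z; rewrite inE => /orP[/eqP ->|/sk uz].
    by apply: le_u uy; rewrite leq_maxl.
  by apply: le_u uz; rewrite leq_maxr.
case: (svalP (next (u k)) (Du k)) => _ _; apply=> x ux.
by apply: (span_min (iD _ (Du k)) sk); rewrite -Us; exists k.+1.
Qed.

(** * Krull's height theorem *)

(** The principal ideal theorem for the quotient by [q0].  Suppose that [m] is
    the only prime between [q0 + (x)] and [m], and pick [a] in [q] but not in
    [q0].  Among the ideals that are saturated with respect to the complement
    of [m] (they stand for the ideals of the local ring at [m]), those above
    [x] and [q0] satisfy the descending chain condition, since the local ring
    modulo [q0 + (x)] is Artinian.  Applied to the contractions [Q n] of
    [(a ^+ n) + q0] from the local ring at [q], this and Nakayama's lemma give
    [Q n = Q n.+1] for some [n], whence [a] is in [q0]. *)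
Section PrincipalIdeal.
Variables (A q0 q m : set K) (x : K).
Hypotheses (rA : subring A) (nA : noetherian A).
Hypotheses (pq0 : prime_of A q0) (pq : prime_of A q) (pm : prime_of A m).
Hypotheses (q0q : q0 `<` q) (qm : q `<` m) (mx : m x) (q0x : ~ q0 x).
Hypothesis qx : ~ q x.
Hypothesis only_m :
  forall P, prime_of A P -> q0 `<=` P -> P `<=` m -> P x -> P = m.

Let iq0 : ideal_of A q0 := prime_ideal pq0.
Let im : ideal_of A m := prime_ideal pm.
Let iq : ideal_of A q := prime_ideal pq.
Let Ax : A x := idealS im mx.

Let saturated I := forall s a, A s -> ~ m s -> A a -> I (s * a) -> I a.

Let saturation I : set K := [set a | A a /\ exists s, [/\ A s, ~ m s & I (s * a)]].

Let saturation_ideal I : ideal_of A I -> ideal_of A (saturation I).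
Proof.
move=> iI; split.
- by move=> a [].
- split; first exact: subring0.
  exists 1; split; [exact: subring1|exact: primeN1 pm|].
  by rewrite mulr0; apply: ideal0 iI.
- move=> a b [Aa [s [As ms Isa]]] [Ab [t [At mt Itb]]].
  split; first exact: subringD.
  exists (s * t); split; [exact: subringM|exact: (primeNM pm)|].
  have -> : s * t * (a + b) = t * (s * a) + s * (t * b) by ring.
  by apply: (idealD iI); apply: (idealMl iI).
- move=> a b Aa [Ab [s [As ms Isb]]]; split; first exact: subringM.
  exists s; split=> //; have -> : s * (a * b) = a * (s * b) by ring.
  exact: (idealMl iI).
Qed.

Let saturation_saturated I : saturated (saturation I).
Proof.
move=> s a As ms Aa [_ [t [At mt H]]]; split=> //.
exists (t * s); split; [exact: subringM|exact: (primeNM pm)|].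
by rewrite -mulrA.
Qed.

Let sub_saturation I : ideal_of A I -> I `<=` saturation I.
Proof.
move=> iI a Ia; split; first exact: idealS Ia.
by exists 1; split; rewrite ?mul1r //; [exact: subring1|exact: primeN1 pm].
Qed.

Let plus I g : set K := [set c | exists2 a, A a & I (c - a * g)].

Let plus_ideal I g : ideal_of A I -> A g -> ideal_of A (plus I g).
Proof.
move=> iI Ag; split.
- move=> c [a Aa /(idealS iI) H]; rewrite -(subrK (a * g) c).
  by apply: subringD => //; apply: subringM.
- by exists 0; [exact: subring0|rewrite mul0r subr0; apply: ideal0 iI].
- move=> c d [a Aa H] [b Ab H']; exists (a + b); first exact: subringD.
  by rewrite mulrDl opprD addrACA; apply: idealD iI _ _ H H'.
- move=> c d Ac [a Aa H]; exists (c * a); first exact: subringM.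
  by rewrite -mulrA -mulrBr; apply: idealMl iI _ _ Ac H.
Qed.

Let sub_plus I g : ideal_of A I -> I `<=` plus I g.
Proof. by move=> iI c Ic; exists 0; [exact: subring0|rewrite mul0r subr0]. Qed.

Let mem_plus I g : ideal_of A I -> plus I g g.
Proof.
by move=> iI; exists 1; [exact: subring1|rewrite mul1r subrr; apply: ideal0 iI].
Qed.

(** [m] is an associated prime of each proper saturated ideal above [x] and
    [q0]: a maximal annihilator modulo that ideal is prime, hence is [m]. *)
Let socle L : ideal_of A L -> saturated L -> q0 `<=` L -> L x -> ~ L 1 ->
  exists g, [/\ A g, ~ L g & forall a, m a -> L (a * g)].
Proof.
move=> iL sL q0L Lx L1.
pose ann g : set K := [set a | A a /\ L (a * g)].
have iann g : A g /\ ~ L g -> ideal_of A (ann g).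
  move=> [Ag _]; split.
  - by move=> a [].
  - by split; [exact: subring0|rewrite mul0r; apply: ideal0 iL].
  - move=> a b [Aa La] [Ab Lb]; split; first exact: subringD.
    by rewrite mulrDl; apply: idealD iL _ _ La Lb.
  - move=> a b Aa [Ab Lb]; split; first exact: subringM.
    by rewrite -mulrA; apply: idealMl iL _ _ Aa Lb.
have D1 : A 1 /\ ~ L 1 by split=> //; apply: subring1.
have [g [Ag Lg] gmax] := noetherian_max rA nA iann D1.
have pann : prime_of A (ann g).
  split; [exact: iann|by case; rewrite mul1r|].
  move=> a b Aa Ab [_ Lab].
  have [Lbg|nLbg] := pselect (L (b * g)); first by right.
  left; split=> //.
  have [|||_ //] := gmax (b * g) _ _ a.
  - by split=> //; apply: subringM.
  - move=> c [Ac Lcg]; split=> //.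
    by rewrite mulrCA; apply: (idealMl iL).
  - by split=> //; rewrite mulrA.
exists g; split=> // a ma.
suff Em : ann g = m by move: ma; rewrite -Em => -[].
apply: only_m pann _ _ _.
- by move=> b q0b; split; [exact: idealS q0b|exact: (idealMr iL) (q0L _ q0b)].
- move=> b [Ab Lb]; apply: contrapT => mb; apply: Lg; exact: sL Ab mb Ag Lb.
- by split=> //; apply: (idealMr iL).
Qed.

Let stationary (I : nat -> set K) L :=
  exists N, forall n c, (N <= n)%N -> I n c -> L c -> I n.+1 c.

Let descending_chain (I : nat -> set K) :
  (forall n, ideal_of A (I n)) -> (forall n, saturated (I n)) ->
  (forall n, q0 `<=` I n) -> (forall n, I n x) ->
  (forall n, I n.+1 `<=` I n) -> exists n, I n `<=` I n.+1.
Proof.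
move=> iI sI q0I Ix decI.
have decI' n k : (n <= k)%N -> I k `<=` I n.
  elim: k => [|k IH]; first by rewrite leqn0 => /eqP ->.
  rewrite leq_eqVlt => /orP[/eqP -> //|/IH le].
  exact: subset_trans (decI k) le.
pose D L := [/\ ideal_of A L, saturated L, q0 `<=` L /\ L x & stationary I L].
have iq0x := plus_ideal iq0 Ax.
have D0 : D (saturation (plus q0 x)).
  split; [exact: saturation_ideal|exact: saturation_saturated| |].
    split; last exact/sub_saturation/mem_plus.
    by apply: subset_trans (sub_saturation iq0x); apply: sub_plus.
  exists 0%N => n c _ Ic [Ac [s [As ms [a Aa H]]]]; apply: (sI _ s) => //.
  rewrite -(subrK (a * x) (s * c)); apply: (idealD (iI _)).
    exact: q0I H.
  exact: (idealMl (iI _)).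
have [|L [iL sL [q0L Lx] [N stL]] Lmax] :=
  noetherian_max rA nA (f := id) _ D0; first by move=> L [].
have [L1|nL1] := pselect (L 1).
  exists N => c Ic; apply: stL => //.
  by apply: ideal_full iL L1 _ _; apply: idealS Ic.
have [g [Ag Lg mg]] := socle iL sL q0L Lx nL1.
pose L' := saturation (plus L g).
have LL' : L `<=` L'.
  by apply: subset_trans (sub_saturation (plus_ideal iL Ag)); apply: sub_plus.
case: Lg; apply: (Lmax L') => //; last first.
  exact/sub_saturation/mem_plus/iL/plus_ideal.
split; [exact/saturation_ideal/plus_ideal|exact: saturation_saturated| |].
  by split; [exact: subset_trans LL'|apply: LL'].
(* [L' / L] is simple, so either each [I n] meets [L'] outside [L], or, from
   some [n] on, [I n] and [L'] have the same intersection as [I n] and [L]. *)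
have decomp c : L' c -> ~ L c ->
    exists s a l, [/\ A s, ~ m s, A a & L l] /\ s * c = l + a * g /\ ~ m a.
  move=> [Ac [s [As ms [a Aa H]]]] nLc.
  exists s, a, (s * c - a * g); split=> //; split; first by rewrite subrK.
  move=> ma; apply/nLc/(sL s) => //; rewrite -(subrK (a * g) (s * c)).
  exact: (idealD iL) (mg _ ma).
have [meet|/existsNP[n1 nomeet]] :=
    pselect (forall n, exists c, [/\ I n c, L' c & ~ L c]); last first.
  exists (maxn N n1) => n c; rewrite geq_max => /andP[Nn n1n] Ic L'c.
  have [Lc|nLc] := pselect (L c); first exact: stL.
  by case: nomeet; exists c; split=> //; apply: decI' Ic.
exists N => n c Nn Ic L'c; have [Lc|nLc] := pselect (L c); first exact: stL.
have [s [a [l [[As ms Aa Ll] [Es _]]]]] := decomp c L'c nLc.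
have [c' [Ic' L'c' nLc']] := meet n.+1.
have [s' [a' [l' [[As' ms' Aa' Ll'] [Es' ma']]]]] := decomp c' L'c' nLc'.
have As'c' : A (a * s') by apply: subringM.
have Aa's : A (a' * s) by apply: subringM.
apply: (sI n.+1 (a' * s)) => //; [exact: (primeNM pm)|exact: idealS Ic|].
rewrite -(subrK (a * s' * c') (a' * s * c)).
apply: (idealD (iI _)); last exact: (idealMl (iI _)).
apply: stL => //.
  apply: (idealB rA (iI _)); apply: (idealMl (iI _)) => //.
  exact: decI.
rewrite -!mulrA Es Es'.
have -> : a' * (l + a * g) - a * (l' + a' * g) = a' * l - a * l' by ring.
by apply: (idealB rA iL); apply: (idealMl iL).
Qed.

Let nakayama I N : ideal_of A I -> ideal_of A N -> saturated N ->
  (forall c, I c -> exists s r, [/\ A s, ~ m s, I r & N (s * c - x * r)]) ->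
  I `<=` N.
Proof.
move=> iI iN sN H c0 Ic0; apply: contrapT => Nc0.
have [|g [Ig Ng] gmax] := noetherian_max (D := fun g => I g /\ ~ N g)
  (f := fun g => saturation (plus N g)) rA nA _ (conj Ic0 Nc0).
  by move=> g [Ig _]; apply/saturation_ideal/(plus_ideal iN)/(idealS iI).
have Ag := idealS iI Ig.
have [s [r [As ms Ir Nr]]] := H g Ig; have Ar := idealS iI Ir.
have Nr0 : ~ N r.
  move=> Nr'; apply/Ng/(sN s) => //; rewrite -(subrK (x * r) (s * g)).
  exact: (idealD iN) (idealMl iN Ax Nr').
have [||_ [t [At mt [a Aa Nt]]]] := gmax r (conj Ir Nr0) _ r; last first.
- have Ats : A (t * s - x * a) by apply: subringB => //; apply: subringM.
  apply/Ng/(sN (t * s - x * a)) => //.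
    move=> mts; apply: (primeNM pm At As mt ms).
    rewrite -(subrK (x * a) (t * s)); apply: (idealD im) => //.
    exact: (idealMr im).
  have -> : (t * s - x * a) * g = t * (s * g - x * r) + x * (t * r - a * g).
    by ring.
  by apply: (idealD iN); apply: (idealMl iN).
- exact/sub_saturation/mem_plus/iN/plus_ideal.
- move=> c [Ac [t [At mt [a Aa Nt]]]]; split=> //.
  exists (s * t); split; [exact: subringM|exact: (primeNM pm)|].
  exists (a * x); first exact: subringM.
  have -> : s * t * c - a * x * r = s * (t * c - a * g) + a * (s * g - x * r).
    by ring.
  by apply: (idealD iN); apply: (idealMl iN).
Qed.

Lemma principal_ideal_contradiction : False.
Proof.
have [a qa q0a] : exists2 a, q a & ~ q0 a.
  case: q0q => _ /existsNP[a /not_implyP[qa q0a]]; by exists a.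
have Aa := idealS iq qa.
pose Q n : set K := [set c | A c /\ exists s, [/\ A s, ~ q s
  & plus q0 (a ^+ n) (s * c)]].
have iplus n := plus_ideal iq0 (subringX rA n Aa).
have iQ n : ideal_of A (Q n).
  split.
  - by move=> c [].
  - split; first exact: subring0.
    exists 1; split; [exact: subring1|exact: primeN1 pq|].
    by rewrite mulr0; apply: ideal0 (iplus n).
  - move=> b c [Ab [s [As qs H]]] [Ac [t [At qt H']]].
    split; first exact: subringD.
    exists (s * t); split; [exact: subringM|exact: (primeNM pq)|].
    have -> : s * t * (b + c) = t * (s * b) + s * (t * c) by ring.
    by apply: (idealD (iplus n)); apply: (idealMl (iplus n)).
  - move=> b c Ab [Ac [s [As qs H]]]; split; first exact: subringM.
    exists s; split=> //; have -> : s * (b * c) = b * (s * c) by ring.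
    exact: (idealMl (iplus n)).
have sQ n s b : A s -> ~ q s -> A b -> Q n (s * b) -> Q n b.
  move=> As qs Ab [_ [t [At qt H]]]; split=> //.
  exists (t * s); split; [exact: subringM|exact: (primeNM pq)|].
  by rewrite -mulrA.
have decQ n : Q n.+1 `<=` Q n.
  move=> c [Ac [s [As qs [b Ab H]]]]; split=> //; exists s; split=> //.
  by exists (b * a); [exact: subringM|rewrite -mulrA -exprS].
have q0Q n : q0 `<=` Q n.
  move=> c q0c; split; first exact: idealS q0c.
  exists 1; split; [exact: subring1|exact: primeN1 pq|].
  by rewrite mul1r; apply: sub_plus.
have iQx n := plus_ideal (iQ n) Ax.
have [|||||n stat] := @descending_chain (fun n => saturation (plus (Q n) x)).
- by move=> n; apply/saturation_ideal/iQx.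
- by move=> n; apply: saturation_saturated.
- move=> n; apply: subset_trans (sub_saturation (iQx n)).
  exact: subset_trans (q0Q n) (sub_plus _ (iQ n)).
- by move=> n; apply: sub_saturation => //; apply: mem_plus.
- move=> n c [Ac [s [As ms [b Ab H]]]]; split=> //; exists s; split=> //.
  by exists b => //; apply: decQ.
have : Q n `<=` Q n.+1.
  apply: nakayama => //.
    by move=> s b As ms; apply: sQ => // /(proj1 qm).
  move=> c Qc; have [|_ [s [As ms [r Ar H]]]] := stat c.
    by apply: sub_saturation => //; apply: sub_plus.
  exists s, r; split=> //; last by rewrite [x * r]mulrC.
  apply: (sQ n x) => //; rewrite [x * r]mulrC.
  have -> : r * x = s * c - (s * c - r * x) by ring.
  by apply: (idealB rA (iQ n)); [exact: (idealMl (iQ n))|exact: decQ].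
move=> /(_ (a ^+ n))[].
  split; first exact: subringX.
  exists 1; split; [exact: subring1|exact: primeN1 pq|].
  by rewrite mul1r; apply: mem_plus.
move=> _ [s [As qs [b Ab]]].
have -> : s * a ^+ n - b * a ^+ n.+1 = a ^+ n * (s - b * a).
  by rewrite exprS; ring.
have Aba : A (b * a) by apply: subringM.
move=> /(primeM pq0 (subringX rA n Aa) (subringB rA As Aba))[|/(proj1 q0q)].
  by move/(primeX rA pq0 Aa).
move=> H; apply: qs; rewrite -(subrK (b * a) s); apply: (idealD iq) => //.
exact: (idealMl iq).
Qed.

End PrincipalIdeal.

(** By the contradiction above, [m] cannot be the only prime below [m] that
    contains both [q0] and [x]; if [x] is already in [q], then [q] will do. *)
Lemma prime_between A q0 q m x : subring A -> noetherian A ->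
  prime_of A q0 -> prime_of A q -> prime_of A m -> q0 `<` q -> q `<` m -> m x ->
  exists P, [/\ prime_of A P, q0 `<` P, P `<` m & P x].
Proof.
move=> rA nA pq0 pq pm q0q qm mx; apply: contrapT => none.
have qx : ~ q x by move=> qx; apply: none; exists q.
have q0x : ~ q0 x by move=> /(proj1 q0q).
apply: (principal_ideal_contradiction rA nA pq0 pq pm q0q qm mx) => // P pP q0P Pm Px.
apply/seteqP; split=> //; apply: contrapT => mP; apply: none; exists P.
by split=> //; split=> // /(_ x Px).
Qed.

Definition prime_chain_to A n (C : nat -> set K) P : Prop :=
  prime_chain A n C /\ C n = P.

(** Downward induction on the chain: [x] is first moved into the term below the
    top one, then the chain that ends there is treated in the same way. *)
Lemma chain_first A n C P x : subring A -> noetherian A ->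
  prime_chain_to A n.+1 C P -> P x ->
  exists C', [/\ prime_chain_to A n.+1 C' P, C' 0%N = C 0%N & C' 1%N x].
Proof.
move=> rA nA; elim: n C P => [|n IH] C P [[pC sC] CP] Px.
  by exists C; split; rewrite // CP.
rewrite -CP in Px.
have [||||||P' [pP' CP' P'C P'x]] := prime_between (x := x) rA nA
  (pC n _) (pC n.+1 _) (pC n.+2 _) (sC n _) (sC n.+1 _); rewrite ?leqnSn //; try lia.
have [|C' [[[pC' sC'] C'P'] C'0 C'1]] :=
    IH (fun i => if i == n.+1 then P' else C i) P' _ P'x.
  split; last by rewrite eqxx.
  split=> i lei; first by case: eqVneq => // _; apply: pC; lia.
  rewrite eqSS; case: (eqVneq i n) => [->|ni].
    by have -> : (n == n.+1) = false by lia.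
  by rewrite (ltn_eqF lei); apply: sC (leqW lei).
exists (fun i => if i == n.+2 then C n.+2 else C' i); split=> //.
split; last by rewrite eqxx CP.
split=> i lei.
  by case: eqVneq => [_|ne]; [exact: pC|apply: pC'; lia].
rewrite eqSS; case: (eqVneq i n.+1) => [->|ni].
  by rewrite (ltn_eqF (ltnSn _)) C'P'.
by rewrite (ltn_eqF lei); apply: sC'; rewrite ltn_neqAle ni -ltnS.
Qed.

(** Krull's height theorem.  The entries of the list are moved, one after the
    other, to the bottom of a chain of primes that ends in [P]; each costs one
    term of the chain.  If terms are left, the lowest one is a prime that
    contains the list and is smaller than [P]. *)
Lemma krull_height A n C P (s : seq K) : subring A -> noetherian A ->
  prime_chain_to A n C P -> {in s, forall y, P y} ->
  (forall P', prime_of A P' -> {in s, forall y, P' y} -> P' `<=` P -> P' = P) ->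
  (n <= size s)%N.
Proof.
move=> rA nA CP sP minP; rewrite leqNgt; apply/negP => lt_sn.
have [C' [[[pC' sC'] C'P] sC0]] : exists C',
    prime_chain_to A (n - size s) C' P /\ {in s, forall y, C' 0%N y}.
  elim: s sP lt_sn {minP} => [|x s IH] sP lt_sn; first by exists C; rewrite subn0.
  have [||C' [CP' sC0]] := IH; [|by apply: ltnW|].
    by move=> y ys; apply: sP; rewrite inE ys orbT.
  have En : (n - size s = (n - (size s).+1).+1)%N by rewrite /= in lt_sn; lia.
  rewrite En in CP'; have Px : P x by apply: sP; rewrite inE eqxx.
  have [C1 [[[pC1 sC1] C1P] C10 C11]] := chain_first rA nA CP' Px.
  exists (fun i => C1 i.+1); split; first by split=> //; split=> i lei; auto.
  move=> y; rewrite inE => /orP[/eqP -> //|/sC0 C'y].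
  by apply: (sC1 0%N _).1 => //; rewrite C10.
have le j k : (j <= k)%N -> (k <= n - size s)%N -> C' j `<=` C' k.
  elim: k => [|k IH]; first by rewrite leqn0 => /eqP -> _ y.
  rewrite leq_eqVlt => /orP[/eqP -> _ y //|/IH le] lek y /(le (ltnW lek)).
  exact: (sC' k lek).1.
have n0 : (0 < n - size s)%N by rewrite subn_gt0.
have E0 : C' 0%N = P.
  by apply: minP; [exact: pC'|exact: sC0|rewrite -C'P; apply: le].
by case: (sC' 0%N n0) => _; rewrite E0 -C'P; apply; apply: le.
Qed.

End Ideals.

(** * Local rings and localization *)
Section Localization.
Context {K : fieldType}.
Implicit Types (A I J P Q m : set K).

Definition local_ring A m :=
  [/\ subring A, ideal_of A m, ~ m 1 & forall a, A a -> ~ m a -> A a^-1].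

Lemma local_sub A m I : local_ring A m -> ideal_of A I -> ~ I 1 -> I `<=` m.
Proof.
move=> [rA im _ uA] iI I1 a Ia; apply: contrapT => ma; apply: I1.
have Aa := idealS iI Ia.
have a0 : a != 0 by apply/eqP => a0; apply: ma; rewrite a0; apply: ideal0 im.
by rewrite -(mulVf a0); apply: (idealMl iI) => //; apply: uA.
Qed.

Lemma local_prime A m : local_ring A m -> prime_of A m.
Proof.
move=> [rA im m1 uA]; split=> // a b Aa Ab mab.
have [ma|ma] := pselect (m a); first by left.
right; have [a0|a0] := eqVneq a 0; first by case: ma; rewrite a0; apply: ideal0 im.
by rewrite -(mulKf a0 b); apply: (idealMl im) => //; apply: uA.
Qed.

Lemma local_maximal A m : local_ring A m ->
  maximal_of A m /\ forall m', maximal_of A m' -> m' = m.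
Proof.
move=> lA; have [rA im m1 uA] := lA; split.
  split=> // I iI mI I1; apply/seteqP; split=> //; exact: local_sub lA iI I1.
move=> m' [im' m'1 max]; apply/esym/max => //; exact: local_sub lA im' m'1.
Qed.

(** The height theorem bounds the length of every chain in a local ring, since
    the top of a chain may be replaced by the maximal ideal. *)
Lemma local_krull_height A m (s : seq K) n C : local_ring A m ->
  noetherian A -> {in s, forall y, m y} ->
  (forall P, prime_of A P -> {in s, forall y, P y} -> P = m) ->
  prime_chain A n C -> (n <= size s)%N.
Proof.
move=> lA nA sm minm [pC sC]; have [rA im _ _] := lA.
pose C' i := if i == n then m else C i.
apply: (@krull_height _ A n C' m s) => //; last by move=> P pP sP _; apply: minm.
split; last by rewrite /C' eqxx.
split=> i lei; rewrite /C'.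
  by case: eqVneq => _; [exact: local_prime|exact: pC].
rewrite (ltn_eqF lei); case: eqVneq => [Ei|_]; last exact: sC.
have Cm : C i.+1 `<=` m.
  by apply: local_sub lA _ _; [exact: prime_ideal (pC _ lei)|exact: primeN1 (pC _ lei)].
have [C1 C2] := sC _ lei; split; first exact: subset_trans Cm.
by move=> mC; apply: C2; apply: subset_trans mC.
Qed.

Definition loc A P : set K :=
  [set x | exists a b, [/\ A a, A b, ~ P b & x = a / b]].

Section Loc.
Variables A P : set K.
Hypotheses (rA : subring A) (pP : prime_of A P).

Let A1 := subring1 rA.
Let P1 := primeN1 pP.

Lemma loc_den_neq0 b : ~ P b -> b != 0.
Proof. by move=> Pb; apply/eqP => b0; apply: Pb; rewrite b0; apply: ideal0 (prime_ideal pP). Qed.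

Lemma sub_loc : A `<=` loc A P.
Proof. by move=> a Aa; exists a, 1; rewrite divr1. Qed.

Lemma locV b : A b -> ~ P b -> loc A P b^-1.
Proof. by move=> Ab Pb; exists 1, b; rewrite mul1r. Qed.

Definition extension I : set K :=
  [set x | exists a b, [/\ I a, A b, ~ P b & x = a / b]].

Lemma loc_subring : subring (loc A P).
Proof.
split; first exact: sub_loc.
- move=> _ _ [a [b [Aa Ab Pb ->]]] [c [d [Ac Ad Pd ->]]].
  exists (a * d - c * b), (b * d); split.
  + by apply: subringB; rewrite //; apply: subringM.
  + exact: subringM.
  + exact: primeNM pP _ _ _ _.
  + by have b0 := loc_den_neq0 Pb; have d0 := loc_den_neq0 Pd; field; rewrite b0 d0.
- move=> _ _ [a [b [Aa Ab Pb ->]]] [c [d [Ac Ad Pd ->]]].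
  exists (a * c), (b * d); split; try exact: subringM.
    exact: primeNM pP _ _ _ _.
  by rewrite invfM mulrACA.
Qed.

Lemma extension_ideal I : ideal_of A I -> ideal_of (loc A P) (extension I).
Proof.
move=> iI; split.
- by move=> _ [a [b [/(idealS iI) Aa Ab Pb ->]]]; exists a, b.
- by exists 0, 1; rewrite mul0r; split=> //; apply: ideal0 iI.
- move=> _ _ [a [b [Ia Ab Pb ->]]] [c [d [Ic Ad Pd ->]]].
  exists (a * d + c * b), (b * d); split.
  + by apply: (idealD iI); apply: (idealMr iI).
  + exact: subringM.
  + exact: primeNM pP _ _ _ _.
  + by have b0 := loc_den_neq0 Pb; have d0 := loc_den_neq0 Pd; field; rewrite b0 d0.
- move=> _ _ [a [b [Aa Ab Pb ->]]] [c [d [Ic Ad Pd ->]]].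
  exists (a * c), (b * d); split.
  + exact: (idealMl iI).
  + exact: subringM.
  + exact: primeNM pP _ _ _ _.
  + by rewrite invfM mulrACA.
Qed.

(** The contraction of the extension of [Q] is [Q]; this needs [Q] to be prime and
    disjoint from the denominators. *)
Lemma extension_prime_mem Q a b : prime_of A Q -> Q `<=` P -> A a -> A b ->
  ~ P b -> extension Q (a / b) -> Q a.
Proof.
move=> pQ QP Aa Ab Pb [c [d [Qc Ad Pd E]]].
have b0 := loc_den_neq0 Pb; have d0 := loc_den_neq0 Pd.
have Ead : a * d = c * b by move/eqP: E; rewrite eqr_div // => /eqP.
have Qad : Q (a * d) by rewrite Ead; apply: (idealMr (prime_ideal pQ)).
by have [|/QP] := primeM pQ Aa Ad Qad.
Qed.

Lemma extension_prime Q :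
  prime_of A Q -> Q `<=` P -> prime_of (loc A P) (extension Q).
Proof.
move=> pQ QP; split; first exact: extension_ideal (prime_ideal pQ).
  rewrite -(divr1 1) => /(extension_prime_mem pQ QP A1 A1 P1).
  exact: primeN1 pQ.
move=> _ _ [a [b [Aa Ab Pb ->]]] [c [d [Ac Ad Pd ->]]].
rewrite mulrACA -invfM => /(extension_prime_mem pQ QP) H.
have [|Qa|Qc] := primeM pQ Aa Ac; last 2 first.
- by left; exists a, b.
- by right; exists c, d.
by apply: H; [exact: subringM|exact: subringM|exact: primeNM pP _ _ _ _].
Qed.

Lemma contraction_ideal J : ideal_of (loc A P) J -> ideal_of A (A `&` J).
Proof.
move=> iJ; split.
- by move=> a [].
- by split; [exact: subring0|exact: ideal0 iJ].
- by move=> a b [Aa Ja] [Ab Jb]; split; [exact: subringD|exact: (idealD iJ)].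
- move=> a b Aa [Ab Jb]; split; first exact: subringM.
  by apply: (idealMl iJ) => //; apply: sub_loc.
Qed.

Lemma loc_noetherian : noetherian A -> noetherian (loc A P).
Proof.
move=> nA J iJ; have iI := contraction_ideal iJ.
have [s sI Is] := noetherian_span rA nA iI.
have sJ : {in s, forall y, J y} by move=> y /sI[].
have sL : {in s, forall y, loc A P y} by move=> y /sJ /(idealS iJ).
exists s; rewrite ideal_gen_span //; last exact: loc_subring.
apply/seteqP; split; last exact: span_min.
move=> x Jx; have [a [b [Aa Ab Pb E]]] := idealS iJ Jx.
have iS : ideal_of (loc A P) (span (loc A P) s).
  by apply: span_ideal; [exact: loc_subring|exact: all_subset].
rewrite E mulrC; apply: (idealMl iS); first exact: locV.
suff Sa : span A s a by exact: span_mono sub_loc _ Sa.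
rewrite -Is; split=> //; have b0 := loc_den_neq0 Pb.
have -> : a = b * x by rewrite E mulrCA divff ?mulr1.
by apply: (idealMl iJ) => //; apply: sub_loc.
Qed.

Lemma loc_local : local_ring (loc A P) (extension P).
Proof.
split; [exact: loc_subring|exact/extension_ideal/prime_ideal| |].
  by rewrite -(divr1 1) => /(extension_prime_mem pP (fun _ => id) A1 A1 P1).
move=> _ [a [b [Aa Ab Pb ->]]] Pab; exists b, a; split=> //; last by rewrite invf_div.
by move=> Pa; apply: Pab; exists a, b.
Qed.

(** Regularity of the local ring of [A] at [P], expressed in [A] itself so that
    it can be transported to [A[x]].  By the height theorem, a chain below [P] is
    never longer than a list of local generators, so that [d] is the height. *)
Definition regular_at : Prop :=
  exists d C (s : seq K), [/\ prime_chain_to A d C P, size s = d,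
    {in s, forall y, P y}
    & forall a, P a -> exists b, [/\ A b, ~ P b & span A s (b * a)]].

Lemma regular_local_loc : noetherian A -> regular_at -> regular_local (loc A P).
Proof.
move=> nA [d [C [s [[[pC sC] CP] sd sP gen]]]]; split; first exact: loc_noetherian.
have lL := loc_local; have [maxP uniqP] := local_maximal lL.
have sE : {in s, forall y, extension P y}.
  by move=> y /sP Py; exists y, 1; rewrite divr1.
have sL : {in s, forall y, loc A P y}.
  by move=> y /sE /(idealS (extension_ideal (prime_ideal pP))).
have rL := loc_subring.
have iS := span_ideal rL (all_subset sL).
have EP : extension P = span (loc A P) s.
  apply/seteqP; split; last first.
    exact: span_min (extension_ideal (prime_ideal pP)) sE.
  move=> _ [a [b [Pa Ab Pb ->]]]; have [c [Ac Pc Sca]] := gen a Pa.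
  have c0 := loc_den_neq0 Pc.
  have -> : a / b = (c^-1 * b^-1) * (c * a) by field; rewrite c0 loc_den_neq0.
  apply: (idealMl iS); first by apply: subringM => //; apply: locV.
  exact: span_mono sub_loc _ Sca.
exists (extension P); split=> //; exists d; split; last first.
  by exists (Tuple (introT eqP sd)); rewrite EP -(ideal_gen_span rL sL).
split; last first.
  move=> n C' cC'; rewrite -sd.
  apply: (local_krull_height lL (loc_noetherian nA) sE _ cC') => Q pQ sQ.
  apply/seteqP; split.
    exact: (local_sub lL (prime_ideal pQ) (primeN1 pQ)).
  by rewrite EP; apply: span_min (prime_ideal pQ) sQ.
have CleP i : (i <= d)%N -> C i `<=` P.
  rewrite -CP; move=> lei; rewrite -(subKn lei).
  elim: (d - i)%N (leq_subr i d) => [|k IH] lek; first by rewrite subn0.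
  apply: subset_trans (IH (ltnW lek)).
  have -> : (d - k = (d - k.+1).+1)%N by lia.
  by case: (sC (d - k.+1)%N _) => //; lia.
exists (fun i => extension (C i)); split=> i lei.
  by apply: extension_prime; [exact: pC|exact: CleP].
have [C1 C2] := sC i lei; split.
  by move=> _ [a [b [Ca Ab Pb ->]]]; exists a, b; split=> //; apply: C1.
move=> E; apply: C2 => a Ca; have Aa := idealS (prime_ideal (pC _ lei)) Ca.
apply: (@extension_prime_mem (C i) a 1) => //.
- exact: pC (ltnW lei).
- exact: CleP (ltnW lei).
- by apply: E; exists a, 1.
Qed.

End Loc.

(** ** A quadratic obstruction to regularity *)

Definition square_ideal A m : set K :=
  ideal_gen A [set x | exists a b, [/\ m a, m b & x = a * b]].

Section Exchange.
Variables A m : set K.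
Hypothesis lA : local_ring A m.

Let rA : subring A. Proof. by case: lA. Qed.
Let im : ideal_of A m. Proof. by case: lA. Qed.
Let m1 : ~ m 1. Proof. by case: lA. Qed.

Lemma square_ideal_ideal : ideal_of A (square_ideal A m).
Proof.
apply: ideal_gen_ideal => // _ [a [b [ma mb ->]]].
by apply: subringM => //; exact: (idealS im).
Qed.

Lemma square_idealM a b : m a -> m b -> square_ideal A m (a * b).
Proof. by move=> ma mb; apply: sub_gen_smallest; exists a, b. Qed.

Let span_ideal_m s : {in s, forall y, m y} -> ideal_of A (span A s).
Proof. by move=> sm; apply/span_ideal/all_subset => // y /sm /(idealS im). Qed.

Lemma span_catP s t x : span A (s ++ t) x ->
  exists u, span A s u /\ span A t (x - u).
Proof.
elim: s x => [|y s IH] x /=; first by exists 0; rewrite subr0.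
move=> [a Aa /IH[u [Su Tu]]]; exists (u + a * y); split.
  by exists a; rewrite ?addrK.
by rewrite opprD addrA addrAC.
Qed.

(** A coefficient of [z] outside [m] is a unit, and the equation that expresses
    [z] can then be solved for the parameter that it multiplies. *)
Lemma unit_coefficient s z : {in s, forall y, m y} -> span A s z ->
  square_ideal A m z \/
  exists s1 y s2, s = s1 ++ y :: s2 /\ span A (z :: s1 ++ s2) y.
Proof.
elim: s z => [z _ ->|y s IH z sm [a Aa Sz]].
  by left; apply: ideal0 square_ideal_ideal.
have sm' : {in s, forall w, m w} by move=> w ws; apply: sm; rewrite inE ws orbT.
have my : m y by apply: sm; rewrite inE eqxx.
have Ay := idealS im my.
have [ma|ma] := pselect (m a); last first.
  right; exists [::], y, s; split=> //=.
  have a0 : a != 0 by apply/eqP => a0; apply: ma; rewrite a0; apply: ideal0 im.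
  have Aa1 : A a^-1 by case: lA => _ _ _; apply.
  exists a^-1 => //.
  have -> : y - a^-1 * z = - a^-1 * (z - a * y) by field.
  by apply: (idealMl (span_ideal_m sm')) => //; apply: subringN.
have [sqz|[s1 [w [s2 [Es [b Ab Sw]]]]]] := IH _ sm' Sz.
  left; rewrite -(subrK (a * y) z); apply: (idealD square_ideal_ideal) => //.
  exact: square_idealM.
right; exists (y :: s1), w, s2; split; first by rewrite Es.
exists b => //; exists (- (b * a)); first by apply: (subringN rA); apply: (subringM rA).
by have -> : w - b * z - - (b * a) * y = w - b * (z - a * y) by ring.
Qed.

(** The exchange step of Steinitz, modulo the square of [m]. *)
Lemma exchange us ss x : {in us ++ ss, forall y, m y} ->
  m `<=` span A (us ++ ss) -> m x ->
  (forall u, span A us u -> ~ square_ideal A m (x - u)) ->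
  exists ss', [/\ size ss = (size ss').+1, {in x :: us ++ ss', forall y, m y}
    & m `<=` span A (x :: us ++ ss')].
Proof.
move=> sm ms mx indep; have [u [Su Sz]] := span_catP (ms x mx).
have ssm : {in ss, forall y, m y}.
  by move=> y ys; apply: sm; rewrite mem_cat ys orbT.
have [/(indep u Su) //|[s1 [y [s2 [Es Sy]]]]] := unit_coefficient ssm Sz.
have sm' : {in x :: us ++ s1 ++ s2, forall y, m y}.
  move=> w; rewrite inE !mem_cat => /orP[/eqP -> //|H]; apply: sm.
  by rewrite Es !mem_cat inE; case/or3P: H => ->; rewrite ?orbT.
exists (s1 ++ s2); split=> //; first by rewrite Es !size_cat /= addnS.
have iS := span_ideal_m sm'.
have Sin w : w \in x :: us ++ s1 ++ s2 -> span A (x :: us ++ s1 ++ s2) w.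
  exact: mem_span.
apply: subset_trans ms _; apply: span_min => // w.
rewrite mem_cat Es mem_cat inE => /or3P[wus|ws1|/orP[/eqP -> {w}|ws2]].
- by apply: Sin; rewrite inE !mem_cat wus !orbT.
- by apply: Sin; rewrite inE !mem_cat ws1 !orbT.
- apply: (span_min iS _ Sy) => w; rewrite inE mem_cat => /orP[/eqP ->|ws].
    apply: (idealB rA iS); first by apply: Sin; rewrite inE eqxx.
    apply: (span_min iS _ Su) => v vus.
    by apply: Sin; rewrite inE !mem_cat vus !orbT.
  by apply: Sin; rewrite inE !mem_cat; case/orP: ws => ->; rewrite !orbT.
- by apply: Sin; rewrite inE !mem_cat ws2 !orbT.
Qed.

(** Completing [x - y], [z] and [x] to a minimal list of generators of [m],
    the relation puts [x ^+ 2] in the ideal of all the generators but [x].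
    Hence that ideal is contained in no prime but [m], and the dimension is
    smaller than the number of generators. *)
Lemma quadratic_not_regular x y z : m x -> m y -> m z ->
  x * y = (x + y) * z ->
  (forall a b c, A a -> A b -> A c ->
    square_ideal A m (a * x + b * y + c * z) -> [/\ m a, m b & m c]) ->
  ~ regular_local A.
Proof.
move=> mx my mz rel indep [nA [m' [maxm' _ [d [[[C cC] _] [s Em']]]]]].
have Em : m' = m by have [_ uniq_m] := local_maximal lA; exact: uniq_m.
rewrite {m' maxm'}Em in Em'.
have [Ax Ay Az] : [/\ A x, A y & A z] by split; apply: (idealS im).
have A1 := subring1 rA; have A0 := subring0 rA; have AN1 := subringN rA A1.
have sm : {in s, forall w, m w}.
  by move=> w ws; rewrite Em'; apply: sub_gen_smallest.
have ms : m `<=` span A s.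
  by rewrite {1}Em' ideal_gen_span // => w /sm /(idealS im).
have mxy : m (x - y) by apply: (idealB rA im).
have [|s1 [Es1 s1m ms1]] := exchange (us := [::]) sm ms mxy.
  move=> u -> H; apply: m1.
  have [//|_ _ //] := indep 1 (- 1) 0 A1 AN1 A0.
  by congr (square_ideal A m _): H; ring.
have [|s2 [Es2 s2m ms2]] := exchange (us := [:: x - y]) s1m ms1 mz.
  move=> u [a Aa /eqP]; rewrite subr_eq0 => /eqP -> H; apply: m1.
  have [||//] := indep (- a) a 1 _ Aa A1; first exact: subringN.
  by congr (square_ideal A m _): H; ring.
have [|s3 [Es3 s3m ms3]] := exchange (us := [:: z; x - y]) s2m ms2 mx.
  move=> u [a Aa [b Ab /eqP]]; rewrite subr_eq0 => /eqP Eu H; apply: m1.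
  have [|||m1b mb _] := indep (1 - b) b (- a) _ Ab.
  - exact: subringB.
  - exact: subringN.
  - congr (square_ideal A m _): H; rewrite -[u](subrK (a * z)) Eu; ring.
  by rewrite -(subrK b 1); apply: (idealD im).
pose t := z :: (x - y) :: s3.
have tm : {in t, forall w, m w} by move=> w wt; apply: s3m; rewrite inE wt orbT.
have Ed : d = (size t).+1 by rewrite -(size_tuple s) Es1 Es2 Es3.
suff: (d <= size t)%N by rewrite Ed ltnn.
apply: (local_krull_height lA nA tm _ cC) => P pP tP; have iP := prime_ideal pP.
have Pz : P z by apply: tP; rewrite !inE eqxx.
have Pxy : P (x - y) by apply: tP; rewrite !inE eqxx orbT.
have Px : P x.
  apply: (primeX (n := 2) rA pP Ax).
  have -> : x ^+ 2 = (x + y) * z + x * (x - y) by rewrite -rel; ring.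
  by apply: (idealD iP); apply: (idealMl iP) => //; apply: subringD.
apply/seteqP; split; first exact: local_sub lA iP (primeN1 pP).
apply: subset_trans ms3 _; apply: span_min => // w.
by rewrite inE => /orP[/eqP -> //|]; exact: tP.
Qed.

End Exchange.

End Localization.

(** * Adjoining a transcendental element *)
Section Adjunction.
Context {K : fieldType}.
Implicit Types (A I P : set K) (h g : {poly K}).

Definition over A h := forall i, A h`_i.

Definition adj A x : set K := [set y | exists2 h, over A h & y = h.[x]].

Definition transcendental A x := forall h, over A h -> h.[x] = 0 -> h = 0.

Section Over.
Variable A : set K.
Hypothesis rA : subring A.

Lemma overC a : A a -> over A a%:P.
Proof. by move=> Aa i; rewrite coefC; case: ifP => // _; apply: subring0. Qed.

Lemma overXn n : over A 'X^n.
Proof. by move=> i; rewrite coefXn; case: eqP => _; [apply: subring1|apply: subring0]. Qed.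

Lemma overM h g : over A h -> over A g -> over A (h * g).
Proof.
move=> oh og i; rewrite coefM.
by apply: (@subring_sum _ A rA _ (fun j => h`_j * g`_(i - j))) => j; apply: subringM.
Qed.

Section OverIdeal.
Variable I : set K.
Hypothesis iI : ideal_of A I.

Lemma over_ideal h : over I h -> over A h.
Proof. by move=> oh i; apply: idealS (oh i). Qed.

Lemma over0 : over I 0.
Proof. by move=> i; rewrite coef0; apply: ideal0 iI. Qed.

Lemma overD h g : over I h -> over I g -> over I (h + g).
Proof. by move=> oh og i; rewrite coefD; apply: (idealD iI). Qed.

Lemma overN h : over I h -> over I (- h).
Proof. by move=> oh i; rewrite coefN; apply: (idealN rA iI). Qed.

Lemma overB h g : over I h -> over I g -> over I (h - g).
Proof. by move=> oh og; apply: overD => //; apply: overN. Qed.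

Lemma overMl h g : over A h -> over I g -> over I (h * g).
Proof.
move=> oh og i; rewrite coefM.
by apply: (@ideal_sum _ A I iI _ (fun j => h`_j * g`_(i - j))) => j; apply: (idealMl iI).
Qed.

End OverIdeal.

Lemma adj_subring x : subring (adj A x).
Proof.
have iA := ideal_self rA; split.
- by exists 1%:P; [apply: overC; apply: subring1|rewrite hornerC].
- by move=> _ _ [h oh ->] [g og ->]; exists (h - g); [exact: overB|rewrite !hornerE].
- by move=> _ _ [h oh ->] [g og ->]; exists (h * g); [exact: overM|rewrite !hornerE].
Qed.

Lemma sub_adj x : A `<=` adj A x.
Proof. by move=> a Aa; exists a%:P; [exact: overC|rewrite hornerC]. Qed.

Lemma mem_adj x : adj A x x.
Proof. by exists 'X; rewrite ?hornerX //; exact: (overXn 1). Qed.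

Lemma adj_min x B : subring B -> A `<=` B -> B x -> adj A x `<=` B.
Proof.
move=> rB AB Bx _ [h oh ->]; rewrite horner_coef.
apply: (@subring_sum _ B rB _ (fun i => h`_i * x ^+ i)) => i.
by apply: subringM => //; [exact: AB|exact: subringX].
Qed.

(** Hilbert's basis theorem.  The ideals [lead n] of the [n]-th coefficients of
    the polynomials of degree at most [n] that evaluate into [I] increase, hence
    stabilize, and finitely many generators of them lift to generators of
    [I]. *)
Lemma adj_noetherian x : noetherian A -> noetherian (adj A x).
Proof.
move=> nA I iI; have iA := ideal_self rA; have rAx := adj_subring x.
pose lead n : set K :=
  [set a | exists h, [/\ over A h, (size h <= n.+1)%N, I h.[x] & a = h`_n]].
have ilead n : ideal_of A (lead n).
  split.
  - by move=> _ [h [oh _ _ ->]]; apply: oh.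
  - exists 0; rewrite size_poly0 horner0 coef0; split=> //; first exact: over0.
    exact: ideal0 iI.
  - move=> _ _ [h [oh sh Ih ->]] [g [og sg Ig ->]]; exists (h + g).
    rewrite coefD hornerD; split=> //; [exact: overD| |exact: (idealD iI)].
    by rewrite (leq_trans (size_polyD _ _)) // geq_max sh.
  - move=> a _ Aa [h [oh sh Ih ->]]; exists (a%:P * h).
    rewrite coefCM hornerM hornerC; split=> //.
    + by apply: overM => //; apply: overC.
    + by rewrite mul_polyC (leq_trans (size_scale_leq _ _)).
    + by apply: (idealMl iI) => //; apply: sub_adj.
have leadS m n : (m <= n)%N -> lead m `<=` lead n.
  move=> lemn _ [h [oh sh Ih ->]]; exists ('X^(n - m) * h).
  rewrite coefXnM ltnNge leq_subr /= subKn // hornerM; split=> //.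
  - by apply: overM => //; apply: overXn.
  - have [->|h0] := eqVneq h 0; first by rewrite mulr0 size_poly0.
    by rewrite mulrC size_mulXn //; lia.
  - by apply: (idealMl iI) => //; exists 'X^(n - m) => //; apply: overXn.
have [N _ leadN] := noetherian_max (D := fun=> True) (f := lead) (t0 := 0%N)
  rA nA (fun n _ => ilead n) Logic.I.
have lift n : {s : seq K | {in s, forall y, I y} & forall a, lead n a -> exists k,
    [/\ over A k, (size k <= n.+1)%N, a = k`_n & span (adj A x) s k.[x]]}.
  apply: cid2; have [c lc ->] := noetherian_span rA nA (ilead n).
  elim: c lc => [|y c IH] lc.
    exists [::] => // _ ->; exists 0.
    by rewrite size_poly0 coef0 horner0; split=> //; apply: over0.
  have [|s sI Hs] := IH; first by move=> z zc; apply: lc; rewrite inE zc orbT.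
  have [|h [oh sh Ih Ey]] := lc y; first by rewrite inE eqxx.
  exists (h.[x] :: s) => [z|a [b Ab /Hs[k [ok sk Ek Sk]]]].
    by rewrite inE => /orP[/eqP ->|/sI].
  exists (k + b%:P * h); split.
  - by apply: overD => //; apply: overM => //; apply: overC.
  - rewrite (leq_trans (size_polyD _ _)) // geq_max sk mul_polyC.
    by rewrite (leq_trans (size_scale_leq _ _)).
  - by rewrite coefD coefCM -Ey -Ek subrK.
  - by exists b; [exact: sub_adj|rewrite hornerD hornerM hornerC addrK].
pose s n := s2val (lift n).
pose S := flatten [seq s n | n <- iota 0 N.+1].
have SI : {in S, forall y, I y}.
  by move=> y /flatten_mapP[n _]; apply: (s2valP (lift n)).
have SA : {in S, forall y, adj A x y} by move=> y /SI /(idealS iI).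
have iS : ideal_of (adj A x) (span (adj A x) S).
  exact: span_ideal (all_subset SA).
exists S; rewrite ideal_gen_span //; apply/seteqP; split; last exact: span_min.
move=> y Iy; have [h oh Ey] := idealS iI Iy; rewrite Ey in Iy *.
have [n] := ubnP (size h); elim: n h {Ey y} oh Iy => // n IH h oh Ih sh.
have [->|h0] := eqVneq h 0; first by rewrite horner0; apply: ideal0 iS.
pose d := (size h).-1; pose e := minn d N.
have sz_h : size h = d.+1 by rewrite /d prednK // size_poly_gt0.
have [|k [ok sk Ek Sk]] := s2valP' (lift e) h`_d.
  rewrite /e /minn; case: ifP => dN; first by exists h; rewrite sz_h.
  apply: (leadN d) => //; first by apply: leadS; rewrite leqNgt dN.
  by exists h; rewrite sz_h.
have le_ed : (e <= d)%N by rewrite geq_minl.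
have oX := overXn (d - e).
have Sk' : span (adj A x) S k.[x].
  apply: (span_min iS _ Sk) => z zs; apply: mem_span => //.
  apply/flatten_mapP; exists e => //; rewrite mem_iota /= add0n ltnS.
  exact: geq_minr.
have SXk : span (adj A x) S ('X^(d - e) * k).[x].
  by rewrite hornerM; apply: (idealMl iS) => //; exists 'X^(d - e).
rewrite -(subrK ('X^(d - e) * k) h) hornerD; apply: (idealD iS) => //.
apply: IH.
- by apply: overB => //; apply: overM.
- rewrite hornerD hornerN; apply: (idealB rAx iI) => //.
  exact: (span_min iI SI SXk).
- apply: (@leq_ltn_trans d); last by rewrite -ltnS -sz_h.
  apply/leq_sizeP => j; rewrite leq_eqVlt => /orP[/eqP <-|dj].
    by rewrite coefB coefXnM ltnNge leq_subr /= subKn // -Ek subrr.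
  rewrite coefB coefXnM [h`_j]nth_default ?sz_h //.
  rewrite [k`_(j - (d - e))]nth_default ?if_same ?subr0 //.
  by apply: leq_trans sk _; lia.
Qed.

Definition extend_ideal I x : set K := [set y | exists2 h, over I h & y = h.[x]].

Section Transcendental.
Variable x : K.
Hypothesis tx : transcendental A x.

Lemma horner_inj h g : over A h -> over A g -> h.[x] = g.[x] -> h = g.
Proof.
move=> oh og /eqP; rewrite -subr_eq0 -hornerN -hornerD => /eqP E.
apply/eqP; rewrite -subr_eq0; apply/eqP/tx => //.
by apply: (overB (ideal_self rA)).
Qed.

Lemma mem_extend_ideal I h : ideal_of A I ->
  over A h -> extend_ideal I x h.[x] -> over I h.
Proof. by move=> iI oh [g og /(horner_inj oh (over_ideal iI og)) ->]. Qed.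

Lemma extend_ideal_ideal I :
  ideal_of A I -> ideal_of (adj A x) (extend_ideal I x).
Proof.
move=> iI; split.
- by move=> _ [h oh ->]; exists h => //; apply: over_ideal oh.
- by exists 0; [exact: over0|rewrite horner0].
- by move=> _ _ [h oh ->] [g og ->]; exists (h + g); [exact: overD|rewrite hornerD].
- by move=> _ _ [h oh ->] [g og ->]; exists (h * g); [exact: overMl|rewrite hornerM].
Qed.

Lemma over_drop I h : ideal_of A I -> over I h ->
  over I (h - (lead_coef h)%:P * 'X^((size h).-1)).
Proof.
move=> iI oh; apply: (overB iI) => //; rewrite mulrC.
apply: (overMl iI); first exact: overXn.
by move=> i; rewrite coefC; case: ifP => _; [exact: oh|exact: ideal0 iI].
Qed.

Lemma size_drop h : h != 0 ->
  (size (h - (lead_coef h)%:P * 'X^((size h).-1))%R < size h)%N.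
Proof.
move=> h0; have sz_h : size h = (size h).-1.+1 by rewrite prednK // size_poly_gt0.
rewrite [X in (_ < X)%N]sz_h ltnS; apply/leq_sizeP => j.
rewrite coefB coefCM coefXn leq_eqVlt => /orP[/eqP <-|lt].
  by rewrite eqxx mulr1 subrr.
by rewrite gtn_eqF // mulr0 subr0 nth_default // sz_h.
Qed.

(** One of the leading coefficients of [h] and [g] is in [P], and that leading term
    can be dropped without changing the hypothesis or the conclusion. *)
Lemma over_prime P h g : prime_of A P -> over A h -> over A g ->
  over P (h * g) -> over P h \/ over P g.
Proof.
move=> pP; have iP := prime_ideal pP; have iA := ideal_self rA.
have [n] := ubnP (size h + size g).
elim: n h g => // n IH h g lt oh og ohg.
have [->|h0] := eqVneq h 0; first by left; apply: over0.
have [->|g0] := eqVneq g 0; first by right; apply: over0.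
have lead_term f : over A f -> P (lead_coef f) ->
    over P ((lead_coef f)%:P * 'X^((size f).-1)).
  move=> of_ Pf; rewrite mulrC; apply: (overMl iP); first exact: overXn.
  by move=> i; rewrite coefC; case: ifP => _ //; exact: ideal0 iP.
have drop f : over A f -> P (lead_coef f) ->
    over P (f - (lead_coef f)%:P * 'X^((size f).-1)) -> over P f.
  move=> of_ Pf H; rewrite -(subrK ((lead_coef f)%:P * 'X^((size f).-1)) f).
  by apply: (overD iP) => //; apply: lead_term.
have Plc : P (lead_coef h * lead_coef g) by rewrite -lead_coefM; apply: ohg.
have [Ph|Pg] := primeM pP (oh _) (og _) Plc.
- have [||||H|H] := IH (h - (lead_coef h)%:P * 'X^((size h).-1)) g.
  + by have := size_drop h0; lia.
  + exact: over_drop.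
  + exact: og.
  + rewrite mulrBl; apply: (overB iP) => //; rewrite mulrC.
    by apply: (overMl iP) => //; apply: lead_term.
  + by left; apply: drop.
  + by right.
- have [||||H|H] := IH h (g - (lead_coef g)%:P * 'X^((size g).-1)).
  + by have := size_drop g0; lia.
  + exact: oh.
  + exact: over_drop.
  + rewrite mulrBr; apply: (overB iP) => //.
    by apply: (overMl iP) => //; apply: lead_term.
  + by left.
  + by right; apply: drop.
Qed.

Lemma extend_ideal_prime P : prime_of A P -> prime_of (adj A x) (extend_ideal P x).
Proof.
move=> pP; have iP := prime_ideal pP; split; first exact: extend_ideal_ideal.
  have o1 : over A 1%:P by apply: overC; apply: subring1.
  rewrite -(hornerC 1 x) => /(mem_extend_ideal iP o1)/(_ 0%N).
  by rewrite coefC; apply: primeN1 pP.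
move=> _ _ [h oh ->] [g og ->]; rewrite -hornerM.
move=> /(mem_extend_ideal iP (overM oh og))/(over_prime pP oh og)[H|H].
  by left; exists h.
by right; exists g.
Qed.

Lemma contract_extend_ideal I a : ideal_of A I -> A a -> extend_ideal I x a -> I a.
Proof.
move=> iI Aa; rewrite -{1}(hornerC a x).
by move=> /(mem_extend_ideal iI (overC Aa))/(_ 0%N); rewrite coefC.
Qed.

(** Were the leading coefficient of [f] in [P], the leading term could be dropped,
    against the minimality of [f].  So it is invertible locally, and division by
    [f], after multiplication by a power of it, leaves a remainder over [P], again
    by minimality. *)
Lemma pseudo_division P P' f : ideal_of A P -> ideal_of (adj A x) P' ->
  extend_ideal P x `<=` P' -> over A f -> P' f.[x] -> ~ over P f ->
  (forall g, over A g -> P' g.[x] -> (size g < size f)%N -> over P g) ->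
  ~ P (lead_coef f) /\ forall g, over A g -> P' g.[x] ->
    exists k h r, [/\ over A h, over P r
      & (lead_coef f ^+ k)%:P * g = h * f + r].
Proof.
move=> iP iP' PP' of_ P'f nof minf; have iA := ideal_self rA.
have f0 : f != 0 by apply/eqP => f0; apply: nof; rewrite f0; apply: over0.
split=> [Pl|].
  set f1 := (lead_coef f)%:P * 'X^((size f).-1); apply: nof.
  have of1 : over P f1.
    rewrite /f1 mulrC; apply: (overMl iP); first exact: overXn.
    by move=> i; rewrite coefC; case: ifP => // _; apply: ideal0 iP.
  rewrite -(subrK f1 f); apply: (overD iP) => //; apply: minf.
  - exact: over_drop.
  - rewrite hornerD hornerN; apply: (idealB (adj_subring x) iP') => //.
    by apply: PP'; exists f1.
  - exact: size_drop.
move=> g; have [n] := ubnP (size g); elim: n g => // n IH g lt og P'g.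
have [lt_gf|le_fg] := ltnP (size g) (size f).
  exists 0%N, 0, g; split; [exact: over0|exact: minf|].
  by rewrite expr0 mul0r add0r mul1r.
have g0 : g != 0 by rewrite -size_poly_gt0 (leq_trans _ le_fg) // size_poly_gt0.
set c := lead_coef f; pose q := (lead_coef g)%:P * 'X^(size g - size f).
have oq : over A q.
  by apply: overM; [apply: overC; apply: og|exact: overXn].
have Ac : A c by apply: of_.
have ocg : over A (c%:P * g) by apply: overM => //; apply: overC.
have og1 : over A (c%:P * g - q * f) by apply: (overB iA) => //; apply: overM.
have [||k [h [r [oh or E]]]] := IH (c%:P * g - q * f) _ og1.
- have sz_g : size g = (size g).-1.+1 by rewrite prednK // size_poly_gt0.
  have sz_f : size f = (size f).-1.+1 by rewrite prednK // size_poly_gt0.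
  apply: (@leq_ltn_trans (size g).-1); last by rewrite -ltnS -sz_g.
  apply/leq_sizeP => j; rewrite coefB coefCM -mulrA coefCM coefXnM.
  rewrite leq_eqVlt => /orP[/eqP <-|lt_j].
    have -> : ((size g).-1 < size g - size f)%N = false by lia.
    have -> : ((size g).-1 - (size g - size f) = (size f).-1)%N by lia.
    by rewrite -!lead_coefE mulrC subrr.
  have -> : (j < size g - size f)%N = false by lia.
  have sf : (size f <= j - (size g - size f))%N by lia.
  have sg : (size g <= j)%N by lia.
  by rewrite (nth_default _ sf) (nth_default _ sg) !mulr0 subrr.
- rewrite hornerD hornerN (hornerM q) (hornerM c%:P) hornerC.
  apply: (idealB (adj_subring x) iP'); apply: (idealMl iP') => //.
    exact: sub_adj.
  by exists q.
exists k.+1, (h + (c ^+ k)%:P * q), r; split=> //.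
  apply: (overD iA) => //; apply: overM => //.
  by apply: overC; apply: subringX.
rewrite mulrDl -addrA [_ * f + r]addrC addrA -E exprSr polyCM -!mulrA mulrBr.
by rewrite subrK.
Qed.

Lemma common_denominator P (s : seq K) r : prime_of A P ->
  {in s, forall y, A y} ->
  (forall a, P a -> exists b, [/\ A b, ~ P b & span A s (b * a)]) ->
  over P r -> exists b, [/\ A b, ~ P b & span (adj A x) s (b * r.[x])].
Proof.
move=> pP sA gen or; rewrite horner_coef.
have sAx : {in s, forall y, adj A x y} by move=> y /sA; apply: sub_adj.
have iS := span_ideal (adj_subring x) (all_subset sAx).
elim: (size r) => [|n [b [Ab Pb Sb]]].
  exists 1; rewrite big_ord0 mulr0; split; [exact: subring1|exact: primeN1 pP|].
  exact: ideal0 iS.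
have [c [Ac Pc Sc]] := gen _ (or n).
exists (b * c); split; [exact: subringM|exact: (primeNM pP)|].
rewrite big_ord_recr /= mulrDr [in X in span _ _ (X + _)]mulrAC.
apply: (idealD iS); first by rewrite mulrC; apply: (idealMl iS) => //; apply: sub_adj.
have -> : b * c * (r`_n * x ^+ n) = c * r`_n * (b * x ^+ n) by ring.
apply: (idealMr iS).
  apply: (subringM (adj_subring x)); first exact: sub_adj.
  exact: (subringX (adj_subring x)) (mem_adj x).
exact: span_mono (sub_adj x) _ Sc.
Qed.

(** A prime of [A[x]] over [P] is either [P[x]], and the data for [P] serve again,
    or is generated, locally, by [P] and a polynomial [f] of least degree not over
    [P]; then [f] is one more generator, and [P'] is one more term of the chain
    above [P[x]]. *)
Lemma adj_regular_at P' : prime_of (adj A x) P' ->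
  (forall P, prime_of A P -> regular_at A P) -> regular_at (adj A x) P'.
Proof.
move=> pP' regA; have iP' := prime_ideal pP'; have rAx := adj_subring x.
pose P := A `&` P'.
have iP : ideal_of A P.
  split.
  - by move=> a [].
  - by split; [exact: subring0|exact: ideal0 iP'].
  - by move=> a b [Aa Pa] [Ab Pb]; split; [exact: subringD|exact: (idealD iP')].
  - move=> a b Aa [Ab Pb]; split; first exact: subringM.
    by apply: (idealMl iP') => //; apply: sub_adj.
have pP : prime_of A P.
  split=> //; first by case=> _; apply: primeN1 pP'.
  move=> a b Aa Ab [_ Pab].
  by have [] := primeM pP' (sub_adj x Aa) (sub_adj x Ab) Pab; [left|right].
have nP' a : A a -> ~ P a -> ~ P' a by move=> Aa Pa P'a; apply: Pa.
have PP' : extend_ideal P x `<=` P'.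
  move=> _ [h oh ->]; rewrite horner_coef.
  apply: (@ideal_sum _ _ _ iP' _ (fun i => h`_i * x ^+ i)) => i.
  apply: (idealMr iP'); last by case: (oh i).
  exact: (subringX rAx) (mem_adj x).
have [d [C [s [[[pC sC] CP] sd sP gen]]]] := regA P pP.
have sA : {in s, forall y, A y} by move=> y /sP[].
have pCx i : (i <= d)%N -> prime_of (adj A x) (extend_ideal (C i) x).
  by move=> lei; apply/extend_ideal_prime/pC.
have sCx i : (i < d)%N -> extend_ideal (C i) x `<` extend_ideal (C i.+1) x.
  move=> lei; have [C1 C2] := sC i lei; split.
    by move=> _ [h oh ->]; exists h => // j; apply: C1.
  have iC1 := prime_ideal (pC _ lei); have iC := prime_ideal (pC _ (ltnW lei)).
  move=> CC; apply: C2 => a Ca; apply: (contract_extend_ideal iC).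
    exact: idealS Ca.
  apply: CC; exists a%:P; last by rewrite hornerC.
  by move=> j; rewrite coefC; case: ifP => // _; apply: ideal0 iC1.
have [all_P|/existsNP[f0 /not_implyP[of0 /not_implyP[P'f0 nof0]]]] :=
    pselect (forall f, over A f -> P' f.[x] -> over P f).
  exists d, (fun i => extend_ideal (C i) x), s; split=> //.
  - split=> //; rewrite CP; apply/seteqP; split=> // y P'y.
    have [h oh Ey] := idealS iP' P'y.
    by exists h => //; apply: all_P; rewrite -?Ey.
  - by move=> y /sP[].
  - move=> y P'y; have [h oh Ey] := idealS iP' P'y; rewrite Ey in P'y *.
    have [b [Ab Pb Sb]] := common_denominator pP sA gen (all_P _ oh P'y).
    by exists b; split=> //; [exact: sub_adj|exact: nP'].
pose bad n := `[< exists f, [/\ over A f, P' f.[x], ~ over P f & size f = n] >].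
have ex_bad : exists n, bad n.
  by exists (size f0); apply/asboolP; exists f0.
case: (ex_minnP ex_bad) => n /asboolP[f [of_ P'f nof sz_f]] min_n.
have [Pl division] : ~ P (lead_coef f) /\ forall g, over A g -> P' g.[x] ->
    exists k h r, [/\ over A h, over P r
      & (lead_coef f ^+ k)%:P * g = h * f + r].
  apply: (@pseudo_division P P') => // g og P'g lt; apply: contrapT => nog.
  have : bad (size g) by apply/asboolP; exists g.
  by move=> /min_n; rewrite -sz_f leqNgt lt.
have Al : A (lead_coef f) by apply: of_.
exists d.+1, (fun i => if i == d.+1 then P' else extend_ideal (C i) x).
exists (f.[x] :: s); split.
- split; last by rewrite eqxx.
  split=> i lei; first by case: eqVneq => // ne; apply: pCx; lia.
  rewrite eqSS (ltn_eqF lei); case: eqVneq => [->|ne]; last by apply: sCx; lia.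
  rewrite CP; split=> // P'P; apply: nof; apply: mem_extend_ideal => //.
  exact: P'P.
- by rewrite /= sd.
- by move=> y; rewrite inE => /orP[/eqP -> //|/sP[]].
move=> y P'y; have [g og Ey] := idealS iP' P'y; rewrite Ey in P'y *.
have [k [h [r [oh or E]]]] := division g og P'y.
have [b [Ab Pb Sb]] := common_denominator pP sA gen or.
have Alk : A (lead_coef f ^+ k) by apply: subringX.
have Plk : ~ P (lead_coef f ^+ k) by move/(primeX rA pP Al).
exists (b * lead_coef f ^+ k); split.
- by apply: sub_adj; apply: subringM.
- by apply: nP'; [exact: subringM|exact: (primeNM pP)].
exists (b * h.[x]); first by apply: (subringM rAx); [exact: sub_adj|exists h].
have -> : b * lead_coef f ^+ k * g.[x] - b * h.[x] * f.[x] = b * r.[x]; last by [].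
have := congr1 (fun p => p.[x]) E; rewrite hornerD !hornerM hornerC => E'.
by rewrite -mulrA E'; ring.
Qed.

End Transcendental.
End Over.

Definition regular_ring A :=
  [/\ subring A, noetherian A & forall P, prime_of A P -> regular_at A P].

Lemma adj_regular A x :
  regular_ring A -> transcendental A x -> regular_ring (adj A x).
Proof.
move=> [rA nA regA] tx; split; [exact: adj_subring|exact: adj_noetherian|].
by move=> P' pP'; apply: adj_regular_at.
Qed.

Lemma field_regular A : subring A -> (forall a, A a -> A a^-1) -> regular_ring A.
Proof.
move=> rA uA.
have zero_or I : ideal_of A I -> I 1 \/ I = [set 0].
  move=> iI; have [[a [Ia a0]]|no] := pselect (exists a, I a /\ a != 0).
    left; rewrite -(mulVf a0); apply: (idealMl iI) => //.
    by apply: uA; apply: idealS Ia.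
  right; apply/seteqP; split=> [a Ia|_ ->]; last exact: ideal0 iI.
  by apply: contrapT => /eqP a0; apply: no; exists a.
split=> // [I iI|P pP].
  have [I1|->] := zero_or I iI.
    exists [:: 1]; rewrite ideal_gen_span //; last first.
      by move=> y; rewrite inE => /eqP ->; apply: subring1.
    apply/seteqP; split=> [a /(idealS iI) Aa|]; first by exists a => //=; rewrite mulr1 subrr.
    by apply: span_min => // y; rewrite inE => /eqP ->.
  by exists [::]; rewrite ideal_gen_span.
have [P1|EP] := zero_or P (prime_ideal pP); first by case: (primeN1 pP).
exists 0%N, (fun=> P), [::]; split=> // a Pa; exists 1.
split; [exact: subring1|exact: primeN1 pP|].
by rewrite mul1r -[span _ _]EP.
Qed.

End Adjunction.

(** * Transcendence in a field of fractions *)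
Section FixedFractions.
Variables (S : idomainType) (K : fieldType).
Variables (iota : {rmorphism S -> K}) (sigma : {rmorphism S -> {poly S}}).
Hypothesis iota_eq0 : forall a, (iota a == 0) = (a == 0).

(** The fractions whose image under the extension of [sigma] to fractions is
    constant. *)
Definition fixed : set K :=
  [set x | exists a b, [/\ sigma b != 0, sigma a * b%:P = sigma b * a%:P
    & x = iota a / iota b]].

Let den_neq0 b : sigma b != 0 -> b != 0.
Proof. by apply: contraNneq => ->; rewrite rmorph0. Qed.

Let iota_neq0 b : sigma b != 0 -> iota b != 0.
Proof. by move/den_neq0; rewrite iota_eq0. Qed.

Lemma fixed_subring : subring fixed.
Proof.
split.
- by exists 1, 1; rewrite !rmorph1 oner_neq0 divr1.
- move=> _ _ [a [b [b0 E ->]]] [c [d [d0 E' ->]]].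
  exists (a * d - c * b), (b * d); split.
  + by rewrite rmorphM mulf_neq0.
  + rewrite rmorphB !rmorphM !polyCB !polyCM mulrBl mulrBr.
    congr (_ - _).
      transitivity ((sigma a * b%:P) * (sigma d * d%:P)); first by ring.
      by rewrite E; ring.
    transitivity ((sigma c * d%:P) * (sigma b * b%:P)); first by ring.
    by rewrite E'; ring.
  + rewrite rmorphB !rmorphM; field.
    by rewrite (iota_neq0 b0) (iota_neq0 d0).
- move=> _ _ [a [b [b0 E ->]]] [c [d [d0 E' ->]]].
  exists (a * c), (b * d); split.
  + by rewrite rmorphM mulf_neq0.
  + rewrite !rmorphM /=.
    transitivity ((sigma a * b%:P) * (sigma c * d%:P)); first by ring.
    by rewrite E E'; ring.
  + by rewrite !rmorphM invfM mulrACA.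
Qed.

Lemma fixedV x : fixed x -> fixed x^-1.
Proof.
move=> [a [b [b0 E ->]]]; have [a0|a0] := eqVneq a 0.
  rewrite a0 rmorph0 mul0r invr0; exact: subring0 fixed_subring.
exists b, a; rewrite E invf_div; split=> //.
have : sigma b * a%:P != 0 by rewrite mulf_neq0 // polyC_eq0.
by rewrite -E; apply: contraNneq => ->; rewrite mul0r.
Qed.

Lemma fixed_iota a : sigma a = a%:P -> fixed (iota a).
Proof.
by move=> E; exists a, 1; rewrite E !rmorph1 oner_neq0 mulrC divr1.
Qed.

Lemma over_fixed_denominator (h : {poly K}) : over fixed h ->
  exists b (P : {poly S}), [/\ sigma b != 0,
    forall i, sigma P`_i * b%:P = sigma b * (P`_i)%:P
    & (iota b)%:P * h = map_poly iota P].
Proof.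
elim/poly_ind: h => [_|h c IH ohc].
  exists 1, 0; rewrite rmorph1 oner_neq0 mulr0 rmorph0; split=> // i.
  by rewrite coef0 rmorph0 !(mul0r, mulr0).
have oh : over fixed h.
  by move=> i; have := ohc i.+1; rewrite coefD coefMX coefC addr0.
have [a [d [d0 Ea Ec]]] : fixed c.
  by have := ohc 0%N; rewrite coefD coefMX coefC add0r.
have [b [P [b0 EP Eb]]] := IH oh.
exists (d * b), (d%:P * P * 'X + (b * a)%:P); split.
- by rewrite rmorphM mulf_neq0.
- move=> i; rewrite coefD coefMX coefC coefCM; case: i => [|i] /=.
    rewrite add0r !rmorphM /=.
    transitivity ((sigma a * d%:P) * (sigma b * b%:P)); first by ring.
    by rewrite Ea; ring.
  rewrite addr0 !rmorphM /=.
  transitivity ((sigma P`_i * b%:P) * (sigma d * d%:P)); first by ring.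
  by rewrite EP; ring.
- transitivity ((iota d)%:P * ((iota b)%:P * h) * 'X + (iota d * iota b * c)%:P).
    by rewrite (rmorphM iota) !polyCM; ring.
  rewrite Eb Ec [RHS]rmorphD; congr (_ + _).
    by rewrite !rmorphM /= map_polyX map_polyC.
  rewrite /= map_polyC /= (rmorphM iota); congr _%:P.
  by field; rewrite iota_neq0.
Qed.

(** A polynomial relation for [x] over the fixed fractions is also a relation
    for [sigma x]; but the composite of a nonzero polynomial and a nonconstant
    one is not zero. *)
Lemma fixed_transcendental x :
  (1 < size (sigma x))%N -> transcendental fixed (iota x).
Proof.
move=> sx h oh h0; have [b [P [b0 EP Eb]]] := over_fixed_denominator oh.
have tb0 := iota_neq0 b0.
have Px0 : P.[x] = 0.
  apply/eqP; rewrite -(iota_eq0 P.[x]) -horner_map -Eb /=.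
  by rewrite hornerM h0 mulr0.
have : sigma b * (P \Po sigma x) = b%:P * sigma P.[x].
  rewrite comp_polyE horner_coef rmorph_sum !mulr_sumr; apply: eq_bigr => i _.
  rewrite rmorphM rmorphXn -mul_polyC /= !mulrA [b%:P * _]mulrC EP.
  by [].
rewrite Px0 rmorph0 mulr0 => /eqP.
rewrite mulf_eq0 (negbTE b0) /= comp_poly_eq0 // => /eqP P0.
move/eqP: Eb; rewrite P0 rmorph0 mulf_eq0 polyC_eq0 (negbTE tb0) /=.
by move/eqP.
Qed.

End FixedFractions.

Section TranscendentalOperations.
Variables (K : fieldType) (A : set K).
Hypotheses (rA : subring A).

Lemma transcendental_sub (B : set K) x :
  A `<=` B -> transcendental B x -> transcendental A x.
Proof. by move=> AB tx h oh; apply: tx => i; apply: AB. Qed.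

Lemma transcendental_scale c x :
  A c -> c != 0 -> transcendental A x -> transcendental A (c * x).
Proof.
move=> Ac c0 tx h oh h0.
have sc : size (c *: 'X : {poly K}) = 2 by rewrite size_scale // size_polyX.
apply/eqP; rewrite -(comp_poly2_eq0 _ sc); apply/eqP/tx; last first.
  by rewrite horner_comp !hornerE.
have -> : h \Po (c *: 'X) = \poly_(i < size h) (h`_i * c ^+ i).
  rewrite comp_polyE poly_def; apply: eq_bigr => i _.
  by rewrite exprZn scalerA.
move=> i; rewrite coef_poly; case: ifP => _; last exact: subring0.
by apply: subringM => //; apply: subringX.
Qed.

(** Reverse the coefficients of a relation. *)
Lemma transcendentalV x : transcendental A x -> transcendental A x^-1.
Proof.
have nat1 (n i : nat) : (i < n)%N -> (n.-1 - (n - i.+1) = i)%N by lia.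
have nat2 (n i : nat) : (i < n)%N -> (n - i.+1 + i = n.-1)%N by lia.
have nat3 (n i : nat) : (i < n)%N -> (n.-1 - i < n)%N by lia.
have nat4 (n i : nat) : (i < n)%N -> (n.-1 - (n.-1 - i) = i)%N by lia.
move=> tx h oh hV0; have [x0|x0] := eqVneq x 0.
  by apply: tx => //; move: hV0; rewrite x0 invr0.
pose g := \poly_(i < size h) h`_((size h).-1 - i).
have g0 : g = 0.
  apply: tx => [i|].
    by rewrite coef_poly; case: ifP => // _; apply: subring0.
  transitivity (x ^+ (size h).-1 * h.[x^-1]); last by rewrite hV0 mulr0.
  rewrite horner_poly horner_coef mulr_sumr [LHS](reindex_inj rev_ord_inj) /=.
  apply: eq_bigr => i _.
  have lti := ltn_ord i.
  rewrite (nat1 _ _ lti) mulrCA; congr (_ * _).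
  by rewrite -(nat2 _ _ lti) exprD exprVn mulfK // expf_neq0.
apply/polyP => i; rewrite coef0; have [lti|gei] := ltnP i (size h); last first.
  by rewrite nth_default.
have := congr1 (fun p : {poly K} => p`_((size h).-1 - i)) g0.
by rewrite coef0 coef_poly nat3 // nat4.
Qed.

End TranscendentalOperations.

Lemma invfD_mul (K : fieldType) (x y : K) : x != 0 -> y != 0 -> x + y != 0 ->
  x^-1 * y^-1 = (x + y)^-1 * (x^-1 + y^-1).
Proof. by move=> x0 y0 xy0; field; rewrite x0 y0 xy0. Qed.

(** * The symmetric algebra and its field of fractions *)
Section SymmetricAlgebra.
Context {F : finFieldType} {V : vectType F}.
Implicit Types (u v w : V) (c : F).

Local Notation S := (symalg V).

Definition lin v : S := \sum_(i < \dim {:V}) coord (vbasis {:V}) i v *: 'X_i.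

Lemma lin_is_linear c u v : lin (c *: u + v) = c%:MP * lin u + lin v.
Proof.
rewrite /lin mulr_sumr -big_split; apply: eq_bigr => i _ /=.
by rewrite linearP scalerDl mul_mpolyC scalerA.
Qed.

(** The universal property of the symmetric algebra, through which all that
    follows uses [symalg], without reference to a basis. *)
Lemma symext (T : comNzRingType) (f : {rmorphism F -> T}) (L : V -> T) :
  (forall c u v, L (c *: u + v) = f c * L u + L v) ->
  {ev : {rmorphism S -> T} | (forall c, ev c%:MP = f c)
    & forall v, ev (lin v) = L v}.
Proof.
move=> Llin; pose h i := L (vbasis {:V})`_i.
have L0 : L 0 = 0.
  have := Llin 1 0 0; rewrite scale1r addr0 rmorph1 mul1r.
  by move=> /esym/(canRL (addrK _)); rewrite subrr.
have LZ c v : L (c *: v) = f c * L v by rewrite -[c *: v]addr0 Llin L0 addr0.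
have LD u v : L (u + v) = L u + L v.
  by have := Llin 1 u v; rewrite scale1r rmorph1 mul1r.
pose ev : {rmorphism S -> T} := mmap f (h : 'I_(\dim {:V}) -> T).
exists ev => [c|v]; first exact: mmapC.
rewrite rmorph_sum [in RHS](coord_vbasis (memvf v)).
rewrite (big_morph L LD L0); apply: eq_bigr => i _.
by rewrite LZ -mul_mpolyC rmorphM /ev /= mmapC mmapX mmap1U.
Qed.

Lemma lin_eq0 v : (lin v == 0) = (v == 0).
Proof.
apply/eqP/eqP => [v0|->]; last first.
  by rewrite /lin big1 // => i _; rewrite linear0 scale0r.
rewrite (coord_vbasis (memvf v)) big1 // => i _.
have [|ev _ evL] := @symext F idfun (coord (vbasis {:V}) i).
  by move=> c u w; rewrite linearP.
by rewrite -evL v0 rmorph0 scale0r.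
Qed.

Lemma eltE v : elt v = tofrac (lin v). Proof. by []. Qed.
Lemma scalE c : scal c = tofrac (c%:MP : S). Proof. by []. Qed.

Lemma elt_is_linear c u v : elt (c *: u + v) = scal c * elt u + elt v :> KV V.
Proof. by rewrite !eltE lin_is_linear tofracD tofracM. Qed.

Lemma scal1 : scal 1 = 1 :> KV V.
Proof. by rewrite scalE mpolyC1 tofrac1. Qed.

Lemma scal0 : scal 0 = 0 :> KV V.
Proof. by rewrite scalE mpolyC0 tofrac0. Qed.

Lemma scalM c d : scal (c * d) = scal c * scal d :> KV V.
Proof. by rewrite !scalE mpolyCM tofracM. Qed.

Lemma scalD c d : scal (c + d) = scal c + scal d :> KV V.
Proof. by rewrite !scalE mpolyCD tofracD. Qed.

Lemma scalN c : scal (- c) = - scal c :> KV V.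
Proof. by rewrite !scalE mpolyCN tofracN. Qed.

Lemma eltD u v : elt (u + v) = elt u + elt v :> KV V.
Proof. by rewrite -[u]scale1r elt_is_linear scal1 mul1r scale1r. Qed.

Lemma elt_eq0 v : (elt v == 0) = (v == 0).
Proof. by rewrite eltE tofrac_eq0 lin_eq0. Qed.

Lemma elt0 : elt 0 = 0 :> KV V.
Proof. by apply/eqP; rewrite elt_eq0. Qed.

Lemma eltZ c v : elt (c *: v) = scal c * elt v :> KV V.
Proof. by rewrite -[c *: v]addr0 elt_is_linear elt0 addr0. Qed.

Lemma scal_eq0 c : (scal c == 0 :> KV V) = (c == 0).
Proof. by rewrite scalE tofrac_eq0 mpolyC_eq0. Qed.

Lemma scalV c : scal c^-1 = (scal c)^-1 :> KV V.
Proof.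
have [->|c0] := eqVneq c 0; first by rewrite invr0 scal0 invr0.
apply: (@mulfI _ (scal c)); first by rewrite scal_eq0.
by rewrite -scalM !divff ?scal1 ?scal_eq0.
Qed.

(** This relation makes the nonvanishing reciprocals at a point those of a
    subspace, and it is the one that obstructs regularity. *)
Lemma elt_invD u v : u != 0 -> v != 0 -> u + v != 0 ->
  (elt u)^-1 * (elt v)^-1 = (elt (u + v))^-1 * ((elt u)^-1 + (elt v)^-1) :> KV V.
Proof.
rewrite -!elt_eq0 eltD; exact: invfD_mul.
Qed.

End SymmetricAlgebra.

Section Weight.
Variables (S : idomainType) (K : fieldType).
Variables (iota : {rmorphism S -> K}) (sigma : {rmorphism S -> {poly S}}).
Hypothesis iota_eq0 : forall a, (iota a == 0) = (a == 0).

(** The fractions [x] whose image under the extension of [sigma] to fractions is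
    [x * 'X ^ d]. *)
Definition weight (d : int) : set K := [set x | exists a b (k l : nat),
  [/\ sigma b != 0, sigma a * b%:P * 'X^k = sigma b * a%:P * 'X^l,
      l%:Z = k%:Z + d & x = iota a / iota b]].

Let iota_neq0 b : sigma b != 0 -> iota b != 0.
Proof. by rewrite iota_eq0; apply: contraNneq => ->; rewrite rmorph0. Qed.

Lemma weight0 d : weight d 0.
Proof.
have [k [l E]] : exists k l : nat, l%:Z = k%:Z + d.
  by case: d => n; [exists 0%N, n|exists n.+1, 0%N]; lia.
exists 0, 1, k, l; rewrite !rmorph0 !rmorph1 oner_neq0 mul0r.
by split=> //; ring.
Qed.

Lemma weightD d x y : weight d x -> weight d y -> weight d (x + y).
Proof.
move=> [a [b [k [l [b0 E Ekl ->]]]]] [a' [b' [k' [l' [b'0 E' Ekl' ->]]]]].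
exists (a * b' + a' * b), (b * b'), (k + k')%N, (l + k')%N; split.
- by rewrite rmorphM mulf_neq0.
- have Ell : (l + k' = l' + k)%N by lia.
  rewrite (rmorphD sigma) !(rmorphM sigma) polyCD !polyCM.
  transitivity (sigma b' * b'%:P * (sigma a * b%:P * 'X^k) * 'X^k'
    + sigma b * b%:P * (sigma a' * b'%:P * 'X^k') * 'X^k).
    by rewrite exprD; ring.
  transitivity (sigma b * sigma b' * a%:P * b'%:P * 'X^(l + k')
    + sigma b * sigma b' * a'%:P * b%:P * 'X^(l' + k)).
    by rewrite E E' !exprD; ring.
  by rewrite -Ell; ring.
- by rewrite !PoszD Ekl; ring.
- by rewrite rmorphD !rmorphM; field; rewrite !iota_neq0.
Qed.

Lemma weightM d e x y : weight d x -> weight e y -> weight (d + e) (x * y).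
Proof.
move=> [a [b [k [l [b0 E Ekl ->]]]]] [a' [b' [k' [l' [b'0 E' Ekl' ->]]]]].
exists (a * a'), (b * b'), (k + k')%N, (l + l')%N; split.
- by rewrite rmorphM mulf_neq0.
- rewrite !(rmorphM sigma) !polyCM.
  transitivity ((sigma a * b%:P * 'X^k) * (sigma a' * b'%:P * 'X^k')).
    by rewrite exprD; ring.
  by rewrite E E' exprD; ring.
- by rewrite !PoszD Ekl Ekl'; ring.
- by rewrite !rmorphM invfM mulrACA.
Qed.

Lemma weight_iota a : sigma a = a%:P -> weight 0 (iota a).
Proof.
move=> E; exists a, 1, 0%N, 0%N; rewrite E !rmorph1 oner_neq0 divr1.
by split=> //; ring.
Qed.

Lemma weight1 a : sigma a = a%:P * 'X -> weight 1 (iota a).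
Proof.
move=> E; exists a, 1, 0%N, 1%N; rewrite E !rmorph1 oner_neq0 divr1.
by split=> //; ring.
Qed.

Lemma weightN1 a : a != 0 -> sigma a = a%:P * 'X -> weight (-1) (iota a)^-1.
Proof.
move=> a0 E; exists 1, a, 1%N, 0%N; rewrite E !rmorph1 div1r; split=> //.
  by rewrite mulf_neq0 ?polyC_eq0 // polyX_eq0.
by rewrite mul1r expr0 !mulr1 expr1.
Qed.

Lemma weight_fixed : weight 0 `<=` fixed iota sigma.
Proof.
move=> x [a [b [k [l [b0 E Ekl ->]]]]]; exists a, b; split=> //.
have Elk : l = k by lia.
by apply: (mulIf (monic_neq0 (monicXn _ k))); rewrite E Elk.
Qed.

End Weight.

Section Transcendence.
Context {F : finFieldType} {V : vectType F}.
Implicit Types (u v w : V) (c : F) (W : {vspace V}).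

Local Notation S := (symalg V).
Local Notation K := (KV V).

Lemma separating_functional W v : v \notin W -> exists l : V -> F,
  [/\ forall c u w, l (c *: u + w) = c * l u + l w,
      forall w, w \in W -> l w = 0 & l v = 1].
Proof.
move=> vW; pose pr u := u - projv W u.
have prv : pr v != 0.
  apply: contra vW => /eqP/subr0_eq ->; exact: memv_proj.
have [i ci] : exists i, coord (vbasis {:V}) i (pr v) != 0.
  apply: contrapT => no; case/eqP: prv.
  rewrite (coord_vbasis (memvf (pr v))) big1 // => i _.
  by have [->|ne] := eqVneq (coord (vbasis {:V}) i (pr v)) 0;
    [rewrite scale0r|case: no; exists i].
exists (fun u => coord (vbasis {:V}) i (pr u) / coord (vbasis {:V}) i (pr v)).
split=> [c u w|w Ww|]; last by rewrite divff.
- rewrite mulrA -mulrDl -linearP; congr (coord _ _ _ / _).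
  by rewrite /pr linearP scalerBr opprD addrACA.
- by rewrite /pr projv_id // subrr linear0 mul0r.
Qed.

Let f : {rmorphism F -> {poly S}} := polyC \o @mpolyC (\dim {:V}) F.

(** A vector outside [W] is transcendental over the fractions of [W]: the
    automorphisms that translate it by a constant fix [W]. *)
Lemma elt_transcendental W v : v \notin W -> exists L : set K,
  [/\ subring L, forall x, L x -> L x^-1, forall c, L (scal c),
      forall w, w \in W -> L (elt w) & transcendental L (elt v)].
Proof.
move=> /separating_functional[l [llin lW lv]].
have [|sigma sC sL] := @symext F V _ f (fun u => (lin u)%:P + f (l u) * 'X).
  move=> c u w; rewrite lin_is_linear llin (rmorphD f) (rmorphM f) polyCD polyCM.
  by rewrite mulrDl mulrDr addrACA mulrA.
have iota0 (a : S) : (tofrac a == 0 :> K) = (a == 0) by exact: tofrac_eq0.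
exists (fixed (@FracField.tofrac S) sigma); split.
- exact: fixed_subring.
- exact: fixedV.
- by move=> c; apply: fixed_iota; apply: sC.
- by move=> w /lW lw; apply: fixed_iota; rewrite sL lw rmorph0 mul0r addr0.
- apply: fixed_transcendental => //.
  rewrite sL lv rmorph1 mul1r addrC size_polyDl size_polyX //.
  exact: leq_ltn_trans (size_polyC_leq1 _) _.
Qed.

Lemma ratio_transcendental W v1 v : v1 \in W -> v1 != 0 -> v \notin W ->
  exists L : set K, [/\ subring L, forall c, L (scal c),
    forall w, w \in W -> L (elt w / elt v1),
    transcendental L (elt v / elt v1) & transcendental L (elt v1 / elt v)].
Proof.
move=> Wv1 v10 /elt_transcendental[L [rL LV Ls LW Lv]].
have Lv1 : L (elt v1)^-1 by apply/LV/LW.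
have tr : transcendental L (elt v / elt v1).
  by rewrite mulrC; apply: transcendental_scale; rewrite // invr_eq0 elt_eq0.
exists L; split=> //.
- by move=> w Ww; apply: subringM => //; apply: LW.
- by rewrite -invf_div; apply: transcendentalV.
Qed.

(** The homothety with an indeterminate factor fixes the fractions of degree [0]
    and moves [w]. *)
Lemma inverse_transcendental w : w != 0 ->
  transcendental (RSV0 V) (elt w)^-1.
Proof.
move=> w0.
have [|sigma sC sL] := @symext F V _ f (fun u => (lin u)%:P * 'X).
  by move=> c u v; rewrite lin_is_linear /= polyCD polyCM mulrDl mulrA.
have iota0 (a : S) : (tofrac a == 0 :> K) = (a == 0) by exact: tofrac_eq0.
have wt (d : int) (x : K) :
    graded_part (RSV_gens V) d x -> weight (@FracField.tofrac S) sigma d x.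
  elim=> [c|e y [[-> [v v0 <-]]|[-> [v v0 <-]]]|e|e y z _ wy _ wz|e g y z _ wy _ wz].
  - by apply: weight_iota; apply: sC.
  - by apply: weightN1; [rewrite lin_eq0|apply: sL].
  - by apply: weight1; apply: sL.
  - exact: weight0.
  - exact: weightD.
  - exact: weightM.
apply: (transcendental_sub (B := fixed (@FracField.tofrac S) sigma)).
  by move=> x /wt /weight_fixed.
apply: transcendentalV; first exact: fixed_subring.
apply: fixed_transcendental => //.
by rewrite sL size_mulX ?polyC_eq0 ?lin_eq0 // size_polyC lin_eq0 w0.
Qed.

End Transcendence.

Lemma expfVK (K : fieldType) n (x y : K) :
  y != 0 -> x * y ^+ n * y^-1 ^+ n = x.
Proof. by move=> y0; rewrite exprVn mulfK // expf_neq0. Qed.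

Lemma mul_swap (K : fieldType) (b c d x y : K) :
  b * ((c * x) * (d * y)) = (c * d) * (b * (x * y)).
Proof. by ring. Qed.

Lemma ratio_mulV (K : fieldType) (x y : K) : x != 0 -> y != 0 ->
  y / x * (x / y) = 1.
Proof. by move=> x0 y0; field; rewrite x0 y0. Qed.

(** * The graded ring [R_V] and the open stratum *)
Section GradedRing.
Context {F : finFieldType} {V : vectType F}.
Implicit Types (u v w : V) (c : F).

Local Notation K := (KV V).
Local Notation inv v := ((elt v)^-1 : K).

Lemma subalgebra_subring (A : set K) : subalgebra A -> subring A.
Proof.
move=> [As AD AM]; split=> //; first by rewrite -scal1.
move=> x y Ax Ay; apply: AD => //; rewrite -mulN1r -scal1 -scalN.
exact: AM.
Qed.

Lemma generated_subalgebra (G : set K) : subalgebra (smallest subalgebra G).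
Proof.
split=> [c A [[As _ _] _] //|x y Ax Ay A hA|x y Ax Ay A hA].
  by have [[_ AD _] _] := hA; apply: AD; [apply: Ax|apply: Ay].
by have [[_ _ AM] _] := hA; apply: AM; [apply: Ax|apply: Ay].
Qed.

Lemma RV_subring : subring (RV V).
Proof. exact/subalgebra_subring/generated_subalgebra. Qed.

Lemma RSV_subring : subring (RSV V).
Proof. exact/subalgebra_subring/generated_subalgebra. Qed.

Lemma RV_scal c : RV V (scal c).
Proof. by have [Rs _ _] := generated_subalgebra (Vinv V); apply: Rs. Qed.

Lemma RV_inv v : v != 0 -> RV V (inv v).
Proof. by move=> v0; apply: sub_gen_smallest; exists v. Qed.

Lemma RV_ind (P : set K) :
  (forall c, P (scal c)) -> (forall v, v != 0 -> P (inv v)) ->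
  (forall x y, RV V x -> RV V y -> P x -> P y -> P (x + y)) ->
  (forall x y, RV V x -> RV V y -> P x -> P y -> P (x * y)) ->
  forall x, RV V x -> P x.
Proof.
move=> Ps Pv PD PM x Rx; have rR := RV_subring.
suff [] : (RV V `&` P) x by [].
apply: (smallest_sub _ _ Rx).
  split=> [c|y z [Ry Py] [Rz Pz]|y z [Ry Py] [Rz Pz]].
  - by split; [exact: RV_scal|exact: Ps].
  - by split; [exact: (subringD rR)|exact: PD].
  - by split; [exact: (subringM rR)|exact: PM].
by move=> _ [v v0 <-]; split; [exact: RV_inv|exact: Pv].
Qed.

Lemma RVdeg_scal c : RVdeg V 0 (scal c).
Proof. by rewrite /RVdeg oppr0; apply: graded_scal. Qed.

Lemma RVdeg_inv v : v != 0 -> RVdeg V 1 (inv v).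
Proof. by move=> v0; apply: graded_gen; split=> //; exists v. Qed.

Lemma RVdeg0 n : RVdeg V n 0. Proof. exact: graded_zero. Qed.

Lemma RVdegD n x y : RVdeg V n x -> RVdeg V n y -> RVdeg V n (x + y).
Proof. exact: graded_add. Qed.

Lemma RVdegM m n x y : RVdeg V m x -> RVdeg V n y -> RVdeg V (m + n) (x * y).
Proof. by rewrite /RVdeg PoszD opprD; apply: graded_mul. Qed.

Lemma RVdegM_eq m n k x y : (m + n)%N = k ->
  RVdeg V m x -> RVdeg V n y -> RVdeg V k (x * y).
Proof. by move=> <-; apply: RVdegM. Qed.

Lemma RVdegN n x : RVdeg V n x -> RVdeg V n (- x).
Proof.
by move=> Rx; rewrite -mulN1r -scal1 -scalN; apply: (RVdegM (RVdeg_scal _)).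
Qed.

Lemma RVdegX x n : RVdeg V 1 x -> RVdeg V n (x ^+ n).
Proof.
move=> Rx; elim: n => [|n IH]; first by rewrite expr0 -scal1; apply: RVdeg_scal.
by rewrite exprS; apply: (RVdegM Rx IH).
Qed.

Lemma RVdeg_ind (P : nat -> set K) :
  (forall c, P 0%N (scal c)) -> (forall v, v != 0 -> P 1%N (inv v)) ->
  (forall n, P n 0) ->
  (forall n x y, RVdeg V n x -> RVdeg V n y -> P n x -> P n y -> P n (x + y)) ->
  (forall m n x y, RVdeg V m x -> RVdeg V n y -> P m x -> P n y ->
    P (m + n)%N (x * y)) ->
  forall n x, RVdeg V n x -> P n x.
Proof.
move=> Ps Pv P0 PD PM n x Rx.
(* In the sign convention of [graded_part], only [0] has positive degree, and
   [graded_zero] puts it in every degree. *)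
suff [->//|[k [Ek Px _]]] : x = 0 \/ exists k : nat,
    [/\ - n%:Z = - k%:Z, P k x & RVdeg V k x].
  by have -> : n = k by lia.
elim: {n} (- n%:Z) x / Rx => [c|d x [-> [v v0 <-]]|d|d x y _ IHx _ IHy|d e x y _ IHx _ IHy].
- by right; exists 0%N; split; [rewrite oppr0|exact: Ps|exact: RVdeg_scal].
- by right; exists 1%N; split; [|exact: Pv|exact: RVdeg_inv].
- by left.
- case: IHx => [->|[k [Ek Pk Rk]]]; first by rewrite add0r.
  case: IHy => [->|[l [El Pl Rl]]]; first by rewrite addr0; right; exists k.
  have Ekl : k = l by move: El; rewrite Ek; lia.
  rewrite -Ekl in Pl Rl.
  by right; exists k; split=> //; [exact: PD|exact: RVdegD].
- case: IHx => [->|[k [Ek Pk Rk]]]; first by left; rewrite mul0r.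
  case: IHy => [->|[l [El Pl Rl]]]; first by left; rewrite mulr0.
  right; exists (k + l)%N; split; [by rewrite Ek El; lia|exact: PM|exact: RVdegM].
Qed.

Lemma RVdeg_sub n : RVdeg V n `<=` RV V.
Proof.
move=> x; have rR := RV_subring; apply: (RVdeg_ind (P := fun=> RV V)) => //.
- exact: RV_scal.
- exact: RV_inv.
- by move=> _; apply: (subring0 rR).
- by move=> *; apply: (subringD rR).
- by move=> *; apply: (subringM rR).
Qed.

(** A polynomial whose [i]-th coefficient has degree [i] stands for the
    decomposition of its value at [1] into homogeneous parts. *)
Definition graded_poly (h : {poly K}) := forall i, RVdeg V i h`_i.

Lemma RV_decomposition x : RV V x -> exists2 h, graded_poly h & x = h.[1].
Proof.
have gsum i n (f : nat -> K) :
    (forall j, (j < n)%N -> RVdeg V i (f j)) -> RVdeg V i (\sum_(j < n) f j).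
  elim: n => [|n IH] Rf; first by rewrite big_ord0; apply: RVdeg0.
  rewrite big_ord_recr /=; apply: RVdegD; last exact: Rf.
  by apply: IH => j lt; apply: Rf; apply: ltnW.
move: x; apply: RV_ind.
- move=> c; exists (scal c)%:P; last by rewrite hornerC.
  by move=> [|i]; rewrite coefC; [exact: RVdeg_scal|exact: RVdeg0].
- move=> v v0; exists ((inv v)%:P * 'X); last by rewrite hornerMX hornerC mulr1.
  move=> i; rewrite coefMX coefC; case: i => [|[|i]] /=.
  + exact: RVdeg0.
  + exact: RVdeg_inv.
  + exact: RVdeg0.
- move=> _ _ _ _ [h gh ->] [g gg ->]; exists (h + g); last by rewrite hornerD.
  by move=> i; rewrite coefD; apply: RVdegD.
- move=> _ _ _ _ [h gh ->] [g gg ->]; exists (h * g); last by rewrite hornerM.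
  move=> i; rewrite coefM; apply: (gsum i _ (fun j => h`_j * g`_(i - j))) => j.
  by rewrite ltnS => lej; apply: (RVdegM_eq (subnKC lej)).
Qed.

Lemma homogeneousP (I : set K) : ideal_of (RV V) I -> homogeneous I <->
  forall x, I x -> exists h, [/\ graded_poly h, forall i, I h`_i & x = h.[1]].
Proof.
move=> iI; split=> hI x /hI.
  move=> [n [f [If Ex]]]; exists (\poly_(i < n) f i); split.
  - by move=> i; rewrite coef_poly; case: ifP => _; [case: (If i)|exact: RVdeg0].
  - by move=> i; rewrite coef_poly; case: ifP => _; [case: (If i)|exact: ideal0 iI].
  - by rewrite horner_poly Ex; apply: eq_bigr => i _; rewrite expr1n mulr1.
move=> [h [gh Ih ->]]; exists (size h), (fun i => h`_i); split=> //.
by rewrite horner_coef; apply: eq_bigr => i _; rewrite expr1n mulr1.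
Qed.

Lemma RSV0_subring : subring (RSV0 V).
Proof.
apply: subalgebra_subring; split=> [c|x y|x y]; first exact: graded_scal.
  exact: graded_add.
by move=> Rx Ry; have := @graded_mul _ _ _ _ _ _ _ Rx Ry; rewrite addr0.
Qed.

Lemma RSV0_ratio v w : w != 0 -> RSV0 V (elt v / elt w).
Proof.
move=> w0; have [->|v0] := eqVneq v 0.
  rewrite elt0 mul0r; exact: graded_zero.
have : graded_part (RSV_gens V) (1 + -1) (elt v / elt w).
  by apply: graded_mul; apply: graded_gen; [right; split=> //; exists v|
    left; split=> //; exists w].
by rewrite addrN.
Qed.

Lemma RSV0_RSV : RSV0 V `<=` RSV V.
Proof.
have rR := RSV_subring; have [Rs _ _] := generated_subalgebra (Vinv V `|` Vlin V).
move=> x; elim=> [c|d y Gy|d|d y z _ IHy _ IHz|d e y z _ IHy _ IHz].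
- exact: Rs.
- by apply: sub_gen_smallest; case: Gy => -[_ Gy]; [left|right].
- exact: (subring0 rR).
- exact: (subringD rR).
- exact: (subringM rR).
Qed.

Lemma RV_RSV : RV V `<=` RSV V.
Proof.
apply: smallest_sub; first exact: generated_subalgebra.
by move=> x Vx; apply: sub_gen_smallest; left.
Qed.

Lemma RVdeg_shift w n x : w != 0 -> RVdeg V n x -> RSV0 V (x * elt w ^+ n).
Proof.
move=> w0; have rR := RSV0_subring.
apply: (RVdeg_ind (P := fun n x => RSV0 V (x * elt w ^+ n))) => {n x}.
- by move=> c; rewrite expr0 mulr1; apply: graded_scal.
- by move=> v v0; rewrite expr1 mulrC; apply: RSV0_ratio.
- by move=> n; rewrite mul0r; apply: (subring0 rR).
- by move=> n x y _ _ Rx Ry; rewrite mulrDl; apply: (subringD rR).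
- by move=> m n x y _ _ Rx Ry; rewrite exprD mulrACA; apply: (subringM rR).
Qed.

Section DegreeOne.
Variable w : V.
Hypothesis w0 : w != 0.

Local Notation t := (inv w).

Let rR0 := RSV0_subring.
Let tr := inverse_transcendental w0.
Let et0 : elt w != 0 :> K. Proof. by rewrite elt_eq0. Qed.

Lemma RV_adj : RV V `<=` adj (RSV0 V) t.
Proof.
have rA := adj_subring rR0 t; apply: smallest_sub; last first.
  move=> _ [v v0 <-]; have -> : (inv v) = elt w / elt v * t.
    by rewrite mulrAC divff ?mul1r // elt_eq0.
  apply: (subringM rA); last exact: mem_adj.
  exact/(sub_adj rR0)/RSV0_ratio.
split=> [c|x y|x y]; [|exact: (subringD rA)|exact: (subringM rA)].
exact/(sub_adj rR0)/graded_scal.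
Qed.

Lemma RSV_adj r : RSV V r -> exists n, adj (RSV0 V) t (t ^+ n * r).
Proof.
have rA := adj_subring rR0 t; have At := mem_adj rR0 t.
have AX n := subringX rA n At.
apply: (smallest_sub (X := [set r | exists n, adj (RSV0 V) t (t ^+ n * r)])).
  split.
  - move=> c; exists 0%N; rewrite expr0 mul1r; apply/(sub_adj rR0)/graded_scal.
  - move=> x y [m Ax] [n Ay]; exists (m + n)%N.
    rewrite mulrDr {1}addnC !exprD -!mulrA.
    by apply: (subringD rA); apply: (subringM rA) => //; apply: AX.
  - move=> x y [m Ax] [n Ay]; exists (m + n)%N.
    by rewrite exprD mulrACA; apply: (subringM rA).
move=> _ [[v v0 <-]|[v v0 <-]].
  by exists 0%N; rewrite expr0 mul1r; apply: RV_adj; apply: RV_inv.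
exists 1%N; rewrite expr1 mulrC; exact/(sub_adj rR0)/RSV0_ratio.
Qed.

Lemma extend_ideal_t (P : set K) : prime_of (RSV0 V) P -> ~ extend_ideal P t t.
Proof.
move=> pP; have oX : over (RSV0 V) 'X by apply: (overXn rR0 1).
rewrite -{2}(hornerX t) => /(mem_extend_ideal rR0 tr (prime_ideal pP) oX).
by move=> /(_ 1%N); rewrite coefX; apply: primeN1 pP.
Qed.

(** [RS_V] is the ring of Laurent polynomials in [t] over its part of degree [0],
    and [R_V] is contained in the polynomials in [t].  An element of [R_V] in the
    ideal generated by [P] thus has a multiple [t ^+ n * x] in [P[t]], a prime that
    does not contain [t]. *)
Lemma Omega_ideal (P : set K) : prime_of (RSV0 V) P ->
  RV V `&` ideal_gen (RSV V) P = RV V `&` extend_ideal P t.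
Proof.
move=> pP; have iP := prime_ideal pP; have rA := adj_subring rR0 t.
have pE := extend_ideal_prime rR0 tr pP; have iE := prime_ideal pE.
have At := mem_adj rR0 t.
have PR : P `<=` RSV V by move=> x /(idealS iP); apply: RSV0_RSV.
apply/seteqP; split=> x [Rx Ix]; split=> //.
  suff [_ [n En]] :
      (RSV V `&` [set y | exists n, extend_ideal P t (t ^+ n * y)]) x.
    have [/(primeX rA pE At)|//] :=
      primeM pE (subringX rA n At) (RV_adj Rx) En.
    by move/(extend_ideal_t pP).
  apply: (smallest_sub _ _ Ix); last first.
    move=> y Py; split; first exact: PR.
    exists 0%N; rewrite expr0 mul1r; exists y%:P; last by rewrite hornerC.
    by move=> i; rewrite coefC; case: ifP => // _; apply: ideal0 iP.
  have rR := RSV_subring; split.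
  - by move=> y [].
  - split; first exact: (subring0 rR).
    by exists 0%N; rewrite mulr0; apply: ideal0 iE.
  - move=> y z [Ry [m Ey]] [Rz [n Ez]]; split; first exact: (subringD rR).
    exists (m + n)%N; rewrite mulrDr {1}addnC !exprD -!mulrA.
    by apply: (idealD iE); apply: (idealMl iE) => //; apply: (subringX rA).
  - move=> y z Ry [Rz [n Ez]]; split; first exact: (subringM rR).
    have [m Ay] := RSV_adj Ry; exists (m + n)%N.
    by rewrite exprD mulrACA; apply: (idealMl iE).
have iG : ideal_of (RSV V) (ideal_gen (RSV V) P).
  by apply: ideal_gen_ideal PR; apply: RSV_subring.
have [h oh ->] := Ix; rewrite horner_coef.
apply: (@ideal_sum _ _ _ iG _ (fun i => h`_i * t ^+ i)) => i.
apply: (idealMr iG); last exact: sub_gen_smallest (oh i).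
by apply: (subringX RSV_subring); apply: RV_RSV; apply: RV_inv.
Qed.

(** All three properties are read off from the coefficients of a polynomial
    in [t], which are well defined since [t] is transcendental. *)
Lemma Omega_properties q : OmegaV V q ->
  [/\ prime_of (RV V) q, forall v, v != 0 -> ~ q (inv v)
    & forall h, graded_poly h -> q h.[1] -> forall i, q h`_i].
Proof.
move=> [P pP ->]; rewrite Omega_ideal //.
have iP := prime_ideal pP; have rA := adj_subring rR0 t.
have rR := RV_subring.
have pE := extend_ideal_prime rR0 tr pP; have iE := prime_ideal pE.
split.
- split.
  + split.
    * by move=> x [].
    * by split; [exact: (subring0 rR)|exact: ideal0 iE].
    * by move=> x y [Rx Ex] [Ry Ey]; split; [exact: (subringD rR)|exact: (idealD iE)].
    * move=> a x Ra [Rx Ex]; split; first exact: (subringM rR).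
      by apply: (idealMl iE) => //; apply: RV_adj.
  + by case=> _; apply: primeN1 pE.
  + move=> a b Ra Rb [_ Eab].
    by have [] := primeM pE (RV_adj Ra) (RV_adj Rb) Eab; [left|right].
- move=> v v0 [_]; have -> : (inv v) = ((elt w / elt v)%:P * 'X).[t].
    by rewrite hornerMX hornerC mulrAC divff ?mul1r // elt_eq0.
  have o1 : over (RSV0 V) ((elt w / elt v)%:P * 'X).
    apply: (overM rR0); last exact: (overXn rR0 1).
    by apply: (overC rR0); apply: RSV0_ratio.
  move=> /(mem_extend_ideal rR0 tr iP o1)/(_ 1%N); rewrite coefMX coefC /= => Pw.
  apply: (primeN1 pP); have -> : 1 = elt v / elt w * (elt w / elt v) :> K.
      have ev0 : elt v != 0 :> K by rewrite elt_eq0.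
  exact: (esym (ratio_mulV et0 ev0)).
  by apply: (idealMl iP) => //; apply: RSV0_ratio.
- move=> h gh [_ Eh] i; split; first exact: RVdeg_sub (gh i).
  pose g := \poly_(j < size h) (h`_j * elt w ^+ j).
  have og : over (RSV0 V) g.
    move=> j; rewrite coef_poly; case: ifP => _; last exact: (subring0 rR0).
    exact: RVdeg_shift.
  have Eg : h.[1] = g.[t].
    rewrite horner_poly horner_coef; apply: eq_bigr => j _.
    by rewrite (expfVK j _ et0) expr1n mulr1.
  rewrite Eg in Eh; have Pg := mem_extend_ideal rR0 tr iP og Eh.
  have [lti|gei] := ltnP i (size h); last first.
    by rewrite nth_default //; apply: ideal0 iE.
  exists ((g`_i)%:P * 'X^i).
    move=> j; rewrite coefCM coefXn; case: eqP => _; rewrite ?mulr1 ?mulr0 //.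
    exact: ideal0 iP.
  rewrite hornerM hornerC hornerXn coef_poly lti.
  exact: (esym (expfVK i _ et0)).
Qed.

(** The prime of [RSV0] is the set of fractions of degree [0] with numerator in
    [q] and denominator outside [q]. *)
Lemma mem_Omega q : prime_of (RV V) q -> homogeneous q ->
  (forall v, v != 0 -> ~ q (inv v)) -> OmegaV V q.
Proof.
move=> pq hq qv; have iq := prime_ideal pq; have rR := RV_subring.
have rS := RSV_subring.
pose Q : set K := [set x | exists b, [/\ RV V b, ~ q b & q (b * x)]].
have den x : RSV V x -> exists b, [/\ RV V b, ~ q b & RV V (b * x)].
  apply: (smallest_sub (X := [set x | exists b, [/\ RV V b, ~ q b & RV V (b * x)]])).
    split.
    - move=> c; exists 1; rewrite mul1r; split; [exact: (subring1 rR)|exact: primeN1 pq|].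
      exact: RV_scal.
    - move=> y z [b [Rb qb Rby]] [c [Rc qc Rcz]]; exists (b * c); split.
      + exact: (subringM rR).
      + exact: primeNM pq _ _ _ _.
      + have -> : b * c * (y + z) = c * (b * y) + b * (c * z).
          by rewrite mulrDr [b * c]mulrC -!mulrA; congr (_ + _); rewrite mulrCA.
        by apply: (subringD rR) => //; apply: (subringM rR).
    - move=> y z [b [Rb qb Rby]] [c [Rc qc Rcz]]; exists (b * c); split.
      + exact: (subringM rR).
      + exact: primeNM pq _ _ _ _.
      + by rewrite mulrACA; apply: (subringM rR).
  move=> _ [[v v0 <-]|[v v0 <-]].
    exists 1; rewrite mul1r; split; [exact: (subring1 rR)|exact: primeN1 pq|exact: RV_inv].
  exists (inv v); rewrite mulVf ?elt_eq0 //; split; [exact: RV_inv|exact: qv|].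
  exact: (subring1 rR).
have QD x y : Q x -> Q y -> Q (x + y).
  move=> [b [Rb qb Hb]] [c [Rc qc Hc]]; exists (b * c); split.
  - exact: (subringM rR).
  - exact: primeNM pq _ _ _ _.
  - have -> : b * c * (x + y) = c * (b * x) + b * (c * y).
      by rewrite mulrDr [b * c]mulrC -!mulrA; congr (_ + _); rewrite mulrCA.
    by apply: (idealD iq); apply: (idealMl iq).
have Q0 : Q 0.
  exists 1; rewrite mulr0; split; [exact: (subring1 rR)|exact: primeN1 pq|].
  exact: ideal0 iq.
have QM a x : RSV V a -> Q x -> Q (a * x).
  move=> /den[c [Rc qc Rca]] [b [Rb qb Hb]]; exists (c * b); split.
  - exact: (subringM rR).
  - exact: primeNM pq _ _ _ _.
  - by rewrite mulrACA; apply: (idealMl iq).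
have iQ : ideal_of (RSV V) (RSV V `&` Q).
  split.
  - by move=> x [].
  - by split=> //; apply: (subring0 rS).
  - by move=> x y [Rx Qx] [Ry Qy]; split; [exact: (subringD rS)|exact: QD].
  - by move=> a x Ra [Rx Qx]; split; [exact: (subringM rS)|exact: QM].
exists (RSV0 V `&` Q).
  split.
  - split.
    + by move=> x [].
    + by split=> //; apply: (subring0 rR0).
    + by move=> x y [Rx Qx] [Ry Qy]; split; [exact: (subringD rR0)|exact: QD].
    + by move=> a x Ra [Rx Qx]; split; [exact: (subringM rR0)|apply: QM => //; exact: RSV0_RSV].
  - by move=> [_ [b [_ qb]]]; rewrite mulr1.
  - move=> x y Rx Ry [_ [b [Rb qb Hb]]].
    have [c [Rc qc Rcx]] := den x (RSV0_RSV Rx).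
    have [d [Rd qd Rdy]] := den y (RSV0_RSV Ry).
    have H : q (b * ((c * x) * (d * y))).
      have -> : b * ((c * x) * (d * y)) = (c * d) * (b * (x * y)).
        exact: mul_swap.
      by apply: (idealMl iq) => //; apply: (subringM rR).
    have [//|] := primeM pq Rb (subringM rR Rcx Rdy) H.
    by move=> /(primeM pq Rcx Rdy)[Hx|Hy]; [left; split=> //; exists c|
      right; split=> //; exists d].
apply/seteqP; split=> x; last first.
  move=> [Rx Ix]; have [_ [b [Rb qb Hb]]] : (RSV V `&` Q) x.
    apply: (smallest_sub iQ _ Ix) => y [Ry Qy]; split=> //; exact: RSV0_RSV.
  by have [] := primeM pq Rb Rx Hb.
move=> qx; split; first exact: idealS qx.
have [h [gh qh ->]] := (homogeneousP iq).1 hq x qx.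
have PR : RSV0 V `&` Q `<=` RSV V by move=> y [Ry _]; apply: RSV0_RSV.
have iG := ideal_gen_ideal rS PR.
rewrite horner_coef.
apply: (@ideal_sum _ _ _ iG _ (fun i => h`_i * 1 ^+ i)) => i.
rewrite expr1n mulr1 -(expfVK i h`_i et0); apply: (idealMr iG).
  by apply: (subringX rS); apply: RV_RSV; apply: RV_inv.
apply: sub_gen_smallest; split; first exact: RVdeg_shift (gh i).
exists (t ^+ i); split.
- by apply: (subringX rR); apply: RV_inv.
- by move=> /(primeX rR pq (RV_inv w0)); apply: qv.
- by rewrite mulrC (expfVK i h`_i et0).
Qed.

End DegreeOne.
End GradedRing.

(** * Restriction to a subspace *)
Section Expansion.
Variables (S : idomainType) (K L : fieldType).
Variables (iota : {rmorphism S -> K}) (sigma : {rmorphism S -> {poly L}}).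
Hypothesis iota_eq0 : forall a, (iota a == 0) = (a == 0).

(** The fraction [x] has an image in [L('X)] under [sigma], whose expansion at
    infinity begins with [y0 + y1 / 'X], where [Y = y0 * 'X + y1]. *)
Definition expansion (x : K) (Y : {poly L}) := exists a b,
  [/\ sigma b != 0, x = iota a / iota b
    & (size ('X * sigma a - Y * sigma b)%R < size (sigma b))%N].

Let iota_neq0 b : sigma b != 0 -> iota b != 0.
Proof. by rewrite iota_eq0; apply: contraNneq => ->; rewrite rmorph0. Qed.

Let size_mul_lt (p q r : {poly L}) :
  (size p < size q)%N -> r != 0 -> (size (p * r)%R < size (q * r)%R)%N.
Proof.
move=> lt r0; have q0 : q != 0 by rewrite -size_poly_gt0 (leq_ltn_trans _ lt).
have [->|p0] := eqVneq p 0; first by rewrite mul0r size_poly0 size_poly_gt0 mulf_neq0.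
have : (0 < size r)%N by rewrite size_poly_gt0.
by rewrite !size_mul //; move: (size p) (size q) (size r) lt => i j k; lia.
Qed.

Let size_add_lt (p q : {poly L}) n :
  (size p < n)%N -> (size q < n)%N -> (size (p + q)%R < n)%N.
Proof. by move=> lp lq; rewrite (leq_ltn_trans (size_polyD _ _)) // gtn_max lp. Qed.

(** Multiply the difference of the two estimates by the denominators: a nonzero
    [Y - Z] would have too large a degree. *)
Lemma expansion_unique x Y Z : expansion x Y -> expansion x Z -> Y = Z.
Proof.
move=> [a [b [b0 -> H]]] [a' [b' [b'0 E H']]].
have Eab : sigma a * sigma b' = sigma a' * sigma b.
  rewrite -!rmorphM; congr (sigma _); apply/eqP; rewrite -subr_eq0 -iota_eq0.
  rewrite rmorphB !rmorphM subr_eq0; apply/eqP.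
  by move/eqP: E; rewrite eqr_div ?iota_neq0 // => /eqP.
apply/eqP; rewrite -subr_eq0; apply/eqP; apply: contrapT => /eqP YZ.
have lt1 := size_mul_lt H b'0; have := size_mul_lt H' b0.
rewrite [sigma b' * _]mulrC => lt2; rewrite -size_polyN in lt1.
have := size_add_lt lt1 lt2.
have -> : - (('X * sigma a - Y * sigma b) * sigma b')
    + ('X * sigma a' - Z * sigma b') * sigma b = (Y - Z) * (sigma b * sigma b').
  transitivity ((Y - Z) * (sigma b * sigma b')
    + 'X * (sigma a' * sigma b - sigma a * sigma b')); first by ring.
  by rewrite Eab subrr mulr0 addr0.
have bb0 : sigma b * sigma b' != 0 by rewrite mulf_neq0.
rewrite (size_mul YZ bb0); have : (0 < size (Y - Z)%R)%N by rewrite size_poly_gt0.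
by move: (size (Y - Z)) (size (sigma b * _)) => i j; lia.
Qed.

Lemma expansionD x y Y Z :
  expansion x Y -> expansion y Z -> expansion (x + y) (Y + Z).
Proof.
move=> [a [b [b0 -> H]]] [a' [b' [b'0 -> H']]].
exists (a * b' + a' * b), (b * b'); split.
- by rewrite rmorphM mulf_neq0.
- by rewrite rmorphD !rmorphM; field; rewrite !iota_neq0.
have lt1 := size_mul_lt H b'0; have := size_mul_lt H' b0.
rewrite [sigma b' * _]mulrC => lt2; have := size_add_lt lt1 lt2.
rewrite rmorphD !rmorphM.
by congr (size (polyseq _) < _)%N; ring.
Qed.

Let size_linear_mul (c d : L) (p q : {poly L}) : (size p < size q)%N ->
  (size ((c%:P * 'X + d%:P) * p)%R <= size q)%N.
Proof.
move=> lt; apply: leq_trans (size_polyMleq _ _) _.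
have : (size (c%:P * 'X + d%:P)%R <= 2)%N.
  rewrite (leq_trans (size_polyD _ _)) // geq_max.
  rewrite (leq_trans (size_polyC_leq1 _)) // andbT mul_polyC.
  by rewrite (leq_trans (size_scale_leq _ _)) // size_polyX.
by move: (size _) (size p) (size q) lt => i j k; lia.
Qed.

Let expansionM_poly (A B A' B' : {poly L}) (x0 x1 y0 y1 : L) :
  B != 0 -> B' != 0 ->
  (size ('X * A - (x0%:P * 'X + x1%:P) * B)%R < size B)%N ->
  (size ('X * A' - (y0%:P * 'X + y1%:P) * B')%R < size B')%N ->
  (size ('X * (A * A') - ((x0 * y0)%:P * 'X + (x0 * y1 + x1 * y0)%:P) * (B * B'))%R
     < size (B * B')%R)%N.
Proof.
move=> b0 b'0.
pose E := 'X * A - (x0%:P * 'X + x1%:P) * B.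
pose E' := 'X * A' - (y0%:P * 'X + y1%:P) * B'.
pose E'' := 'X * (A * A')
  - ((x0 * y0)%:P * 'X + (x0 * y1 + x1 * y0)%:P) * (B * B').
rewrite -/E -/E' -/E'' => H H'.
have BB0 : B * B' != 0 by rewrite mulf_neq0.
have lt1 := size_mul_lt H b'0; have := size_mul_lt H' b0.
rewrite [B' * B]mulrC => lt2.
have lt3 : (size (E * E')%R < size (B * B')%R)%N.
  have [->|E0] := eqVneq E 0; first by rewrite mul0r size_poly0 size_poly_gt0.
  apply: ltn_trans lt1; rewrite [E * _]mulrC [E * _]mulrC.
  exact: size_mul_lt.
have [->|E''0] := eqVneq E'' 0; first by rewrite size_poly0 size_poly_gt0.
have E''X : 'X * E'' = (x1 * y1)%:P * (B * B')
    + ((x0%:P * 'X + x1%:P) * (E' * B)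
    + ((y0%:P * 'X + y1%:P) * (E * B') + E * E')).
  by rewrite /E'' /E /E' !polyCD !polyCM; ring.
rewrite -[X in (X <= _)%N](size_mulX E''0) mulrC E''X.
rewrite (leq_trans (size_polyD _ _)) // geq_max; apply/andP; split.
  by rewrite mul_polyC size_scale_leq.
rewrite (leq_trans (size_polyD _ _)) // geq_max; apply/andP; split.
  exact: size_linear_mul.
rewrite (leq_trans (size_polyD _ _)) // geq_max; apply/andP; split.
  exact: size_linear_mul.
exact: ltnW.
Qed.

Lemma expansionM x y (x0 x1 y0 y1 : L) :
  expansion x (x0%:P * 'X + x1%:P) -> expansion y (y0%:P * 'X + y1%:P) ->
  expansion (x * y) ((x0 * y0)%:P * 'X + (x0 * y1 + x1 * y0)%:P).
Proof.
move=> [a [b [b0 -> H]]] [a' [b' [b'0 -> H']]].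
exists (a * a'), (b * b'); split.
- by rewrite rmorphM mulf_neq0.
- by rewrite !rmorphM invfM mulrACA.
rewrite !(rmorphM sigma); exact: expansionM_poly.
Qed.

Lemma expansion_iota a y : sigma a = y%:P -> expansion (iota a) (y%:P * 'X).
Proof.
move=> Ea; exists a, 1; rewrite Ea !rmorph1 oner_neq0 divr1; split=> //.
by rewrite mulr1 mulrC subrr size_poly0 size_poly1.
Qed.

Lemma expansion_inv b Y : sigma b != 0 ->
  (size ('X - Y * sigma b)%R < size (sigma b))%N -> expansion (iota b)^-1 Y.
Proof. by move=> b0 H; exists 1, b; rewrite !rmorph1 mulr1 div1r. Qed.

Lemma expansionM_lead x y (x0 y0 : L) : expansion x (x0%:P * 'X) ->
  expansion y (y0%:P * 'X) -> expansion (x * y) ((x0 * y0)%:P * 'X).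
Proof.
rewrite -[x0%:P * _]addr0 -[y0%:P * _]addr0 -polyC0 => Ex Ey.
by have := expansionM Ex Ey; rewrite mulr0 mul0r addr0 polyC0 addr0.
Qed.

Lemma expansionD_lead x y (x0 y0 : L) : expansion x (x0%:P * 'X) ->
  expansion y (y0%:P * 'X) -> expansion (x + y) ((x0 + y0)%:P * 'X).
Proof. by move=> Ex Ey; rewrite polyCD mulrDl; apply: expansionD. Qed.

Lemma expansionD_linear x y (x0 x1 y0 y1 : L) :
  expansion x (x0%:P * 'X + x1%:P) -> expansion y (y0%:P * 'X + y1%:P) ->
  expansion (x + y) ((x0 + y0)%:P * 'X + (x1 + y1)%:P).
Proof.
by move=> Ex Ey; rewrite !polyCD mulrDl addrACA; apply: expansionD.
Qed.

Lemma expansion_inv_const b y : sigma b = y%:P -> y != 0 ->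
  expansion (iota b)^-1 ((y^-1)%:P * 'X).
Proof.
move=> Eb y0; apply: expansion_inv; rewrite Eb ?polyC_eq0 //.
have -> : (y^-1)%:P * 'X * y%:P = (y^-1 * y)%:P * 'X by rewrite polyCM; ring.
by rewrite mulVf // mul1r subrr size_poly0 size_polyC y0.
Qed.

Lemma expansion_inv_linear b y d : sigma b = y%:P + d%:P * 'X -> d != 0 ->
  expansion (iota b)^-1 (d^-1)%:P.
Proof.
move=> Eb d0; have sz : size (sigma b) = 2.
  rewrite Eb addrC mul_polyC size_polyDl size_scale // size_polyX //.
  exact: leq_ltn_trans (size_polyC_leq1 _) _.
apply: expansion_inv; first by rewrite -size_poly_eq0 sz.
have -> : 'X - (d^-1)%:P * sigma b = (- (d^-1 * y))%:P + (1 - d^-1 * d)%:P * 'X.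
  by rewrite Eb polyCN polyCB !polyCM polyC1; ring.
by rewrite sz mulVf // subrr polyC0 mul0r addr0 ltnS size_polyC_leq1.
Qed.

Lemma expansion_inv_large b : (2 < size (sigma b))%N -> expansion (iota b)^-1 0.
Proof.
move=> sz; apply: expansion_inv; first by rewrite -size_poly_gt0 (ltn_trans _ sz).
by rewrite mul0r subr0 size_polyX.
Qed.

Lemma expansion_linear_inj x (x0 x1 y0 y1 : L) :
  expansion x (x0%:P * 'X + x1%:P) -> expansion x (y0%:P * 'X + y1%:P) ->
  x0 = y0 /\ x1 = y1.
Proof.
move=> Ex Ey; have E := expansion_unique Ex Ey.
have := congr1 (fun p : {poly L} => p`_1) E; have := congr1 (fun p : {poly L} => p`_0) E.
by rewrite !coefD !coefMX !coefC /= !add0r !addr0.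
Qed.

End Expansion.

Section Restriction.
Context {F : finFieldType} {V : vectType F}.
Implicit Types (u v w : V) (c : F).

Lemma coord_poly_eq0 (K : fieldType) (n : nat) (x : 'I_n -> K) :
  \sum_(i < n) (x i)%:P * 'X^i = 0 :> {poly K} -> forall i, x i = 0.
Proof.
move=> s0 i; have := congr1 (fun p : {poly K} => p`_i) s0; rewrite coef0 coef_sum.
rewrite (bigD1 i) //= coefCM coefXn eqxx mulr1 big1 ?addr0 // => j ji.
by rewrite coefCM coefXn eq_sym (inj_eq val_inj) (negbTE ji) mulr0.
Qed.

Section Subspace.
Variable V' : {vspace V}.

Variables (L : fieldType) (s : {rmorphism F -> L}) (e : subvs_of V' -> L).
Hypothesis elin : forall c (u v : subvs_of V'), e (c *: u + v) = s c * e u + e v.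

(** Substitutions that send the vectors of [V'] to constants and the others to
    polynomials of positive degree, so that the reciprocals of the latter vanish
    at infinity.  For [l = 0] they give the restriction to [V']; if [l v0 = 1],
    the direction of [v0] is moreover the only one sent to degree [1], and the
    second term of the expansion at infinity detects it. *)
Lemma degeneration (l : V -> F) v0 :
  (forall c u w, l (c *: u + w) = c * l u + l w) ->
  (forall w, w \in V' -> l w = 0) ->
  exists sigma : {rmorphism symalg V -> {poly L}},
  [/\ forall c, sigma c%:MP = (s c)%:P,
      forall u : subvs_of V', sigma (lin (vsval u)) = (e u)%:P,
      forall w, w - l w *: v0 \in V' ->
        exists y : L, sigma (lin w) = y%:P + (s (l w))%:P * 'X
    & forall w, w - l w *: v0 \notin V' -> (2 < size (sigma (lin w)))%N].
Proof.
move=> llin lV'; pose r w := w - l w *: v0.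
have rlin c u w : r (c *: u + w) = c *: r u + r w.
  by rewrite /r llin scalerDl -scalerA scalerBr opprD addrACA.
pose pr w := w - projv V' w.
have prlin c u w : pr (c *: u + w) = c *: pr u + pr w.
  by rewrite /pr linearP scalerBr opprD addrACA.
have pr0 w : pr w = 0 -> w \in V' by move/subr0_eq ->; apply: memv_proj.
have prV' w : w \in V' -> pr w = 0 by move=> Ww; rewrite /pr projv_id // subrr.
pose N w : {poly L} :=
  \sum_(i < \dim {:V}) (s (coord (vbasis {:V}) i (pr (r w))))%:P * 'X^i.
have Nlin c u w : N (c *: u + w) = (s c)%:P * N u + N w.
  rewrite /N mulr_sumr -big_split; apply: eq_bigr => i _ /=.
  rewrite rlin prlin linearP rmorphD polyCD mulrDl; congr (_ + _).
  by rewrite rmorphM polyCM mulrA.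
have N0 w : r w \in V' -> N w = 0.
  move=> Wr; rewrite /N big1 // => i _.
  by rewrite (prV' _ Wr) linear0 rmorph0 polyC0 mul0r.
have N_neq0 w : r w \notin V' -> N w != 0.
  apply: contra => /eqP N0'; apply: pr0.
  rewrite (coord_vbasis (memvf (pr (r w)))) big1 // => i _.
  have /eqP := coord_poly_eq0 N0' i.
  by rewrite fmorph_eq0 => /eqP ->; rewrite scale0r.
pose C w : {poly L} := (e (vsproj V' (r w)))%:P.
have Clin c u w : C (c *: u + w) = (s c)%:P * C u + C w.
  by rewrite /C rlin linearP elin polyCD polyCM.
have [|sigma sC sL] := @symext F V _ (polyC \o s)
    (fun w => C w + (s (l w))%:P * 'X + N w * 'X^2).
  move=> c u w; rewrite Clin Nlin llin rmorphD rmorphM polyCD polyCM.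
  by rewrite /=; ring.
exists sigma; split.
- exact: sC.
- move=> u; have Wu := subvsP u.
  have ru : r (vsval u) = vsval u by rewrite /r (lV' _ Wu) scale0r subr0.
  by rewrite sL N0 ?ru // /C ru vsvalK (lV' _ Wu) rmorph0 polyC0 !mul0r !addr0.
- move=> w Ww; exists (e (vsproj V' (r w))).
  by rewrite sL N0 // mul0r addr0.
- move=> w /N_neq0 Nw; rewrite sL addrC.
  have szX : size (N w * 'X^2) = (size (N w)).+2 by rewrite size_mulXn.
  have Npos : (0 < size (N w))%N by rewrite size_poly_gt0.
  have sz2 : (size (C w + (s (l w))%:P * 'X)%R <= 2)%N.
    rewrite (leq_trans (size_polyD _ _)) // geq_max.
    rewrite (leq_trans (size_polyC_leq1 _)) //= mul_polyC.
    by rewrite (leq_trans (size_scale_leq _ _)) // size_polyX.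
  by rewrite size_polyDl szX // ltnS (leq_trans sz2).
Qed.

End Subspace.
Section Expansions.
Variable V' : {vspace V}.

Local Notation K := (KV V).
Local Notation K' := (KV (subvs_of V')).
Local Notation inv v := ((elt v)^-1 : K).

Lemma expansions (l : V -> F) v0 :
  (forall c u w, l (c *: u + w) = c * l u + l w) ->
  (forall w, w \in V' -> l w = 0) ->
  exists sigma : {rmorphism symalg V -> {poly K'}},
  let E := expansion (@FracField.tofrac (symalg V)) sigma in
  [/\ forall c, E (scal c) ((scal c)%:P * 'X),
      forall u : subvs_of V', u != 0 -> E (inv (vsval u)) (((elt u)^-1)%:P * 'X),
      forall w, w - l w *: v0 \in V' -> l w != 0 -> E (inv w) ((scal (l w))^-1)%:P
    & forall w, w - l w *: v0 \notin V' -> E (inv w) 0].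
Proof.
move=> llin lV'.
have [|sigma [sC sV' slin slarge]] := @degeneration V' K'
  (@FracField.tofrac (symalg (subvs_of V')) \o @mpolyC _ F) elt _ l v0 llin lV'.
  by move=> c u w; apply: elt_is_linear.
exists sigma; split.
- by move=> c; apply: expansion_iota; apply: sC.
- by move=> u u0; apply: expansion_inv_const; rewrite ?elt_eq0 ?sV'.
- move=> w /slin[y Ey] lw; apply: expansion_inv_linear; first exact: Ey.
  by rewrite scal_eq0.
- by move=> w /slarge; apply: expansion_inv_large.
Qed.

Lemma restriction_exists : exists phi, is_restriction V' phi.
Proof.
have iota0 (a : symalg V) : (tofrac a == 0 :> K) = (a == 0) by exact: tofrac_eq0.
have [||sigma [Es EV' _ EV]] := expansions (l := fun=> 0) 0.
- by move=> c u w; rewrite mulr0 addr0.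
- by [].
set E := expansion _ _ in Es EV' EV.
have ex x : RV V x -> exists y, E x (y%:P * 'X).
  move: x; apply: RV_ind.
  - by move=> c; exists (scal c); apply: Es.
  - move=> v v0; have [Vv|Vv] := boolP (v \in V').
      have Ev : vsval (vsproj V' v) = v by rewrite vsprojK.
      exists (elt (vsproj V' v))^-1; rewrite -{1}Ev; apply: EV'.
      by apply: contraNneq v0 => v0; rewrite -Ev v0 linear0.
    by exists 0; rewrite polyC0 mul0r; apply: EV; rewrite scale0r subr0.
  - by move=> x y _ _ [x0 Ex] [y0 Ey]; exists (x0 + y0); exact (expansionD_lead iota0 Ex Ey).
  - by move=> x y _ _ [x0 Ex] [y0 Ey]; exists (x0 * y0); exact (expansionM_lead Ex Ey).
have inj x (y z : K') : E x (y%:P * 'X) -> E x (z%:P * 'X) -> y = z.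
  rewrite -[y%:P * _]addr0 -[z%:P * _]addr0 -polyC0.
  by move=> Ey Ez; have [] := expansion_linear_inj iota0 Ey Ez.
have /choice[phi phiE] (x : K) : exists y : K', RV V x -> E x (y%:P * 'X).
  by have [/ex[y Ey]|nx] := pselect (RV V x); [exists y|exists 0].
exists phi; have rR := RV_subring (V := V); split.
- by move=> c; exact (inj _ _ _ (phiE _ (RV_scal c)) (Es c)).
- move=> x y Rx Ry; apply: (inj _ _ _ (phiE _ (subringD rR Rx Ry))).
  exact (expansionD_lead iota0 (phiE _ Rx) (phiE _ Ry)).
- move=> x y Rx Ry; apply: (inj _ _ _ (phiE _ (subringM rR Rx Ry))).
  exact (expansionM_lead (phiE _ Rx) (phiE _ Ry)).
- move=> u u0; have vu0 : vsval u != 0.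
    by apply: contraNneq u0 => vu0; rewrite -(vsvalK u) vu0 linear0.
  exact (inj _ _ _ (phiE _ (RV_inv vu0)) (EV' u u0)).
- move=> v Vv; have v0 : v != 0 by apply: contraNneq Vv => ->; apply: mem0v.
  apply: (inj _ _ _ (phiE _ (RV_inv v0))).
  by rewrite polyC0 mul0r; apply: EV; rewrite scale0r subr0.
Qed.

Lemma restriction_inv_ind phi (P : K' -> Prop) : is_restriction V' phi ->
  P 0 -> (forall u : subvs_of V', u != 0 -> P (elt u)^-1) ->
  forall v, v != 0 -> P (phi (inv v)).
Proof.
move=> [_ _ _ pV' pV] P0 Pu v v0; have [Vv|Vv] := boolP (v \in V'); last first.
  by rewrite pV.
have Ev : vsval (vsproj V' v) = v by rewrite vsprojK.
have u0 : vsproj V' v != 0 by apply: contraNneq v0 => u0; rewrite -Ev u0 linear0.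
by rewrite -Ev pV' //; apply: Pu.
Qed.

Lemma restriction_RV phi x :
  is_restriction V' phi -> RV V x -> RV (subvs_of V') (phi x).
Proof.
move=> res; have [ps pD pM _ _] := res.
have rR' := RV_subring (V := subvs_of V'); move: x; apply: RV_ind.
- by move=> c; rewrite ps; apply: RV_scal.
- apply: restriction_inv_ind res (subring0 rR') _ => u; exact: RV_inv.
- by move=> a b Ra Rb Pa Pb; rewrite pD //; apply: (subringD rR').
- by move=> a b Ra Rb Pa Pb; rewrite pM //; apply: (subringM rR').
Qed.

(** The second term of the expansion is a derivation of [R_V] over the
    restriction to [V'].  It separates the reciprocals [1/v] modulo the squares
    of the ideals that contain them. *)
Lemma restriction_derivation phi v : is_restriction V' phi -> v \notin V' ->
  exists delta : K -> K',
  [/\ forall x, RV V x -> RV (subvs_of V') (delta x),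
      forall x y, RV V x -> RV V y -> delta (x + y) = delta x + delta y,
      forall x y, RV V x -> RV V y ->
        delta (x * y) = phi x * delta y + delta x * phi y,
      delta (inv v) = 1
    & forall w, w \notin (V' + <[v]>)%VS -> delta (inv w) = 0].
Proof.
move=> [ps pD pM pV' pV] vV'.
have iota0 (a : symalg V) : (tofrac a == 0 :> K) = (a == 0) by exact: tofrac_eq0.
have [l [llin lV' lv]] := separating_functional vV'.
have [sigma [Es EV' Elin Elarge]] := expansions v llin lV'.
set E := expansion _ _ in Es EV' Elin Elarge.
have rR := RV_subring (V := V); have rR' := RV_subring (V := subvs_of V').
have v0 : v != 0 by apply: contraNneq vV' => ->; apply: mem0v.
have Einv w : w \notin V' -> w - l w *: v \in V' ->
    E (inv w) ((phi (inv w))%:P * 'X + ((scal (l w))^-1)%:P).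
  move=> wV' rw; rewrite pV // polyC0 mul0r add0r; apply: Elin => //.
  by apply: contraNneq wV' => lw; move: rw; rewrite lw scale0r subr0.
have Einv0 w : w \notin V' -> w - l w *: v \notin V' ->
    E (inv w) ((phi (inv w))%:P * 'X + 0%:P).
  by move=> wV' rw; rewrite pV // polyC0 mul0r add0r; apply: Elarge.
have ex x : RV V x -> exists y, RV (subvs_of V') y /\
    E x ((phi x)%:P * 'X + y%:P).
  move: x; apply: RV_ind.
  - move=> c; exists 0; split; first exact: (subring0 rR').
    by rewrite ps polyC0 addr0; apply: Es.
  - move=> w w0; have [Vw|Vw] := boolP (w \in V').
      have Ew : vsval (vsproj V' w) = w by rewrite vsprojK.
      have u0 : vsproj V' w != 0.
        by apply: contraNneq w0 => u0; rewrite -Ew u0 linear0.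
      exists 0; split; first exact: (subring0 rR').
      by rewrite -Ew pV' // polyC0 addr0; apply: EV'.
    have [rw|rw] := boolP (w - l w *: v \in V').
      exists (scal (l w))^-1; split; last exact: Einv.
      by rewrite -scalV; apply: RV_scal.
    by exists 0; split; [exact: (subring0 rR')|exact: Einv0].
  - move=> x y Rx Ry [x1 [Rx1 Ex]] [y1 [Ry1 Ey]]; exists (x1 + y1).
    split; first exact: (subringD rR').
    by rewrite (pD _ _ Rx Ry); exact (expansionD_linear iota0 Ex Ey).
  - move=> x y Rx Ry [x1 [Rx1 Ex]] [y1 [Ry1 Ey]].
    exists (phi x * y1 + x1 * phi y); split; last first.
      by rewrite (pM _ _ Rx Ry); exact (expansionM Ex Ey).
    have pR := restriction_RV (And5 ps pD pM pV' pV).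
    by apply: (subringD rR'); apply: (subringM rR') => //; apply: pR.
have inj x (y z : K') : E x ((phi x)%:P * 'X + y%:P) ->
    E x ((phi x)%:P * 'X + z%:P) -> y = z.
  by move=> Ey Ez; have [] := expansion_linear_inj iota0 Ey Ez.
have /choice[delta deltaE] (x : K) : exists y : K', RV V x ->
    RV (subvs_of V') y /\ E x ((phi x)%:P * 'X + y%:P).
  by have [/ex[y Ey]|nx] := pselect (RV V x); [exists y|exists 0].
have dE x (Rx : RV V x) := (deltaE x Rx).2.
exists delta; split.
- by move=> x /deltaE[].
- move=> x y Rx Ry; apply: (inj _ _ _ (dE _ (subringD rR Rx Ry))).
  by rewrite (pD _ _ Rx Ry); exact (expansionD_linear iota0 (dE _ Rx) (dE _ Ry)).
- move=> x y Rx Ry; apply: (inj _ _ _ (dE _ (subringM rR Rx Ry))).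
  by rewrite (pM _ _ Rx Ry); exact (expansionM (dE _ Rx) (dE _ Ry)).
- apply: (inj _ _ _ (dE _ (RV_inv v0))); have := @Einv v vV'.
  by rewrite lv scale1r subrr scal1 invr1; apply; apply: mem0v.
- move=> w wV'; have wV : w \notin V'.
    by apply: contra wV'; apply: subvP; apply: addvSl.
  have w0 : w != 0 by apply: contraNneq wV => ->; apply: mem0v.
  apply: (inj _ _ _ (dE _ (RV_inv w0))); apply: Einv0 => //.
  apply: contra wV' => rw; rewrite -(subrK (l w *: v) w).
  by apply: memv_add => //; apply: memvZ; apply: memv_line.
Qed.

End Expansions.
End Restriction.

(** * Strata *)

(** The correspondence between the fractions of [S'] in two fields. *)
Section CommonFractions.
Variables (S' : comNzRingType) (K K' : fieldType).
Variables (kappa : {rmorphism S' -> K}) (iota' : {rmorphism S' -> K'}).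
Hypothesis iota'_eq0 : forall a, (iota' a == 0) = (a == 0).

Definition same_fraction (y : K) (z : K') := exists a b,
  [/\ iota' b != 0, kappa b != 0, y = kappa a / kappa b & z = iota' a / iota' b].

Lemma same_fractionD y z y' z' : same_fraction y z -> same_fraction y' z' ->
  same_fraction (y + y') (z + z').
Proof.
move=> [a [b [b0 b1 -> ->]]] [a' [b' [b'0 b'1 -> ->]]].
exists (a * b' + a' * b), (b * b'); rewrite !rmorphM !mulf_neq0 //.
rewrite !rmorphD !rmorphM; split=> //; field; first by rewrite b1 b'1.
by rewrite b0 b'0.
Qed.

Lemma same_fractionM y z y' z' : same_fraction y z -> same_fraction y' z' ->
  same_fraction (y * y') (z * z').
Proof.
move=> [a [b [b0 b1 -> ->]]] [a' [b' [b'0 b'1 -> ->]]].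
exists (a * a'), (b * b'); rewrite !rmorphM !mulf_neq0 //.
by split=> //; rewrite invfM mulrACA.
Qed.

Lemma same_fraction0 y : same_fraction y 0 -> y = 0.
Proof.
move=> [a [b [b0 b1 -> /esym/eqP]]].
rewrite mulf_eq0 invr_eq0 (negbTE b0) orbF iota'_eq0 => /eqP ->.
by rewrite rmorph0 mul0r.
Qed.

Lemma same_fraction_of a : same_fraction (kappa a) (iota' a).
Proof. by exists a, 1; rewrite !rmorph1 !oner_neq0 !divr1. Qed.

Lemma same_fraction_inv b : iota' b != 0 -> kappa b != 0 ->
  same_fraction (kappa b)^-1 (iota' b)^-1.
Proof. by move=> b0 b1; exists 1, b; rewrite !rmorph1 !div1r. Qed.

End CommonFractions.

Lemma mul_diff (K : fieldType) (x x' y y' : K) :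
  x * x' - y * y' = x * (x' - y') + y' * (x - y).
Proof. by ring. Qed.

Section Strata.
Context {F : finFieldType} {V : vectType F}.
Implicit Types (u v w : V) (c : F) (W : {vspace V}).

Local Notation K := (KV V).
Local Notation inv v := ((elt v)^-1 : K).

Let rR := RV_subring (V := V).

Section Restricted.
Variables (V' : {vspace V}) (phi : K -> KV (subvs_of V')).
Hypothesis res : is_restriction V' phi.

Local Notation K' := (KV (subvs_of V')).

Let rR' := RV_subring (V := subvs_of V').

Let ps : forall c, phi (scal c) = scal c. Proof. by case: res. Qed.
Let pD : forall x y, RV V x -> RV V y -> phi (x + y) = phi x + phi y.
Proof. by case: res. Qed.
Let pM : forall x y, RV V x -> RV V y -> phi (x * y) = phi x * phi y.
Proof. by case: res. Qed.
Let pV' : forall u : subvs_of V', u != 0 -> phi (inv (vsval u)) = (elt u)^-1.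
Proof. by case: res. Qed.
Let pV : forall v, v \notin V' -> phi (inv v) = 0. Proof. by case: res. Qed.

Let vsval_neq0 (u : subvs_of V') : u != 0 -> vsval u != 0.
Proof. by apply: contraNneq => vu0; rewrite -(vsvalK u) vu0 linear0. Qed.

Lemma restriction0 : phi 0 = 0.
Proof. by rewrite -(scal0 (V := V)) ps scal0. Qed.

Lemma restriction1 : phi 1 = 1.
Proof. by rewrite -(scal1 (V := V)) ps scal1. Qed.

Lemma restrictionN x : RV V x -> phi (- x) = - phi x.
Proof.
move=> Rx; rewrite -mulN1r -scal1 -scalN (pM (RV_scal _) Rx) ps scalN scal1.
exact: mulN1r.
Qed.

Lemma restrictionB x y : RV V x -> RV V y -> phi (x - y) = phi x - phi y.
Proof.
by move=> Rx Ry; rewrite (pD Rx (subringN rR Ry)) (restrictionN Ry).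
Qed.

Lemma restriction_deg n x : RVdeg V n x -> RVdeg (subvs_of V') n (phi x).
Proof.
move: n x; apply: RVdeg_ind.
- by move=> c; rewrite ps; apply: RVdeg_scal.
- apply: (restriction_inv_ind res); [exact: RVdeg0|exact: RVdeg_inv].
- by move=> n; rewrite restriction0; apply: RVdeg0.
- move=> n x y Rx Ry Px Py; rewrite (pD (RVdeg_sub Rx) (RVdeg_sub Ry)).
  exact: RVdegD.
- move=> m n x y Rx Ry Px Py; rewrite (pM (RVdeg_sub Rx) (RVdeg_sub Ry)).
  exact: RVdegM.
Qed.

Lemma restriction_surjective y : RV (subvs_of V') y ->
  exists2 x, RV V x & phi x = y.
Proof.
move: y; apply: RV_ind.
- by move=> c; exists (scal c); [exact: RV_scal|exact: ps].
- move=> u u0; exists (inv (vsval u)); last exact: pV'.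
  by apply: RV_inv; apply: vsval_neq0.
- move=> _ _ _ _ [x Rx <-] [y Ry <-]; exists (x + y); last exact: pD.
  exact: (subringD rR).
- move=> _ _ _ _ [x Rx <-] [y Ry <-]; exists (x * y); last exact: pM.
  exact: (subringM rR).
Qed.

(** The restriction to [V'] is injective on the subalgebra generated by the
    reciprocals of vectors of [V'], and [R_V] is the sum of that subalgebra and
    of the ideal generated by the other reciprocals. *)
Lemma restriction_kernel p : ideal_of (RV V) p ->
  (forall v, v \notin V' -> p (inv v)) ->
  forall x, RV V x -> phi x = 0 -> p x.
Proof.
move=> ip pv.
have [|j jC jL] := @symext F (subvs_of V') _ (@mpolyC (\dim {:V}) F)
    (fun x : subvs_of V' => lin (vsval x)).
  by move=> c u v; rewrite linearP lin_is_linear.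
have iota0 (a : symalg (subvs_of V')) : (tofrac a == 0 :> K') = (a == 0).
  exact: tofrac_eq0.
pose kappa : {rmorphism symalg (subvs_of V') -> K} :=
  @FracField.tofrac (symalg V) \o j.
pose C := same_fraction kappa (@FracField.tofrac (symalg (subvs_of V'))).
have ex x : RV V x -> exists y, [/\ C y (phi x), RV V y & p (x - y)].
  move: x; apply: RV_ind.
  - move=> c; exists (scal c); rewrite subrr ps; split; last exact: ideal0 ip.
      have -> : scal c = kappa c%:MP by rewrite /kappa /= jC.
      exact: same_fraction_of.
    exact: RV_scal.
  - move=> v v0; have [Vv|Vv] := boolP (v \in V'); last first.
      exists 0; rewrite (pV Vv) subr0; split; last exact: pv.
        by have := same_fraction_of kappa (@FracField.tofrac _) 0; rewrite !rmorph0.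
      exact: (subring0 rR).
    have Ev : vsval (vsproj V' v) = v by rewrite vsprojK.
    have u0 : vsproj V' v != 0.
      by apply: contraNneq v0 => u0; rewrite -Ev u0 linear0.
    exists (inv v); rewrite subrr; split; [|exact: RV_inv|exact: ideal0 ip].
    rewrite -{2}Ev pV' //.
    have Ek : elt v = kappa (lin (vsproj V' v)) by rewrite /kappa /= jL Ev.
    rewrite Ek; apply: same_fraction_inv; first by rewrite iota0 lin_eq0.
    by rewrite -Ek elt_eq0.
  - move=> x x' Rx Rx' [y [Cy Ry py]] [y' [Cy' Ry' py']]; exists (y + y').
    rewrite (pD Rx Rx'); split.
    + exact: same_fractionD.
    + exact: (subringD rR).
    + by rewrite opprD addrACA; apply: (idealD ip).
  - move=> x x' Rx Rx' [y [Cy Ry py]] [y' [Cy' Ry' py']]; exists (y * y').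
    rewrite (pM Rx Rx'); split.
    + exact: same_fractionM.
    + exact: (subringM rR).
    + have -> : x * x' - y * y' = x * (x' - y') + y' * (x - y).
        exact: mul_diff.
      by apply: (idealD ip); apply: (idealMl ip).
move=> x Rx px0; have [y [Cy Ry py]] := ex x Rx.
by move: Cy py; rewrite px0 => /(same_fraction0 iota0) ->; rewrite subr0.
Qed.

Lemma restriction_graded h : graded_poly h -> exists h' : {poly K'},
  [/\ graded_poly h', phi h.[1] = h'.[1] & forall i, h'`_i = phi h`_i].
Proof.
move=> gh; exists (\poly_(i < size h) phi h`_i).
have coefE i : (\poly_(i < size h) phi h`_i)`_i = phi h`_i.
  rewrite coef_poly; case: ltnP => // le; rewrite nth_default //.
  by rewrite restriction0.
split=> //; first by move=> i; rewrite coefE; apply: restriction_deg.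
rewrite horner_poly horner_coef.
elim: (size h) => [|n IH]; first by rewrite !big_ord0 restriction0.
rewrite !big_ord_recr /= -IH !expr1n !mulr1 pD //; last exact: RVdeg_sub (gh n).
apply: (@subring_sum _ _ rR _ (fun i => h`_i * 1 ^+ i)) => i.
by rewrite expr1n mulr1; apply: RVdeg_sub (gh i).
Qed.

End Restricted.

(** A subspace of largest dimension among those contained in [G]. *)
Lemma subspace_of (G : V -> Prop) : G 0 ->
  (forall c u v, G u -> G v -> G (c *: u + v)) ->
  exists W, forall v, v \in W <-> G v.
Proof.
move=> G0 Glin.
pose dims n := `[< exists W, (forall v, v \in W -> G v) /\ \dim W = n >].
have ex_dim : exists n, dims n.
  exists 0%N; apply/asboolP; exists 0%VS; rewrite dimv0; split=> // v.
  by rewrite memv0 => /eqP ->.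
have max_dim n : dims n -> (n <= \dim {:V})%N.
  by move=> /asboolP[W [_ <-]]; apply/dimvS/subvf.
case: (ex_maxnP ex_dim max_dim) => n /asboolP[W [WG dW]] maxW.
exists W => v; split; first exact: WG.
move=> Gv; apply: contrapT => /negP Wv.
have : dims (\dim (W + <[v]>)%VS).
  apply/asboolP; exists (W + <[v]>)%VS; split=> // _ /memv_addP[w Ww [_ /vlineP[c ->] ->]].
  by rewrite addrC; apply: Glin => //; apply: WG.
move=> /maxW; rewrite -dW => le.
have : (W == W + <[v]>)%VS by rewrite eqEdim addvSl.
move=> /eqP EW; case/negP: Wv; rewrite EW.
by apply: (subvP (addvSr _ _)); apply: memv_line.
Qed.

(** The vectors whose reciprocals are not in [p] are closed under sums by
    [elt_invD] and the primality of [p]; if there were none, [p] would contain all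
    the elements of positive degree. *)
Lemma support p : QV V p -> exists V' : {vspace V},
  V' != 0%VS /\ forall v, v != 0 -> (p (inv v) <-> v \notin V').
Proof.
move=> [pp hp [n [x [n0 Rx px]]]]; have ip := prime_ideal pp.
have [||V' HV'] := @subspace_of (fun v => v = 0 \/ ~ p (inv v)); first by left.
  move=> c u v Gu Gv.
  have [->|c0] := eqVneq c 0; first by rewrite scale0r add0r.
  have [->|u0] := eqVneq u 0; first by rewrite scaler0 add0r.
  have cu0 : c *: u != 0 by rewrite scaler_eq0 negb_or c0 u0.
  have pcu : ~ p (inv (c *: u)).
    case: Gu => [E|pu]; first by rewrite E eqxx in u0.
    move=> pcu; apply: pu.
    have -> : inv u = scal c * inv (c *: u).
      by rewrite eltZ invfM mulVKf // scal_eq0.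
    by apply: (idealMl ip) => //; apply: RV_scal.
  have [->|v0] := eqVneq v 0; first by rewrite addr0; right.
  have [->|uv0] := eqVneq (c *: u + v) 0; first by left.
  have pv : ~ p (inv v) by case: Gv => [E|//]; rewrite E eqxx in v0.
  right=> puv; apply: (primeNM pp (RV_inv cu0) (RV_inv v0) pcu pv).
  rewrite elt_invD //; apply: (idealMr ip) => //.
  by apply: (subringD rR); apply: RV_inv.
exists V'; split.
  apply/eqP => V'0; apply: px.
  have pinv v : v != 0 -> p (inv v).
    move=> v0; apply: contrapT => pv; have : v \in V' by apply/HV'; right.
    by rewrite V'0 memv0 (negbTE v0).
  suff : (0 < n)%N -> p x by apply.
  move: n x Rx {n0}; apply: RVdeg_ind => //.
  - by move=> v /pinv.
  - by move=> n _; apply: ideal0 ip.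
  - by move=> n x y _ _ Px Py n0; apply: (idealD ip); [exact: Px|exact: Py].
  - move=> m n x y Rx Ry Px Py; rewrite addn_gt0 => /orP[m0|n0].
      by apply: (idealMr ip); [exact: RVdeg_sub Ry|exact: Px].
    by apply: (idealMl ip); [exact: RVdeg_sub Rx|exact: Py].
move=> v v0; split=> [pv|V'v].
  by apply/negP => /HV'[E|//]; rewrite E eqxx in v0.
by apply: contrapT => pv; case/negP: V'v; apply/HV'; right.
Qed.

Lemma nonzero_subvs (V' : {vspace V}) : V' != 0%VS ->
  exists u : subvs_of V', u != 0.
Proof.
move=> V'0; exists (vsproj V' (vpick V')); rewrite -vpick0 in V'0.
apply: contraNneq V'0 => E.
by rewrite -(vsprojK (memv_pick V')) E linear0.
Qed.

Lemma stratum_properties (V' : {vspace V}) p : V' != 0%VS -> stratum V' p ->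
  [/\ QV V p, forall v, v != 0 -> (p (inv v) <-> v \notin V')
    & exists phi q, [/\ is_restriction V' phi, prime_of (RV (subvs_of V')) q
      & forall x, p x <-> RV V x /\ q (phi x)]].
Proof.
move=> V'0 [phi res [q Oq Ep]]; have [u u0] := nonzero_subvs V'0.
have [pq qv qgr] := Omega_properties u0 Oq; have iq := prime_ideal pq.
have [ps pD pM pV' pV] := res.
have pE x : p x <-> RV V x /\ q (phi x) by rewrite Ep.
have ip : ideal_of (RV V) p.
  split.
  - by move=> x /pE[].
  - apply/pE; split; first exact: (subring0 rR).
    by rewrite (restriction0 res); apply: ideal0 iq.
  - move=> x y /pE[Rx qx] /pE[Ry qy]; apply/pE.
    by split; [exact: (subringD rR)|rewrite pD //; apply: (idealD iq)].
  - move=> a x Ra /pE[Rx qx]; apply/pE; split; first exact: (subringM rR).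
    by rewrite pM //; apply: (idealMl iq) => //; apply: restriction_RV.
have pp : prime_of (RV V) p.
  split=> // [/pE[_]|a b Ra Rb /pE[_]].
    by rewrite (restriction1 res); apply: primeN1 pq.
  rewrite pM // => /(primeM pq (restriction_RV res Ra) (restriction_RV res Rb)).
  by move=> [qa|qb]; [left|right]; apply/pE.
have pinv v : v != 0 -> (p (inv v) <-> v \notin V').
  move=> v0; split=> [/pE[_ qv']|Vv].
    apply/negP => Vv; have Ev : vsval (vsproj V' v) = v by rewrite vsprojK.
    have w0 : vsproj V' v != 0.
      by apply: contraNneq v0 => w0; rewrite -Ev w0 linear0.
    by apply: (qv _ w0); rewrite -pV' // Ev.
  apply/pE; split; first exact: RV_inv.
  by rewrite pV //; apply: ideal0 iq.
split=> //; last by exists phi, q.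
have vu0 : vsval u != 0.
  by apply: contraNneq u0 => vu0; rewrite -(vsvalK u) vu0 linear0.
split=> //; last first.
  exists 1%N, (inv (vsval u)); split=> //; first exact: RVdeg_inv.
  by move/(pinv _ vu0); rewrite subvsP.
apply/(homogeneousP ip) => x /pE[Rx qx].
have [h gh Ex] := RV_decomposition Rx; exists h; split=> // i.
have [h' [gh' Eh' coefE]] := restriction_graded res gh.
apply/pE; split; first exact: RVdeg_sub (gh i).
by rewrite -coefE; apply: qgr => //; rewrite -Eh' -Ex.
Qed.

(** The image of [p] in [R_V'] is a prime with preimage [p], because [p] contains
    the kernel of the restriction. *)
Lemma mem_stratum (V' : {vspace V}) p : V' != 0%VS -> QV V p ->
  (forall v, v != 0 -> (p (inv v) <-> v \notin V')) -> stratum V' p.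
Proof.
move=> V'0 [pp hp _] pinv; have ip := prime_ideal pp.
have [u u0] := nonzero_subvs V'0.
have [phi res] := restriction_exists V'; have [ps pD pM pV' pV] := res.
have pv v : v \notin V' -> p (inv v).
  by move=> Vv; apply/pinv => //; apply: contraNneq Vv => ->; apply: mem0v.
have ker x y : RV V x -> p y -> phi x = phi y -> p x.
  move=> Rx py E; have Ry := idealS ip py; rewrite -(subrK y x).
  apply: (idealD ip) => //; apply: (restriction_kernel res ip pv).
    exact: (subringB rR).
  by rewrite (restrictionB res) // E subrr.
pose q : set (KV (subvs_of V')) := [set y | exists2 x, p x & y = phi x].
have rR' := RV_subring (V := subvs_of V').
have iq : ideal_of (RV (subvs_of V')) q.
  split.
  - by move=> _ [x /(idealS ip) Rx ->]; apply: restriction_RV.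
  - by exists 0; [exact: ideal0 ip|rewrite (restriction0 res)].
  - move=> _ _ [x px ->] [y py ->]; exists (x + y); first exact: (idealD ip).
    by rewrite pD //; apply: (idealS ip).
  - move=> a _ Ra [x px ->]; have [b Rb <-] := restriction_surjective res Ra.
    exists (b * x); first exact: (idealMl ip).
    by rewrite pM //; apply: (idealS ip).
have pq : prime_of (RV (subvs_of V')) q.
  split=> // [[x px E]|a b Ra Rb [x px E]].
    apply: (primeN1 pp); apply: (ker 1 x) => //; first exact: (subring1 rR).
    by rewrite (restriction1 res).
  have [a' Ra' Ea] := restriction_surjective res Ra.
  have [b' Rb' Eb] := restriction_surjective res Rb.
  have : p (a' * b').
    apply: (ker _ x) => //; first exact: (subringM rR).
    by rewrite pM // Ea Eb.
  by move=> /(primeM pp Ra' Rb')[pa|pb]; [left; exists a'|right; exists b'].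
exists phi => //; exists q; last first.
  apply/seteqP; split=> [x px|x [Rx [y py E]]]; last exact: ker py E.
  by split; [exact: idealS px|exists x].
apply: (mem_Omega u0) => //.
  apply/(homogeneousP iq) => _ [x px ->].
  have [h [gh ph Ex]] := (homogeneousP ip).1 hp x px.
  have [h' [gh' Eh' coefE]] := restriction_graded res gh.
  exists h'; split=> // [i|]; last by rewrite Ex.
  by exists h`_i; [exact: ph|exact: coefE].
move=> w w0 [x px E].
have vw0 : vsval w != 0.
  by apply: contraNneq w0 => vw0; rewrite -(vsvalK w) vw0 linear0.
have /(pinv _ vw0) : p (inv (vsval w)); last by rewrite subvsP.
by apply: (ker _ x) => //; [exact: RV_inv|rewrite pV'].
Qed.

End Strata.

(** * The local rings of [Q_V] *)
Section HomogeneousLocalization.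
Variables (K : fieldType) (R : set K) (D : nat -> set K) (p : set K).
Hypotheses (rR : subring R) (pp : prime_of R p).
Hypotheses (DR : forall n, D n `<=` R) (D1 : D 0%N 1).
Hypothesis DB : forall n x y, D n x -> D n y -> D n (x - y).
Hypothesis DM : forall m n x y, D m x -> D n y -> D (m + n)%N (x * y).

Definition hloc : set K :=
  [set x | exists n a b, [/\ D n a, D n b, ~ p b & x = a / b]].

Definition hmax : set K :=
  [set x | exists n a b, [/\ D n a, D n b, ~ p b, p a & x = a / b]].

Let ip : ideal_of R p := prime_ideal pp.

Lemma hloc_den_neq0 b : ~ p b -> b != 0.
Proof. by move=> pb; apply/eqP => b0; apply: pb; rewrite b0; apply: ideal0 ip. Qed.

Let prod_notin m n b d : D m b -> D n d -> ~ p b -> ~ p d -> ~ p (b * d).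
Proof. by move=> Db Dd pb pd; apply: (primeNM pp) => //; apply: DR; eassumption. Qed.

Lemma hmax_mem n a b : D n a -> D n b -> ~ p b -> hmax (a / b) -> p a.
Proof.
move=> Da Db pb [m [c [d [Dc Dd pd pc E]]]].
have b0 := hloc_den_neq0 pb; have d0 := hloc_den_neq0 pd.
have Ead : a * d = c * b by move/eqP: E; rewrite eqr_div // => /eqP.
have pad : p (a * d) by rewrite Ead; apply: (idealMr ip) => //; apply: DR Db.
by have [] := primeM pp (DR Da) (DR Dd) pad.
Qed.

Lemma hloc_local : local_ring hloc hmax.
Proof.
have D0 n x : D n x -> D n 0 by move=> Dx; rewrite -(subrr x); apply: DB.
have DD n x y : D n x -> D n y -> D n (x + y).
  by move=> Dx Dy; rewrite -[y]opprK -[- y]sub0r; apply/DB/DB/Dy/(D0 _ y)/Dy.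
split.
- split.
  + by exists 0%N, 1, 1; rewrite divr1; split=> //; apply: primeN1 pp.
  + move=> _ _ [m [a [b [Da Db pb ->]]]] [n [c [d [Dc Dd pd ->]]]].
    have b0 := hloc_den_neq0 pb; have d0 := hloc_den_neq0 pd.
    exists (m + n)%N, (a * d - c * b), (b * d); split.
    * by apply: DB; [exact: DM|rewrite addnC; exact: DM].
    * exact: DM.
    * exact: prod_notin Db Dd pb pd.
    * by field; rewrite b0 d0.
  + move=> _ _ [m [a [b [Da Db pb ->]]]] [n [c [d [Dc Dd pd ->]]]].
    exists (m + n)%N, (a * c), (b * d); split; try exact: DM.
      exact: prod_notin Db Dd pb pd.
    by rewrite invfM mulrACA.
- split.
  + by move=> _ [n [a [b [Da Db pb _ ->]]]]; exists n, a, b.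
  + exists 0%N, 0, 1; rewrite mul0r; split=> //.
    * exact: D0 D1.
    * exact: primeN1 pp.
    * exact: ideal0 ip.
  + move=> _ _ [m [a [b [Da Db pb pa ->]]]] [n [c [d [Dc Dd pd pc ->]]]].
    have b0 := hloc_den_neq0 pb; have d0 := hloc_den_neq0 pd.
    exists (m + n)%N, (a * d + c * b), (b * d); split.
    * by apply: DD; [exact: DM|rewrite addnC; exact: DM].
    * exact: DM.
    * exact: prod_notin Db Dd pb pd.
    * apply: (idealD ip); apply: (idealMr ip) => //; first exact: DR Dd.
      exact: DR Db.
    * by field; rewrite b0 d0.
  + move=> _ _ [m [a [b [Da Db pb ->]]]] [n [c [d [Dc Dd pd pc ->]]]].
    exists (m + n)%N, (a * c), (b * d); split; try exact: DM.
    * exact: prod_notin Db Dd pb pd.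
    * by apply: (idealMl ip) => //; apply: DR Da.
    * by rewrite invfM mulrACA.
- have p1 := primeN1 pp; rewrite -(divr1 1) => H; apply: p1.
  exact: hmax_mem D1 D1 (primeN1 pp) H.
- move=> _ [n [a [b [Da Db pb ->]]]] ma; exists n, b, a.
  rewrite invf_div; split=> // pa; apply: ma; by exists n, a, b.
Qed.

End HomogeneousLocalization.

Section Points.
Context {F : finFieldType} {V : vectType F}.
Implicit Types (u v w : V) (c : F) (W : {vspace V}).

Local Notation K := (KV V).
Local Notation inv v := ((elt v)^-1 : K).

Let rR := RV_subring (V := V).

Lemma stalk_local p : prime_of (RV V) p ->
  local_ring (stalk p) (hmax (RVdeg V) p).
Proof.
move=> pp; apply: hloc_local pp _ _ _ _.
- exact: RVdeg_sub.
- by rewrite -scal1; apply: RVdeg_scal.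
- by move=> n x y Rx Ry; apply/RVdegD/RVdegN.
- exact: RVdegM.
Qed.

(** ** Strata of codimension at most one *)

Definition coordinate_ring_of W v1 (B : set K) := [/\ regular_ring B,
  forall c, B (scal c), forall w, w \in W -> B (elt w / elt v1)
  & forall L : set K, subring L -> (forall c, L (scal c)) ->
    (forall w, w \in W -> L (elt w / elt v1)) -> B `<=` L].

Lemma coordinate_ring_cons u W v1 (B : set K) : v1 \in W -> v1 != 0 ->
  u \notin W -> coordinate_ring_of W v1 B ->
  coordinate_ring_of (<[u]> + W) v1 (adj B (elt u / elt v1)).
Proof.
move=> Wv1 v10 Wu [regB Bs BW Bmin]; have [rB _ _] := regB.
have rA := adj_subring rB (elt u / elt v1).
have [L [rL Ls LW tr _]] := ratio_transcendental Wv1 v10 Wu.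
have BA : B `<=` adj B (elt u / elt v1) by apply: sub_adj.
split.
- apply: adj_regular => //; apply: transcendental_sub tr; exact: Bmin.
- by move=> c; apply: BA.
- move=> _ /memv_addP[_ /vlineP[c ->] [w Ww ->]].
  rewrite elt_is_linear mulrDl -mulrA; apply: (subringD rA).
    by apply: (subringM rA); [apply: BA; apply: Bs|exact: mem_adj].
  by apply: BA; apply: BW.
- move=> M rM Ms MW; apply: adj_min => //.
    apply: Bmin => // w Ww; apply: MW; exact: (subvP (addvSr _ _)) Ww.
  by apply: MW; apply: (subvP (addvSl _ _)); apply: memv_line.
Qed.

Lemma coordinate_ring_line v1 : v1 != 0 ->
  coordinate_ring_of <[v1]> v1 [set scal c | c in [set: F]].
Proof.
move=> v10; have sD c d : scal c - scal d = scal (c - d) :> K.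
  by rewrite scalD scalN.
have line c : elt (c *: v1) / elt v1 = scal c :> K.
  by rewrite eltZ mulfK // elt_eq0.
split.
- apply: field_regular; first split.
  + by exists 1 => //; apply: scal1.
  + by move=> _ _ [c _ <-] [d _ <-]; exists (c - d).
  + by move=> _ _ [c _ <-] [d _ <-]; exists (c * d) => //; apply: scalM.
  + by move=> _ [c _ <-]; exists c^-1 => //; apply: scalV.
- by move=> c; exists c.
- by move=> _ /vlineP[c ->]; exists c.
- by move=> L rL Ls _ _ [c _ <-].
Qed.

(** Affine coordinates on a subspace generate a ring with regular local rings,
    since they are successively transcendental. *)
Lemma coordinate_ring W : W != 0%VS -> exists v1 (B : set K),
  [/\ v1 \in W, v1 != 0 & coordinate_ring_of W v1 B].
Proof.
have /andP[/eqP] := vbasisP W; case/lastP: (tval (vbasis W)) => [|us v1] EW.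
  by rewrite -EW span_nil eqxx.
rewrite -{}EW => fr _; exists v1; elim: us fr => [|u us IH].
  rewrite /= seq1_free => v10; exists [set scal c | c in [set: F]].
  by rewrite span_seq1 memv_line; split=> //; apply: coordinate_ring_line.
rewrite rcons_cons free_cons span_cons => /andP[Wu /IH[B [Wv1 v10 HB]]].
exists (adj B (elt u / elt v1)); split=> //.
  exact: (subvP (addvSr _ _)) Wv1.
exact: coordinate_ring_cons.
Qed.

Lemma chart_fraction (L : fieldType) (u v1 vr c : L) : v1 != 0 -> vr != 0 ->
  u + c * vr != 0 ->
  v1 / (u + c * vr) = (v1 / vr) / ((v1 / vr) * (u / v1) + c).
Proof.
move=> v10 vr0 w0; have -> : v1 / vr * (u / v1) + c = (u + c * vr) / vr.
  by field; rewrite v10 vr0.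
by field; rewrite vr0 w0.
Qed.

Lemma frac_scale (L : fieldType) (a b t : L) : t != 0 ->
  a / b = (a * t) * (b * t)^-1.
Proof. by move=> t0; rewrite -mulf_div divff ?mulr1. Qed.

(** Homogeneous fractions of degree [n] can be written with numerator and
    denominator in the localization of [B], after multiplication of both by the
    [n]-th power of [v1]; hence the local ring at [p] is that localization. *)
Lemma regular_stalk_chart p v1 (B : set K) : prime_of (RV V) p ->
  v1 != 0 -> ~ p (inv v1) -> regular_ring B -> B `<=` stalk p ->
  (forall v, v != 0 -> loc B (B `&` hmax (RVdeg V) p) (elt v1 / elt v)) ->
  (forall c, B (scal c)) -> regular_local (stalk p).
Proof.
move=> pp v10 pv1 [rB nB regB] Bst frac Bs.
have lS := stalk_local pp; have [rS im m1 uS] := lS.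
have pm := local_prime lS.
set m := hmax (RVdeg V) p in lS im m1 uS pm frac *.
pose P := B `&` m; have pP : prime_of B P.
  split.
  - split.
    + by move=> x [].
    + by split; [exact: (subring0 rB)|exact: ideal0 im].
    + by move=> x y [Bx mx] [By my]; split; [exact: (subringD rB)|exact: (idealD im)].
    + move=> a x Ba [Bx mx]; split; first exact: (subringM rB).
      by apply: (idealMl im) => //; apply: Bst.
  - by case.
  - move=> a b Ba Bb [_ mab].
    by have [] := primeM pm (Bst _ Ba) (Bst _ Bb) mab; [left|right].
have lL := loc_local rB pP; have [rL _ _ uL] := lL.
suff -> : stalk p = loc B P by apply: regular_local_loc => //; exact: regB.
have ev1 : elt v1 != 0 :> K by rewrite elt_eq0.
have shift n a : RVdeg V n a -> loc B P (a * elt v1 ^+ n).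
  move: n a; apply: RVdeg_ind.
  - by move=> c; rewrite expr0 mulr1; apply: sub_loc => //; exact: Bs.
  - by move=> v v0; rewrite expr1 mulrC; apply: frac.
  - by move=> n; rewrite mul0r; apply: (subring0 rL).
  - by move=> n x y _ _ Lx Ly; rewrite mulrDl; apply: (subringD rL).
  - by move=> k n x y _ _ Lx Ly; rewrite exprD mulrACA; apply: (subringM rL).
apply/seteqP; split=> [x [n [a [b [Ra Rb pb ->]]]]|x [a [b [Ba Bb Pb ->]]]].
  rewrite (frac_scale a b (expf_neq0 n ev1)); apply: (subringM rL).
    exact: shift.
  apply: uL; first exact: shift.
  move=> [c [d [[Bc mc] Bd Pd E]]].
  have md : ~ m d by move=> md; apply: Pd.
  have mb : m (b / (inv v1) ^+ n).
    rewrite exprVn invrK E; apply: (idealMr im) => //.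
    by apply: uS => //; apply: Bst.
  apply: pb; apply: (hmax_mem pp (@RVdeg_sub _ V) Rb _ _ mb).
    by apply: RVdegX; apply: RVdeg_inv.
  by move/(primeX rR pp (RV_inv v10)).
apply: (subringM rS); first exact: Bst.
by apply: uS; [exact: Bst|move=> mb; apply: Pb].
Qed.

(** The coordinates on [V'], completed by [s = v1 / vr] if [V'] is a hyperplane,
    serve as a chart around [p]: the denominators that occur are units because
    [s] vanishes at [p]. *)
Lemma regular_stalk p (V' : {vspace V}) : prime_of (RV V) p -> V' != 0%VS ->
  (forall v, v != 0 -> (p (inv v) <-> v \notin V')) ->
  (\dim {:V} - \dim V' < 2)%N -> regular_local (stalk p).
Proof.
move=> pp V'0 pinv codim.
have lS := stalk_local pp; have [rS im m1 uS] := lS.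
have [v1 [B [Vv1 v10 [regB Bs BV Bmin]]]] := coordinate_ring V'0.
have pv1 : ~ p (inv v1) by move/(pinv _ v10); rewrite Vv1.
have frac v : v != 0 -> stalk p (elt v1 / elt v).
  move=> v0; exists 1%N, (inv v), (inv v1); rewrite invrK mulrC.
  by split=> //; apply: RVdeg_inv.
have Sscal c : stalk p (scal c).
  exists 0%N, (scal c), 1; rewrite divr1; split=> //; try exact: primeN1 pp.
    exact: RVdeg_scal.
  by rewrite -scal1; apply: RVdeg_scal.
have Bst : B `<=` stalk p.
  apply: Bmin => // w Vw; have [->|w0] := eqVneq w 0.
    by rewrite elt0 mul0r; apply: (subring0 rS).
  exists 1%N, (inv v1), (inv w); rewrite invrK mulrC; split=> //.
  - exact: RVdeg_inv.
  - exact: RVdeg_inv.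
  - by move/(pinv _ w0); rewrite Vw.
set m := hmax (RVdeg V) p in im m1 uS.
have unit_m x y : stalk p y -> x * y = 1 -> ~ m x.
  by move=> Sy E mx; apply: m1; rewrite -E; apply: (idealMr im).
have [rB _ _] := regB.
have fracV' (B' : set K) v : subring B' -> B `<=` B' -> v != 0 -> v \in V' ->
    loc B' (B' `&` m) (elt v1 / elt v).
  move=> rB' BB' v0 Vv; have ev0 : elt v != 0 :> K by rewrite elt_eq0.
  have ev1 : elt v1 != 0 :> K by rewrite elt_eq0.
  rewrite -invf_div; apply: (locV rB'); first by apply: BB'; apply: BV.
  case=> _; apply: unit_m (frac v v0) _; exact: (ratio_mulV ev1 ev0).
have [full|/existsNP[vr /negP Vr]] := pselect (forall v, v \in V').
  apply: (regular_stalk_chart pp v10 pv1 regB Bst _ Bs) => v v0.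
  exact: fracV'.
have vr0 : vr != 0 by apply: contraNneq Vr => ->; apply: mem0v.
pose s : K := elt v1 / elt vr; pose B' := adj B s.
have ms : m s.
  exists 1%N, (inv vr), (inv v1); rewrite invrK /s mulrC; split=> //.
  - exact: RVdeg_inv.
  - exact: RVdeg_inv.
  - exact/(pinv _ vr0).
have BB' : B `<=` B' by apply: sub_adj.
have regB' : regular_ring B'.
  have [L [rL Ls LW _ tr]] := ratio_transcendental Vv1 v10 Vr.
  by apply: adj_regular => //; apply: transcendental_sub tr; apply: Bmin.
have [rB' _ _] := regB'.
have Bst' : B' `<=` stalk p by apply: adj_min => //; apply: frac.
have full v : v \in (V' + <[vr]>)%VS.
  suff -> : (V' + <[vr]>)%VS = fullv by apply: memvf.
  apply/eqP; rewrite eqEdim subvf /=.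
  have : (\dim V' < \dim (V' + <[vr]>)%VS)%N.
    rewrite ltn_neqAle dimvS ?addvSl // andbT; apply: contra Vr => /eqP E.
    have /eqP -> : (V' == V' + <[vr]>)%VS by rewrite eqEdim addvSl E leqnn.
    by apply: (subvP (addvSr _ _)); apply: memv_line.
  by move: codim; lia.
apply: (regular_stalk_chart pp v10 pv1 regB' Bst') => [v v0|c]; last first.
  by apply: BB'; apply: Bs.
have [Vv|Vv] := boolP (v \in V'); first exact: fracV'.
have /memv_addP[u Vu [_ /vlineP[c ->] Ev]] := full v.
have c0 : c != 0.
  by apply: contraNneq Vv => c0; rewrite Ev c0 scale0r addr0.
have Ee : elt v = elt u + scal c * elt vr :> K by rewrite Ev eltD eltZ.
have ev1 : elt v1 != 0 :> K by rewrite elt_eq0.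
have evr : elt vr != 0 :> K by rewrite elt_eq0.
have ev : elt u + scal c * elt vr != 0 :> K by rewrite -Ee elt_eq0.
rewrite Ee (chart_fraction ev1 evr ev) -/s.
have Bs' : B' s by apply: mem_adj.
have Bu : B' (elt u / elt v1) by apply: BB'; apply: BV.
have Bc : B' (scal c) by apply: BB'; apply: Bs.
have Bsu : B' (s * (elt u / elt v1)) by apply: (subringM rB').
exists s, (s * (elt u / elt v1) + scal c); split=> //; first exact: (subringD rB').
case=> _ mden.
have mc : m (scal c).
  have -> : scal c = s * (elt u / elt v1) + scal c - s * (elt u / elt v1) :> K.
    by rewrite addrAC subrr add0r.
  by apply: (idealB rS im) => //; apply: (idealMr im) => //; apply: Bst'.
apply: unit_m (Sscal c^-1) _ mc; by rewrite -scalM divff // scal1.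
Qed.

(** ** Strata of codimension at least two *)

Lemma clear_denominators (L : fieldType)
    (t a1 a2 a3 g1 g2 g3 x y z e : L) :
  g1 != 0 -> g2 != 0 -> g3 != 0 -> e != 0 ->
  (g1 * g2 * g3 * e^-1) *
    (t * (a1 / g1 * (e / x) + a2 / g2 * (e / y) + a3 / g3 * (e / z))) =
  t * a1 * g2 * g3 * x^-1 + (t * a2 * g1 * g3 * y^-1 + t * a3 * g1 * g2 * z^-1).
Proof.
move=> g10 g20 g30 e0; move: (x^-1) (y^-1) (z^-1) => x' y' z'.
by field; rewrite g10 g20 g30 e0.
Qed.

Lemma relation_scale (L : fieldType) (e x y z : L) :
  x * y = z * (x + y) -> (e * x) * (e * y) = (e * x + e * y) * (e * z).
Proof. by move=> E; rewrite mulrACA E; ring. Qed.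

Lemma mul_num_den (L : fieldType) (a b t x : L) : b != 0 ->
  t * b * (a / b * x) = a * (t * x).
Proof. by move=> b0; field; rewrite b0. Qed.

Lemma mul_dens (L : fieldType) (a b c d : L) : b != 0 -> d != 0 ->
  b * d * (a / b * (c / d)) = a * c.
Proof. by move=> b0 d0; field; rewrite b0 d0. Qed.

Lemma mul_dens_add (L : fieldType) (t s x y : L) :
  t * s * (x + y) = s * (t * x) + t * (s * y).
Proof. by ring. Qed.

Section NotRegular.
Variables (V' : {vspace V}) (p : set K) (phi : K -> KV (subvs_of V')).
Variable q : set (KV (subvs_of V')).
Hypotheses (pp : prime_of (RV V) p) (res : is_restriction V' phi).
Hypotheses (pq : prime_of (RV (subvs_of V')) q).
Hypothesis pE : forall x, p x <-> RV V x /\ q (phi x).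

Local Notation m := (hmax (RVdeg V) p).

Let ip : ideal_of (RV V) p := prime_ideal pp.
Let iq : ideal_of (RV (subvs_of V')) q := prime_ideal pq.
Let lS := stalk_local pp.

(** The derivation attached to a vector [v] outside [V'] kills [m ^ 2] modulo
    [q], and among the reciprocals of [v] and of vectors outside [V' + <v>] it
    detects only that of [v]. *)
Lemma square_coefficient v1 v w1 w2 (a b c : K) : v1 != 0 -> ~ p (inv v1) ->
  v \notin V' -> w1 \notin (V' + <[v]>)%VS -> w2 \notin (V' + <[v]>)%VS ->
  stalk p a -> stalk p b -> stalk p c ->
  square_ideal (stalk p) m
    (a * (elt v1 / elt v) + b * (elt v1 / elt w1) + c * (elt v1 / elt w2)) ->
  m a.
Proof.
move=> v10 pv1 Vv Vw1 Vw2 Sa Sb Sc.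
have [delta [dR dD dM dv dw]] := restriction_derivation res Vv.
have [ps pD pM pV' pV] := res; have [rS _ _ _] := lS.
have notin_sub w : w \notin (V' + <[v]>)%VS -> w \notin V'.
  by apply: contra; apply: (subvP (addvSl _ _)).
have neq0 w : w \notin V' -> w != 0 by apply: contraNneq => ->; apply: mem0v.
have p1 := primeN1 pp; have den0 n g : RVdeg V n g -> ~ p g -> g != 0.
  by move=> _ pg; exact: (hloc_den_neq0 pp pg).
pose small z := p z /\ q (delta z).
have smallD x y : small x -> small y -> small (x + y).
  move=> [px qx] [py qy]; split; first exact: (idealD ip).
  by rewrite (dD _ _ (idealS ip px) (idealS ip py)); apply: (idealD iq).
have smallM r x : RV V r -> small x -> small (r * x).
  move=> Rr [px qx]; have [Rx qpx] := (pE x).1 px.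
  split; first exact: (idealMl ip).
  rewrite (dM _ _ Rr Rx); apply: (idealD iq).
    by apply: (idealMl iq) => //; apply: restriction_RV.
  by apply: (idealMl iq) => //; apply: dR.
have smallMp x y : p x -> p y -> small (x * y).
  move=> /pE[Rx qx] /pE[Ry qy]; split.
    by apply: (idealMl ip) => //; apply/pE.
  rewrite (dM _ _ Rx Ry); apply: (idealD iq).
    by apply: (idealMr iq) => //; apply: dR.
  by apply: (idealMl iq) => //; apply: dR.
have small0 : small 0.
  by have := smallMp 0 0 (ideal0 ip) (ideal0 ip); rewrite mul0r.
pose I : set K := [set x | stalk p x /\
  exists t, [/\ RV V t, ~ p t & small (t * x)]].
have iI : ideal_of (stalk p) I.
  split.
  - by move=> x [].
  - split; first exact: (subring0 rS).
    by exists 1; rewrite mulr0; split=> //; exact: (subring1 rR).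
  - move=> x y [Sx [t [Rt pt tx]]] [Sy [s [Rs pos sy]]].
    split; first exact: (subringD rS).
    exists (t * s); split; [exact: (subringM rR)|exact: (primeNM pp)|].
    by rewrite mul_dens_add; apply: smallD; apply: smallM.
  - move=> _ x [n [g [h [Rg Rh ph ->]]]] [Sx [t [Rt pt tx]]].
    split; first by apply: (subringM rS) => //; exists n, g, h.
    exists (t * h); split.
    + by apply: (subringM rR) => //; apply: RVdeg_sub Rh.
    + by apply: (primeNM pp) => //; apply: RVdeg_sub Rh.
    + rewrite (mul_num_den _ _ _ (den0 _ _ Rh ph)).
      by apply: smallM => //; apply: RVdeg_sub Rg.
have sqI : square_ideal (stalk p) m `<=` I.
  apply: smallest_sub => //.
  move=> _ [_ [_ [[n [g [h [Rg Rh ph pg ->]]]] [k [g' [h' [Rg' Rh' ph' pg' ->]]]] ->]]].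
  split.
    by apply: (subringM rS); [exists n, g, h|exists k, g', h'].
  exists (h * h'); split.
  - by apply: (subringM rR); [apply: RVdeg_sub Rh|apply: RVdeg_sub Rh'].
  - by apply: (primeNM pp) => //; [apply: RVdeg_sub Rh|apply: RVdeg_sub Rh'].
  - by rewrite (mul_dens _ _ (den0 _ _ Rh ph) (den0 _ _ Rh' ph')); apply: smallMp.
move=> /sqI[_ [t [Rt pt]]].
have [n1 [a1 [g1 [Ra1 Rg1 pg1 Ea]]]] := Sa.
have [n2 [a2 [g2 [Ra2 Rg2 pg2 Eb]]]] := Sb.
have [n3 [a3 [g3 [Ra3 Rg3 pg3 Ec]]]] := Sc.
have [[Ra1' Rg1'] [Ra2' Rg2'] [Ra3' Rg3']] : [/\ RV V a1 /\ RV V g1,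
    RV V a2 /\ RV V g2 & RV V a3 /\ RV V g3].
  by split; split; apply: RVdeg_sub; eassumption.
have ev1 : elt v1 != 0 :> K by rewrite elt_eq0.
have Rr : RV V (g1 * g2 * g3 * inv v1).
  by do !apply: (subringM rR) => //; exact: RV_inv.
move=> /(smallM _ _ Rr)[_]; rewrite Ea Eb Ec.
rewrite (clear_denominators _ _ _ _ _ _ _ (den0 _ _ Rg1 pg1) (den0 _ _ Rg2 pg2)
  (den0 _ _ Rg3 pg3) ev1).
have R1 : RV V (t * a1 * g2 * g3) by do !apply: (subringM rR) => //.
have R2 : RV V (t * a2 * g1 * g3) by do !apply: (subringM rR) => //.
have R3 : RV V (t * a3 * g1 * g2) by do !apply: (subringM rR) => //.
have Vw1' := notin_sub _ Vw1; have Vw2' := notin_sub _ Vw2.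
have Rv := RV_inv (neq0 _ Vv); have Rw1 := RV_inv (neq0 _ Vw1').
have Rw2 := RV_inv (neq0 _ Vw2').
rewrite (dD _ _ (subringM rR R1 Rv)
  (subringD rR (subringM rR R2 Rw1) (subringM rR R3 Rw2))).
rewrite (dD _ _ (subringM rR R2 Rw1) (subringM rR R3 Rw2)).
rewrite (dM _ _ R1 Rv) (dM _ _ R2 Rw1) (dM _ _ R3 Rw2).
rewrite dv (dw _ Vw1) (dw _ Vw2) (pV _ Vv) (pV _ Vw1') (pV _ Vw2').
rewrite !mulr0 !addr0 mulr1 => qa; have pa : p (t * a1 * g2 * g3) by apply/pE.
exists n1, a1, g1; split=> //.
have [pa'|//] := primeM pp (subringM rR (subringM rR Rt Ra1') Rg2') Rg3' pa.
have [pa''|//] := primeM pp (subringM rR Rt Ra1') Rg2' pa'.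
by have [|] := primeM pp Rt Ra1' pa''.
Qed.

End NotRegular.

Lemma addv_line_exchange (V' : {vspace V}) v w :
  v \notin V' -> w \notin (V' + <[v]>)%VS -> v \notin (V' + <[w]>)%VS.
Proof.
move=> Vv; apply: contra => /memv_addP[u Vu [_ /vlineP[c ->] Ev]].
have c0 : c != 0.
  by apply: contraNneq Vv => c0; rewrite Ev c0 scale0r addr0.
have -> : w = - c^-1 *: u + c^-1 *: v.
  by rewrite Ev scalerDr scalerA mulVf // scale1r scaleNr addKr.
by apply: memv_add; [apply: memvZ|apply/memvZ/memv_line].
Qed.

Lemma addv_line_add (V' : {vspace V}) v w :
  (v + w \in (V' + <[v]>)%VS) = (w \in (V' + <[v]>)%VS).
Proof.
by rewrite rpredDl //; apply: (subvP (addvSr _ _)); apply: memv_line.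
Qed.

Lemma singular_stalk (V' : {vspace V}) p : V' != 0%VS -> stratum V' p ->
  (2 <= \dim {:V} - \dim V')%N -> ~ regular_local (stalk p).
Proof.
move=> V'0 Sp codim.
have [[pp _ _] pinv [phi [q [res pq pE]]]] := stratum_properties V'0 Sp.
have lS := stalk_local pp.
have [v1 Vv1 v10] : exists2 v1, v1 \in V' & v1 != 0.
  by exists (vpick V'); [exact: memv_pick|rewrite vpick0].
have pv1 : ~ p (inv v1) by move/(pinv _ v10); rewrite Vv1.
have outside W : (\dim W < \dim {:V})%N -> exists v, v \notin W.
  move=> lt; apply: contrapT => no; move: lt; rewrite ltnNge => /negP; apply.
  apply/dimvS/subvP => v _; apply: contrapT => /negP Wv; apply: no; by exists v.
have [v Vv] : exists v, v \notin V' by apply: outside; lia.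
have [w Vw] : exists w, w \notin (V' + <[v]>)%VS.
  apply: outside; apply: leq_ltn_trans (dimv_add_leqif V' <[v]>%VS).1 _.
  rewrite dim_vline; case: (v != 0); lia.
have Vv' := addv_line_exchange Vv Vw.
have Vw' : w \notin V' by apply: contra Vw; apply: (subvP (addvSl _ _)).
have Vvw1 : v + w \notin (V' + <[v]>)%VS by rewrite addv_line_add.
have Vvw2 : v + w \notin (V' + <[w]>)%VS by rewrite addrC addv_line_add.
have Vvw : v + w \notin V' by apply: contra Vvw1; apply: (subvP (addvSl _ _)).
have Vv3 := addv_line_exchange Vv Vvw1.
have Vw3 := addv_line_exchange Vw' Vvw2.
have neq0 u : u \notin V' -> u != 0 by apply: contraNneq => ->; apply: mem0v.
have mfrac u : u \notin V' -> hmax (RVdeg V) p (elt v1 / elt u).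
  move=> Vu; exists 1%N, (inv u), (inv v1); rewrite invrK mulrC; split=> //.
  - exact/RVdeg_inv/neq0.
  - exact: RVdeg_inv.
  - by apply/pinv; first exact: neq0.
apply: (quadratic_not_regular lS (mfrac v Vv) (mfrac w Vw') (mfrac (v + w) Vvw)).
  have E := elt_invD (neq0 _ Vv) (neq0 _ Vw') (neq0 _ Vvw).
  exact: relation_scale E.
move=> a b c Sa Sb Sc sq; split.
- exact: (square_coefficient pp res pq pE v10 pv1 Vv Vw Vvw1 Sa Sb Sc sq).
- apply: (square_coefficient pp res pq pE v10 pv1 Vw' Vv' Vvw2 Sb Sa Sc).
  by rewrite [b * _ + _]addrC.
- apply: (square_coefficient pp res pq pE v10 pv1 Vvw Vv3 Vw3 Sc Sa Sb).
  by rewrite -addrA addrC.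
Qed.

End Points.

Theorem theorem8p4 (F : finFieldType) (V : vectType F)
    (hV : (0 < \dim {:V})%N) :
  singular_locus V =
  \bigcup_(V' in [set V' : {vspace V} |
                   V' != 0%VS /\ (2 <= \dim {:V} - \dim V')%N]) stratum V'.
Proof.
apply/seteqP; split=> p; last first.
  move=> [V' [V'0 codim] Sp]; have [Qp _ _] := stratum_properties V'0 Sp.
  by split=> //; apply: singular_stalk Sp codim.
move=> [Qp sing]; have [V' [V'0 pinv]] := support Qp; have [pp _ _] := Qp.
exists V'; last exact: mem_stratum.
split=> //; rewrite leqNgt; apply/negP => codim.
by apply: sing; apply: regular_stalk codim.
Qed.
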